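(* Let $A$ be a commutative $C^*$-algebra and let $E_A$ be a countably generated Hilbert $A$-module. The trace $\operatorname{tr}\colon\mathcal L^1(E_A)\to A$, $\operatorname{tr}T:=\langle S^*,|T|^{1/2}\rangle_2$ where $T=S|T|^{1/2}$ is a weak polar decomposition, is well-defined. Moreover, if $\mathfrak e=(\mathfrak e_i)_{i\ge1}$ is a frame of $E_A$, then for every $T\in\mathcal L^1(E_A)$ the series $\sum_i\langle\mathfrak e_i,T\mathfrak e_i\rangle$ converges in norm to $\operatorname{tr}T$.
   Context: $\mathcal L(E_A)$ is the $C^*$-algebra of adjointable operators. $\widehat A$ is the space of characters of $A$, so $A\cong C_0(\widehat A)$. For $\chi\in\widehat A$, $\chi_*E_A:=E_A\otimes_A\mathbb C$ (with $A$ acting on $\mathbb C$ via $\chi$), and $\chi_*T:=T\otimes1$ for $T\in\mathcal L(E_A)$. For $1\le p<\infty$, $\mathcal L^p(E_A)$ is the set of $T\in\mathcal L(E_A)$ for which $\operatorname{tr}|T|^p\colon\chi\mapsto\operatorname{tr}|\chi_*T|^p$ lies in $A\cong C_0(\widehat A)$; it is a two-sided ideal closed under adjoints. For $S,T\in\mathcal L^2(E_A)$, $\langle S,T\rangle_2:=\frac14\sum_{k\in\mathbb Z/4\mathbb Z}i^k\operatorname{tr}|T+i^kS|^2\in A$. A weak polar decomposition of $T\in\mathcal L^1(E_A)$ is a factorization $T=S|T|^{1/2}$ with $S\in\mathcal L(E_A)$, $|S|=|T|^{1/2}$; then $S,|T|^{1/2}\in\mathcal L^2(E_A)$. ''Well-defined''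 means that the value $\langle S^*,|T|^{1/2}\rangle_2$ does not depend on the decomposition used. A frame of $E_A$ is a sequence $(\mathfrak e_i)_{i\ge1}$ in $E_A$ such that $\langle v,w\rangle=\sum_{i=1}^\infty\langle v,\mathfrak e_i\rangle\langle\mathfrak e_i,w\rangle$ in norm for all $v,w\in E_A$. *)

(* Defs.v *)
From HB Require Import structures.
From mathcomp Require Import all_boot all_order all_algebra.
From mathcomp Require Import complex.
From mathcomp Require Import all_classical all_reals all_analysis.

Set Implicit Arguments.
Unset Strict Implicit.
Unset Printing Implicit Defensive.

Import Order.TTheory GRing.Theory Num.Theory.
Import numFieldNormedType.Exports.

Local Open Scope classical_set_scope.
Local Open Scope complex_scope.
Local Open Scope ring_scope.

(* The product is a bare operation because [A] need not have a unit, whereas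
   the ring structures of MathComp do.  The norm of a complex normed module is
   [R[i]]-valued (with nonnegative real values). *)
HB.mixin Record isCommCStarAlgebra (R : realType) A
    of CompleteNormedModule R[i] A := {
  cmul : A -> A -> A;
  cstar : A -> A;
  cmulA : associative cmul;
  cmulC : commutative cmul;
  cmulDl : left_distributive cmul +%R;
  cmulZl : forall (c : R[i]) a b, cmul (c *: a) b = c *: cmul a b;
  cmul_norm_le : forall a b, `|cmul a b| <= `|a| * `|b|;
  cstarK : involutive cstar;
  cstarD : {morph cstar : a b / a + b};
  cstarZ : forall (c : R[i]) a, cstar (c *: a) = c^* *: cstar a;
  cstarM : forall a b, cstar (cmul a b) = cmul (cstar b) (cstar a);
  cstar_identity : forall a, `|cmul (cstar a) a| = `|a| ^+ 2
}.

#[short(type="commCStarAlgType")]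
HB.structure Definition CommCStarAlgebra (R : realType) :=
  {A of isCommCStarAlgebra R A & CompleteNormedModule R[i] A}.

(* Complex vector space with a right [A]-action and an [A]-valued inner
   product, linear in the second variable and conjugate linear in the first,
   complete for the norm |<v, v>|^(1/2).  Definiteness of the inner product is
   contained in [cip_norm]. *)
HB.mixin Record isHilbertModule (R : realType) (A : commCStarAlgType R) E
    of CompleteNormedModule R[i] E := {
  cact : E -> A -> E;
  cip : E -> E -> A;
  cactDl : forall v w a, cact (v + w) a = cact v a + cact w a;
  cactDr : forall v a b, cact v (a + b) = cact v a + cact v b;
  cactZl : forall (c : R[i]) v a, cact (c *: v) a = c *: cact v a;
  cactZr : forall (c : R[i]) v a, cact v (c *: a) = c *: cact v a;
  cactA : forall v a b, cact (cact v a) b = cact v (cmul a b);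
  cipDr : forall v w x, cip v (w + x) = cip v w + cip v x;
  cipZr : forall (c : R[i]) v w, cip v (c *: w) = c *: cip v w;
  cip_act : forall v w a, cip v (cact w a) = cmul (cip v w) a;
  cip_star : forall v w, cstar (cip v w) = cip w v;
  cip_ge0 : forall v, exists a, cip v v = cmul (cstar a) a;
  cip_norm : forall v, `|v| ^+ 2 = `|cip v v|
}.

#[short(type="hilbertModType")]
HB.structure Definition HilbertModule (R : realType) (A : commCStarAlgType R) :=
  {E of isHilbertModule R A E & CompleteNormedModule R[i] E}.

(* The C*-algebra of complex numbers; a Hilbert module over it is a Hilbert
   space. *)
Section complex_numbers.
Variable R : realType.

Lemma normc_ge_Im (z : R[i]) : `|complex.Im z|%:C <= `|z|.
Proof.
by rewrite normc_def lecR -sqrtr_sqr ler_sqrt ?lerDr ?addr_ge0 ?sqr_ge0.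
Qed.

Lemma normc_le_ReIm (z : R[i]) :
  `|z| <= (`|complex.Re z| + `|complex.Im z|)%:C.
Proof.
rewrite normc_def lecR -[leRHS]ger0_norm ?addr_ge0//.
rewrite -sqrtr_sqr ler_sqrt ?sqr_ge0// sqrrD !real_normK ?num_real//.
by rewrite -addrA lerD2l lerDr mulrn_wge0 ?mulr_ge0.
Qed.

Lemma cauchy_lipschitz1_cvg (F : set_system R[i]^o) (f : R[i] -> R) :
  ProperFilter F -> cauchy F -> (forall x y, `|f x - f y|%:C <= `|x - y|) ->
  cvg (f @ F).
Proof.
move=> FF /cauchy_ballP Fc fle.
apply: R_complete; apply/cauchy_ballP => e e0.
have := Fc e%:C; rewrite ltcR => /(_ e0).
case=> -[A B] /= [FA FB] AB; exists (f @` A, f @` B) => /=.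
  by split; [apply: filterS FA | apply: filterS FB] => z; exists z.
move=> [_ _] [[x Ax <-] [y By <-]]; have /(_ (conj Ax By)) := AB (x, y).
by rewrite -!ball_normE /ball_ /= => /(le_lt_trans (fle _ _)); rewrite ltcR.
Qed.

Lemma complex_complete (F : set_system R[i]^o) :
  ProperFilter F -> cauchy F -> cvg F.
Proof.
move=> FF Fc.
have /cvg_ex[a Fa] : cvg ((@complex.Re R) @ F).
  apply: cauchy_lipschitz1_cvg => // x y; rewrite -raddfB; exact: normc_ge_Re.
have /cvg_ex[b Fb] : cvg ((@complex.Im R) @ F).
  apply: cauchy_lipschitz1_cvg => // x y; rewrite -raddfB; exact: normc_ge_Im.
apply/cvg_ex; exists (a +i* b).
apply/cvgrPdist_lt => e e0.
have er : e = (complex.Re e)%:C by case: e e0 => ? ? /andP[/eqP ->].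
have re0 : 0 < complex.Re e by rewrite -ltcR -er.
near=> z; apply: (le_lt_trans (normc_le_ReIm _)).
rewrite er ltcR (splitr (complex.Re e)) !raddfB/=.
by apply: ltrD; near: z; [move/cvgrPdist_lt: Fa|move/cvgrPdist_lt: Fb];
  apply; rewrite divr_gt0.
Unshelve. all: by end_near.
Qed.

(* An alias is needed because completeness of [K^o] is already registered by
   the library, for [K] a real type only. *)
Definition complexC : Type := R[i]^o.
HB.instance Definition _ := NormedModule.copy complexC R[i]^o.
HB.instance Definition _ := Uniform_isComplete.Build complexC complex_complete.

Lemma complexC_mulA : associative (fun a b : complexC => a * b : R[i]).
Proof. exact: mulrA. Qed.
Lemma complexC_mulZl (c : R[i]) (a b : complexC) :
  ((c *: a) : R[i]) * b = c *: (a * b : complexC).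
Proof. exact/esym/mulrA. Qed.
Lemma complexC_norm_le (a b : complexC) :
  `|(a * b : R[i]) : complexC| <= `|a| * `|b|.
Proof. by rewrite -normrM. Qed.
Lemma complexC_starM (a b : complexC) :
  (a * b : R[i])^* = (b : R[i])^* * (a : R[i])^* .
Proof. by rewrite rmorphM mulrC. Qed.
Lemma complexC_star_identity (a : complexC) :
  `|((a : R[i])^* * a : R[i]) : complexC| = `|a| ^+ 2.
Proof. by rewrite normrM normcJ -expr2. Qed.

HB.instance Definition _ := isCommCStarAlgebra.Build R complexC
  complexC_mulA (@mulrC R[i]) (@mulrDl R[i]) complexC_mulZl complexC_norm_le
  (@conjcK R) (rmorphD (@conjc R)) (rmorphM (@conjc R)) complexC_starM
  complexC_star_identity.

End complex_numbers.

Section hilbert_module.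
Context {R : realType} {A : commCStarAlgType R} {E : hilbertModType A}.
Implicit Types (S T P Q : E -> E) (X : set E).

Definition module_span X : set E :=
  [set v | exists n (x : 'I_n -> E) (a : 'I_n -> A),
     (forall i, X (x i)) /\ v = \sum_(i < n) cact (x i) (a i)].

(* [X] itself lies in the closure below, even when [A] has no unit. *)
Definition generates X := closure (module_span X) = [set: E].

Definition is_adjoint T S := forall v w, cip (T v) w = cip v (S w).

Definition adjointable T := exists S, is_adjoint T S.

(* Here and below, [xget] selects an object that is unique when it exists:
   the adjoint, the positive square root, and so on. *)
Definition adj T : E -> E := xget (cst 0) [set S | is_adjoint T S].

Definition op_positive P := exists2 Q, adjointable Q & P = adj Q \o Q.

Definition sqrt_op P : E -> E :=
  xget (cst 0) [set Q | [/\ adjointable Q, op_positive Q & Q \o Q = P]].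

Definition abs_op T := sqrt_op (adj T \o T).

Definition frame (e : nat -> E) := forall v w,
  series (fun i => cmul (cip v (e i)) (cip (e i) w)) @ \oo --> cip v w.

End hilbert_module.

Definition countably_generated {R : realType} {A : commCStarAlgType R}
    (E : hilbertModType A) :=
  exists2 X : set E, countable X & generates X.

Section hilbert_space_trace.
Context {R : realType} {H : hilbertModType (complexC R)}.

Definition orthonormal_basis (B : set H) :=
  (forall e f, B e -> B f -> cip e f = (e == f)%:R) /\ generates B.

(* The trace, in [0, +oo], of a positive operator of a Hilbert space; it does
   not depend on the orthonormal basis. *)
Definition has_trace (P : H -> H) (t : \bar R) :=
  exists2 B, orthonormal_basis B &
    t = \esum_(e in B) (complex.Re (cip e (P e)))%:E.

End hilbert_space_trace.

Section localization.
Context {R : realType} {A : commCStarAlgType R}.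
Implicit Types (chi : A -> complexC R).

Definition is_character chi :=
  [/\ forall (c : R[i]) a b, chi (c *: a + b) = c *: chi a + chi b,
      forall a b, chi (cmul a b) = cmul (chi a) (chi b)
    & exists a, chi a != 0].

(* The interior tensor product of [E] with the complex numbers along [chi]:
   the completion of the algebraic tensor product for the inner product
   below.  It is defined up to a unique unitary isomorphism. *)
Record interior_tensor (E : hilbertModType A) chi := InteriorTensor {
  tensor_space :> hilbertModType (complexC R);
  tens : E -> complexC R -> tensor_space;
  tensDl : forall v w z, tens (v + w) z = tens v z + tens w z;
  tensDr : forall v z y, tens v (z + y) = tens v z + tens v y;
  tensZl : forall (c : R[i]) v z, tens (c *: v) z = c *: tens v z;
  tens_balanced : forall v a z, tens (cact v a) z = tens v (cmul (chi a) z);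
  tens_act : forall v z c, cact (tens v z) c = tens v (cmul z c);
  cip_tens : forall v w z y, cip (tens v z) (tens w y) =
    cmul (cstar z) (cmul (chi (cip v w)) y);
  tens_generates : generates [set tens p.1 p.2 | p in [set: E * complexC R]]
}.

Context {E : hilbertModType A}.
Implicit Types (S T : E -> E).

(* The operator [T (x) 1]. *)
Definition localize chi (H : interior_tensor E chi) T : H -> H :=
  xget (cst 0) [set S : H -> H | adjointable S /\
    forall v z, S (tens H v z) = tens H (T v) z].
Arguments localize {chi} H T.

(* [t] is tr |chi_* T|^p; the choice of a model of the tensor product is
   immaterial. *)
Definition has_trace_abs_pow (p : nat) T chi (t : \bar R) :=
  exists H : interior_tensor E chi,
    has_trace (iter p (abs_op (localize H T))) t.

(* The function [chi |-> tr |chi_* T|^p] is finite and is the Gelfand transform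
   of [a]. *)
Definition is_tr_abs_pow (p : nat) T (a : A) :=
  forall chi, is_character chi ->
  exists2 t : R, has_trace_abs_pow p T chi t%:E & chi a = t%:C.

Definition tr_abs_pow (p : nat) T : A := xget 0 (is_tr_abs_pow p T).

Definition schatten (p : nat) : set (E -> E) :=
  [set T | adjointable T /\ exists a, is_tr_abs_pow p T a].

Definition schatten2_ip S T : A :=
  (4%:R^-1 : R[i]) *:
    \sum_(k < 4) ('i%C ^+ k : R[i]) *:
      tr_abs_pow 2 (fun v => T v + ('i%C ^+ k : R[i]) *: S v).

(* T = S |T|^(1/2) with |S| = |T|^(1/2) *)
Definition weak_polar T S :=
  [/\ adjointable S, T = S \o sqrt_op (abs_op T)
    & abs_op S = sqrt_op (abs_op T)].

Definition tr T : A := xget 0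
  [set schatten2_ip (adj S) (sqrt_op (abs_op T)) | S in weak_polar T].

End localization.

(* Main.v *)
(* Everything is checked on characters, so the order of the algebra is never needed:
   minimal uniform seminorms yield, for each [b != 0], a character [chi] with
   [|chi b| = |b|], and inequalities between elements or operators become scalar
   inequalities for the forms [chi <v, w>].

   In the fiber over [chi] the image of a frame [e_i] satisfies Parseval's identity,
   hence so does the double sum of [|<e_i, T b>|^2] over an orthonormal basis [b], and
   [tr |chi_* T|^2 = sum_i chi <T e_i, T e_i>].  When this is the transform of an
   element of the algebra the series converges in norm, by Dini's theorem.  With
   [Q = |T|^(1/2)] and [T = S Q], it applies to [Q], [S^*] and, by Cauchy's criterion,
   to [Q + i^k S^*]; polarization then gives
   [<S^*, Q>_2 = sum_i <S^* e_i, Q e_i> = sum_i <e_i, T e_i>], and the right-hand side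
   does not involve [S].  A frame exists because the module is countably generated. *)
Require Import Defs.
From HB Require Import structures.
From mathcomp Require Import all_boot all_order all_algebra.
From mathcomp Require Import complex finmap.
From mathcomp Require Import all_classical all_reals all_analysis.
From mathcomp Require Import ring lra.

Set Implicit Arguments.
Unset Strict Implicit.
Unset Printing Implicit Defensive.

Import Order.TTheory GRing.Theory Num.Theory.
Import numFieldNormedType.Exports.

Local Open Scope classical_set_scope.
Local Open Scope complex_scope.
Local Open Scope ring_scope.

(** * Real-valued norms *)

(** Since [A] need not have a unit, inverses and spectra give way to seminorms and to multiplication
    by an auxiliary element, and roots of operators are limits of polynomials. The main obstacle is
    uniformity: finiteness of a trace concerns one fiber at a time, while the conclusion is
    convergence in norm, uniform over all fibers. Dini's theorem bridges the two once the sum is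
    known to be the transform of an element of [A]. For [Q] this is the hypothesis on [T]; for [S]
    it follows from [|S v| = |Q v|] in every fiber, and for [S^*] from the symmetry of the double
    sum. For [Q + i^k S^*] no element is given: it is produced as the limit of the partial sums,
    whose increments are at most twice those of [Q] and [S^*] together. Comparing two decompositions
    requires one sequence that serves both, and this is where countable generation enters. That
    sequence only has to satisfy Parseval's identity in each fiber, so its construction involves
    pointwise limits alone. *)

Section real_norm.
Context {R : realType}.

(* The norm of a complex normed module is [R[i]]-valued; [rn] is its real value. *)
Definition rn {V : normedZmodType R[i]} (v : V) : R := complex.Re `|v|.

Section normedZmod.
Context {V : normedZmodType R[i]}.
Implicit Types v w : V.

Lemma rnE v : (rn v)%:C = `|v|.
Proof. by rewrite /rn RRe_real// normr_real. Qed.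

Lemma rn_ge0 v : 0 <= rn v.
Proof. by rewrite -ler0c rnE. Qed.

Lemma rn0 : rn (0 : V) = 0.
Proof. by rewrite /rn normr0. Qed.

Lemma rnN v : rn (- v) = rn v.
Proof. by rewrite /rn normrN. Qed.

Lemma rnD v w : rn (v + w) <= rn v + rn w.
Proof. by rewrite -lecR rmorphD/= !rnE ler_normD. Qed.

Lemma rnB v w : rn (v - w) = rn (w - v).
Proof. by rewrite /rn distrC. Qed.

Lemma rn_eq0 v : rn v = 0 -> v = 0.
Proof. by move=> v0; apply/eqP; rewrite -normr_eq0 -rnE v0. Qed.

Lemma rn_gt0 v : v <> 0 -> 0 < rn v.
Proof. by move=> v0; rewrite lt0r rn_ge0 andbT; apply/eqP => /rn_eq0. Qed.

End normedZmod.

Lemma rnZ (V : normedModType R[i]) (c : R[i]) (v : V) :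
  rn (c *: v) = rn c * rn v.
Proof. by apply: complexI; rewrite rmorphM/= !rnE normrZ. Qed.

Lemma rnM (x y : R[i]) : rn (x * y) = rn x * rn y.
Proof. by apply: complexI; rewrite rmorphM/= !rnE normrM. Qed.

Lemma rnC (x : R) : rn x%:C = `|x|.
Proof. by rewrite /rn normc_def/= expr0n addr0 sqrtr_sqr. Qed.

Lemma rn_sqr (z : R[i]) : rn z ^+ 2 = complex.Re z ^+ 2 + complex.Im z ^+ 2.
Proof. by rewrite /rn normc_def/= sqr_sqrtr// addr_ge0 ?sqr_ge0. Qed.

Lemma Re_le_rn (z : R[i]) : complex.Re z <= rn z.
Proof.
by rewrite -lecR rnE (le_trans _ (normc_ge_Re z))// lecR ler_norm.
Qed.

Lemma rn_conj (z : R[i]) : rn z^*%C = rn z.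
Proof. by rewrite /rn normcJ. Qed.

Lemma cvg_rnP (V : normedModType R[i]) (u : nat -> V) (l : V) :
  (u @ \oo --> l) <->
  (forall e : R, 0 < e -> exists N, forall n, (N <= n)%N -> rn (l - u n) <= e).
Proof.
split=> [/cvgrPdist_le ul e e0|ul].
  have [|N _ ulN] := ul e%:C; first by rewrite ltcR.
  by exists N => n /ulN; rewrite -rnE lecR.
apply/cvgrPdist_le => e e0.
have er : e = (complex.Re e)%:C by case: e e0 => ? ? /andP[/eqP ->].
have [|N ulN] := ul (complex.Re e); first by rewrite -ltcR -er.
by exists N => // n /ulN; rewrite -lecR rnE -er.
Qed.

(** Keeping the rate together with the limit lets later identities between limits be proved by
    bounding a norm by a null sequence. *)
Lemma cauchy_rate (V : completeNormedModType R[i]) (u : nat -> V) (e : nat -> R) :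
  (forall n m, (n <= m)%N -> rn (u m - u n) <= e n) -> e @ \oo --> (0 : R) ->
  exists2 l, u @ \oo --> l & forall n, rn (l - u n) <= e n.
Proof.
move=> ue /cvgrPdist_le e0.
have /cvg_ex[l ul] : cvg (u @ \oo).
  apply: cauchy_cvg; apply: cauchy_exP => eps eps0.
  have er : eps = (complex.Re eps)%:C by case: eps eps0 => ? ? /andP[/eqP ->].
  have h0 : 0 < complex.Re eps / 2 by rewrite divr_gt0// -ltcR -er.
  have [N _ eN] := e0 _ h0; exists (u N); exists N => // m /= Nm.
  rewrite -ball_normE /ball_/= er -rnE ltcR rnB (le_lt_trans (ue _ _ Nm))//.
  rewrite (le_lt_trans (ler_norm _))// -[e N]opprK normrN -sub0r.
  by rewrite (le_lt_trans (eN N _))//=; lra.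
exists l => // n; apply/ler_addgt0Pr => d d0.
have [N uN] := (cvg_rnP u l).1 ul _ d0.
have := uN _ (leq_maxl N n); have := ue _ _ (leq_maxr N n).
have := rnD (l - u (maxn N n)) (u (maxn N n) - u n).
by rewrite subrKA => ? ? ?; lra.
Qed.

End real_norm.

(** * Elementary inequalities for powers and limits *)

Section order_lemmas.
Context {R : realType}.

Lemma bernoulli (x : R) n : 0 <= x -> 1 + n%:R * x <= (1 + x) ^+ n.
Proof.
move=> x0; elim: n => [|n IH]; first by rewrite expr0 mul0r addr0.
rewrite exprS -natr1 (le_trans _ (ler_wpM2l _ IH)) ?addr_ge0//.
have : 0 <= n%:R * x * x by rewrite !mulr_ge0.
by move=> ?; lra.
Qed.

(* Extracting [n]-th roots kills the constant. *)
Lemma root_test (x y C : R) : 0 <= y ->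
  (forall n, exists2 m, (n <= m)%N & x ^+ m <= C * y ^+ m) -> x <= y.
Proof.
move=> y0 H; rewrite leNgt; apply/negP => yx.
have x0 : 0 < x by exact: le_lt_trans yx.
move: yx H; case: (eqVneq y 0) => [->|y00] yx H.
  have [[//|m] _] := H 1%N; rewrite expr0n/= mulr0 => h.
  by have := exprn_gt0 m.+1 x0; rewrite ltNge h.
have yp : 0 < y by rewrite lt0r y00.
pose d := x / y - 1; have d0 : 0 < d by rewrite subr_gt0 ltr_pdivlMr// mul1r.
have [m] := H (Num.truncn (C / d)).+1; rewrite -ler_pdivrMr ?exprn_gt0//.
rewrite -expr_div_n => Nm.
have -> : x / y = 1 + d by rewrite /d; lra.
move=> /(le_trans (bernoulli _ (ltW d0))) h.
have h1 : C / d < m%:R.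
  by rewrite (lt_le_trans (truncnS_gt _))// ler_nat.
by move: h1; rewrite ltr_pdivrMr//; lra.
Qed.

Lemma le_cvg0 (x : R) (e : nat -> R) :
  e @ \oo --> (0 : R) -> (forall n, x <= e n) -> x <= 0.
Proof.
move=> e0 xe; rewrite -(cvg_lim (@Rhausdorff R) e0); apply: limr_ge.
  by apply/cvg_ex; exists 0.
exact: nearW.
Qed.

End order_lemmas.

(** * Uniform seminorms *)

Section algebra_theory.
Context {R : realType} {A : commCStarAlgType R}.
Implicit Types a b c x y : A.

Lemma cmulDr a b c : cmul a (b + c) = cmul a b + cmul a c.
Proof. by rewrite cmulC cmulDl (cmulC b) (cmulC c). Qed.

Lemma cmulZr (k : R[i]) a b : cmul a (k *: b) = k *: cmul a b.
Proof. by rewrite cmulC cmulZl cmulC. Qed.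

Lemma cmulNr a b : cmul a (- b) = - cmul a b.
Proof. by rewrite -scaleN1r cmulZr scaleN1r. Qed.

Lemma cmulBr a b c : cmul a (b - c) = cmul a b - cmul a c.
Proof. by rewrite cmulDr cmulNr. Qed.

Lemma cmulBl a b c : cmul (a - b) c = cmul a c - cmul b c.
Proof. by rewrite !(cmulC _ c) cmulBr. Qed.

Lemma cmulACA a b c d : cmul (cmul a b) (cmul c d) = cmul (cmul a c) (cmul b d).
Proof. by rewrite !cmulA; congr cmul; rewrite -!cmulA (cmulC b). Qed.

Lemma rn_cmul a b : rn (cmul a b) <= rn a * rn b.
Proof. by rewrite -lecR rmorphM/= !rnE cmul_norm_le. Qed.

Lemma rn_cstar_cmul a : rn (cmul (cstar a) a) = rn a ^+ 2.
Proof. by apply: complexI; rewrite rmorphXn/= !rnE cstar_identity. Qed.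

(** By commutativity both sides of [hh] have the form [x^* x], with [x = a a] on the left and
    [x = a^* a] on the right, and the C*-identity applies. The norm itself is thus a uniform
    seminorm. *)
Lemma rn_cmulsq a : rn (cmul a a) = rn a ^+ 2.
Proof.
have hh : cmul (cstar (cmul a a)) (cmul a a) =
          cmul (cstar (cmul (cstar a) a)) (cmul (cstar a) a).
  by rewrite !cstarM cstarK cmulACA.
have := congr1 rn hh; rewrite !rn_cstar_cmul => /eqP.
by rewrite eqrXn2 ?rn_ge0 ?sqr_ge0// => /eqP.
Qed.

End algebra_theory.

Section gelfand.
Context {R : realType} {A : commCStarAlgType R}.
Implicit Types (p q : A -> R) (C : set (A -> R)) (a b c x y : A).

(** On [C_0(X)] these are the suprema of absolute values over closed subsets of [X]; minimality will
    shrink the subset to a point where [|b|] is maximal. *)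
Definition useminorm p :=
  [/\ forall x y, p (x + y) <= p x + p y,
      forall (k : R[i]) x, p (k *: x) <= rn k * p x,
      forall x y, p (cmul x y) <= p x * p y,
      forall x, p x ^+ 2 <= p (cmul x x)
    & forall x, 0 <= p x <= rn x].

Lemma useminorm_norm : useminorm (rn : A -> R).
Proof.
split=> [x y|k x|x y|x|x]; rewrite ?rnD ?rnZ ?rn_cmul ?rn_cmulsq ?rn_ge0//=.
Qed.

Definition pinf C x := inf [set q x | q in C].

Section chain_infimum.
Variable C : set (A -> R).
Hypothesis C_neq0 : C !=set0.
Hypothesis C_ge0 : forall q x, C q -> 0 <= q x.
Hypothesis C_total : forall q q', C q -> C q' ->
  (forall x, q x <= q' x) \/ (forall x, q' x <= q x).

Let lbC x : has_inf [set q x | q in C].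
Proof.
case: C_neq0 => q Cq; split; first by exists (q x), q.
by exists 0 => _ [q' Cq' <-]; exact: C_ge0.
Qed.

Lemma pinf_le q x : C q -> pinf C x <= q x.
Proof. by move=> Cq; apply: ge_inf; [exact: (lbC x).2|exists q]. Qed.

Lemma le_pinf t x : (forall q, C q -> t <= q x) -> t <= pinf C x.
Proof. by move=> H; apply: lb_le_inf; [exact: (lbC x).1|move=> _ [q Cq <-]; exact: H]. Qed.

(** Totality of the chain provides a single member close to both infima, which is what lets sums and
    products pass to the infimum. *)
Lemma pinf_near x y e : 0 < e ->
  exists q, [/\ C q, q x <= pinf C x + e & q y <= pinf C y + e].
Proof.
move=> e0.
have [_ [q Cq <-] qx] := inf_adherent e0 (lbC x).
have [_ [q' Cq' <-] qy] := inf_adherent e0 (lbC y).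
have [qq'|q'q] := C_total Cq Cq'.
  by exists q; split=> //; apply: ltW => //; exact: le_lt_trans (qq' y) qy.
by exists q'; split=> //; apply: ltW => //; exact: le_lt_trans (q'q x) qx.
Qed.

Lemma le_pinfD t x y : (forall q, C q -> t <= q x + q y) ->
  t <= pinf C x + pinf C y.
Proof.
move=> H; apply/ler_addgt0Pr => e e0.
have [|q [Cq qx qy]] := @pinf_near x y (e / 2); first by rewrite divr_gt0.
by have := H _ Cq; lra.
Qed.

Lemma le_pinfM t x y : (forall q, C q -> t <= q x * q y) ->
  t <= pinf C x * pinf C y.
Proof.
move=> H; apply/ler_addgt0Pr => e e0.
have x0 : 0 <= pinf C x by apply: le_pinf => q Cq; exact: C_ge0.
have y0 : 0 <= pinf C y by apply: le_pinf => q Cq; exact: C_ge0.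
set X := pinf C x in x0 *; set Y := pinf C y in y0 *.
(* From [d <= 1] and [d (X + Y + 1) <= e] one gets [(X + d) (Y + d) <= X Y + e]. *)
pose d := Num.min 1 (e / (X + Y + 1)).
have k0 : 0 < X + Y + 1 by rewrite ltr_wpDl// addr_ge0.
have d0 : 0 < d by rewrite lt_min ltr01 divr_gt0.
have d1 : d <= 1 by rewrite ge_min lexx.
have de : d * (X + Y + 1) <= e by rewrite -ler_pdivlMr// ge_min lexx orbT.
have [q [Cq qx qy]] := @pinf_near x y d d0.
apply: (le_trans (H _ Cq)); apply: (le_trans (ler_pM _ _ qx qy)); rewrite ?C_ge0//.
rewrite -/X -/Y; nra.
Qed.

Lemma le_pinfZ t k x : 0 <= k -> (forall q, C q -> t <= k * q x) ->
  t <= k * pinf C x.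
Proof.
rewrite le0r => /orP[/eqP-> H|k0 H].
  by case: C_neq0 => q /H; rewrite !mul0r.
rewrite -ler_pdivrMl//; apply: le_pinf => q Cq.
by rewrite ler_pdivrMl// H.
Qed.

Lemma pinf_ge0 x : 0 <= pinf C x.
Proof. by apply: le_pinf => q Cq; exact: C_ge0. Qed.

End chain_infimum.

(** Zorn's lemma for the reversed pointwise order. The condition [rn b <= p b] holds for the norm
    and survives infima of chains, which prevents the minimal seminorm from collapsing to zero. *)
Lemma minimal_useminorm b : exists p,
  [/\ useminorm p, rn b <= p b & forall q, useminorm q -> rn b <= q b ->
    (forall x, q x <= p x) -> forall x, p x <= q x].
Proof.
pose P p := useminorm p /\ rn b <= p b.
pose T := {p | P p}.
pose r (s t : T) := `[< forall x, sval t x <= sval s x >].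
have P0 : P rn by split; [exact: useminorm_norm|].
have [|||[p [up pb]] /= pmin] := @ZL_preorder T (exist P _ P0) r.
- by move=> t; apply/asboolP.
- move=> s t u /asboolP st /asboolP tu; apply/asboolP => x.
  exact: le_trans (tu x) (st x).
- move=> F Ftot.
  have [F0|/set0P[s0 Fs0]] := eqVneq F set0.
    by exists (exist P _ P0); rewrite F0.
  pose C := [set sval s | s in F].
  have C_neq0 : C !=set0 by exists (sval s0), s0.
  have CP q : C q -> P q by move=> [s _ <-]; exact: svalP.
  have C_ge0 q x : C q -> 0 <= q x by move=> /CP[[_ _ _ _ /(_ x)/andP[]]].
  have C_tot q q' : C q -> C q' ->
      (forall x, q x <= q' x) \/ (forall x, q' x <= q x).
    move=> [s Fs <-] [t Ft <-].
    by have [/asboolP h|/asboolP h] := Ftot _ _ Fs Ft; [right|left].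
  have Ple q x : C q -> pinf C x <= q x by exact: pinf_le.
  have PC : P (pinf C).
    split; last by apply: le_pinf => // q /CP[].
    split=> [x y|k x|x y|x|x].
    - apply: le_pinfD => // q Cq; apply: (le_trans (Ple q _ Cq)).
      by have [[-> //]] := CP _ Cq.
    - apply: le_pinfZ; rewrite ?rn_ge0// => q Cq; apply: (le_trans (Ple q _ Cq)).
      by have [[_ -> //]] := CP _ Cq.
    - apply: le_pinfM => // q Cq; apply: (le_trans (Ple q _ Cq)).
      by have [[_ _ -> //]] := CP _ Cq.
    - apply: le_pinf => // q Cq.
      have [[_ _ _ /(_ x)+ _] _] := CP _ Cq; apply: le_trans.
      by rewrite lerXn2r ?nnegrE ?pinf_ge0 ?C_ge0 ?Ple.
    - rewrite pinf_ge0//=; case: C_neq0 => q Cq.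
      apply: (le_trans (Ple q _ Cq)).
      by have [[_ _ _ _ /(_ x)/andP[]]] := CP _ Cq.
  exists (exist P _ PC) => s Fs; apply/asboolP => x /=; apply: Ple; by exists s.
exists p; split=> // q uq qb qp x.
have := pmin (exist P q (conj uq qb)); rewrite /r /=.
by move=> /(_ _)/asboolP; apply; apply/asboolP.
Qed.

Definition sqiter k c := iter k (fun x => cmul x x) c.

Lemma sqiterS k c : sqiter k.+1 c = cmul (sqiter k c) (sqiter k c).
Proof. by []. Qed.

Lemma useminorm_sq p x : useminorm p -> p (cmul x x) = p x ^+ 2.
Proof.
by move=> [_ _ pM psq _]; apply/eqP; rewrite eq_le psq andbT expr2 pM.
Qed.

(* The seminorm [x |-> lim_k p (c^(2^k) x) / p (c^(2^k))] is smaller than [p], which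
   forces a minimal [p] to be multiplicative. *)
Definition localized_norm p c k x := p (cmul (sqiter k c) x) / p (sqiter k c).

(** Submultiplicativity and [useminorm_sq] make the quotients decrease in [k], so they form a chain,
    and the [k]-th quotients at [x] and [y] bound the next one at their product. By the same
    monotonicity a lower bound is only needed from index 1 on. *)
Lemma useminorm_localized p c : useminorm p -> 0 < p c ->
  let q := pinf (range (localized_norm p c)) in
  [/\ useminorm q, forall x, q x <= p x, forall x, q x <= p (cmul c x) / p c
    & forall t x, (forall k, t * p (sqiter k.+1 c) <= p (cmul (sqiter k.+1 c) x)) -> t <= q x].
Proof.
move=> up pc0; have [pD pZ pM psq pn] := up; move=> q.
have p0 x : 0 <= p x by case/andP: (pn x).
have pck k : 0 < p (sqiter k c).
  by elim: k => //= k IH; rewrite useminorm_sq// exprn_gt0.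
pose L := localized_norm p c.
have L0 k x : 0 <= L k x by rewrite divr_ge0.
have LS k x : L k.+1 x <= L k x.
  rewrite /L/localized_norm/= useminorm_sq// -cmulA ler_pdivrMr ?exprn_gt0//.
  by rewrite expr2 mulrA divfK ?gt_eqF// mulrC; exact: pM.
have Lmono k l x : (k <= l)%N -> L l x <= L k x.
  by move/subnK <-; elim: (_ - _)%N => //= n IH; exact: le_trans (LS _ _) IH.
have C_ge0 f x : range L f -> 0 <= f x by move=> [k _ <-].
have C_neq0 : range L !=set0 by exists (L 0%N), 0%N.
have C_tot f g : range L f -> range L g ->
    (forall x, f x <= g x) \/ (forall x, g x <= f x).
  move=> [k _ <-] [l _ <-]; have [kl|lk] := leqP k l; [right|left] => x.
    exact: Lmono.
  exact/Lmono/ltnW.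
have qL k x : q x <= L k x by apply: pinf_le => //; exists k.
have Lp k x : L k x <= p x by rewrite ler_pdivrMr// mulrC; exact: pM.
have qp x : q x <= p x by exact: le_trans (qL 0%N x) (Lp _ _).
split=> //; [|by move=> x; exact: (qL 0%N)|]; last first.
  move=> t x H; apply: le_pinf => // _ [k _ <-].
  by apply: le_trans (LS _ _); rewrite ler_pdivlMr//.
split=> [x y|k x|x y|x|x].
- apply: le_pinfD => // _ [k _ <-]; apply: (le_trans (qL k _)).
  by rewrite -mulrDl ler_pM2r ?invr_gt0// cmulDr.
- apply: le_pinfZ; rewrite ?rn_ge0// => _ [l _ <-]; apply: (le_trans (qL l _)).
  by rewrite mulrA ler_pM2r ?invr_gt0// cmulZr.
- apply: le_pinfM => // _ [k _ <-]; apply: (le_trans (qL k.+1 _)).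
  rewrite /L/localized_norm/= useminorm_sq// cmulACA mulrACA -invfM -expr2.
  by rewrite ler_pM2r ?invr_gt0 ?exprn_gt0.
- apply: le_pinf => // _ [k _ <-].
  apply: (@le_trans _ _ (L k x ^+ 2)).
    by rewrite lerXn2r ?nnegrE ?qL// ?pinf_ge0.
  apply: le_trans (LS k _).
  rewrite /L/localized_norm/= useminorm_sq// cmulACA expr_div_n.
  by rewrite ler_pM2r ?invr_gt0 ?exprn_gt0.
- by rewrite pinf_ge0//= (le_trans (qp x))//; case/andP: (pn x).
Qed.

(** Minimality is used twice. Localizing at [b] gives [p (b x) = p b * p x]; this equality in turn
    shows that localizing at any other [c] keeps the value at [b], so that minimality applies
    again. *)
Lemma multiplicative_useminorm b : b <> 0 -> exists p,
  [/\ useminorm p, p b = rn b & forall x y, p (cmul x y) = p x * p y].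
Proof.
move=> /rn_gt0 b0; have [p [up pb pmin]] := minimal_useminorm b.
have [pD pZ pM psq pn] := up.
have p0 x : 0 <= p x by case/andP: (pn x).
have {}pb : p b = rn b.
  by apply/eqP; rewrite eq_le pb andbT; case/andP: (pn b).
have pb0 : 0 < p b by rewrite pb.
have bp x : p b * p x <= p (cmul b x).
  have [uq qp qb qge] := useminorm_localized up pb0.
  rewrite mulrC -ler_pdivlMr//; apply: le_trans (qb x); apply: pmin => //.
  rewrite -pb; apply: qge => k.
  (* Here [u] is [b^(2^(k+1) - 1)]. With [B = b u], the bound [p b * p u <= p B] turns
     [p B ^ 2 <= p (B b) * p u] into [p b * p B <= p (B b)]. *)
  have [u bu pu] : exists2 u, sqiter k.+1 b = cmul b u & p b * p u <= p (sqiter k.+1 b).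
    elim: k => [|k [u bu pu]]; first by exists b => //=; rewrite -expr2 useminorm_sq.
    exists (cmul u (sqiter k.+1 b)).
      by rewrite (sqiterS k.+1) cmulA -bu.
    rewrite (sqiterS k.+1) (useminorm_sq _ up)// (le_trans (ler_wpM2l _ (pM _ _)))//.
    by rewrite mulrA expr2 ler_wpM2r.
  have bk0 : 0 < p (sqiter k.+1 b).
    by elim: (k.+1) => //= l IH; rewrite useminorm_sq// exprn_gt0.
  set B := sqiter k.+1 b in bu pu bk0 *.
  rewrite -(ler_pM2r bk0).
  have h1 : p B * p B <= p (cmul B b) * p u.
    by rewrite -expr2 -useminorm_sq// {2}bu cmulA.
  have h2 : p b * (p B * p B) <= p (cmul B b) * (p b * p u) by rewrite [leRHS]mulrCA ler_wpM2l.
  by rewrite -mulrA; apply: (le_trans h2); exact: ler_wpM2l.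
exists p; split=> // c x; apply/eqP; rewrite eq_le pM/=.
have [c0|c0] := eqVneq (p c) 0; first by rewrite c0 mul0r.
have pc0 : 0 < p c by rewrite lt0r c0 p0.
have [uq qp qb qge] := useminorm_localized up pc0.
rewrite mulrC -ler_pdivlMr//; apply: le_trans (qb x); apply: pmin => //.
by rewrite -pb; apply: qge => k; rewrite (cmulC _ b).
Qed.

End gelfand.

(** * A Gelfand-Mazur theorem for multiplicative seminorms *)

Section gelfand_mazur.
Context {R : realType} {A : commCStarAlgType R}.
Variables (p : A -> R) (b : A).
Hypothesis up : useminorm p.
Hypothesis pmul : forall x y, p (cmul x y) = p x * p y.
Hypothesis pb0 : 0 < p b.
Implicit Types (x y : A) (z w : R[i]).

Let p0 x : 0 <= p x. Proof. by have [_ _ _ _ /(_ x)/andP[]] := up. Qed.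

Lemma cmul_diff_sq (x y : A) (s : R[i]) :
  cmul (x - s *: y) (x - (- s) *: y) = cmul x x - (s * s) *: cmul y y.
Proof.
rewrite scaleNr opprK cmulDr !cmulBl !cmulZr !cmulZl (cmulC y x) scalerA.
by rewrite addrA subrK.
Qed.

Lemma useminorm0 : p 0 = 0.
Proof.
apply/eqP; rewrite eq_le p0 andbT; have [_ _ _ _ /(_ 0)/andP[_]] := up.
by rewrite rn0.
Qed.

Lemma useminormZ z x : p (z *: x) = rn z * p x.
Proof.
have [_ pZ _ _ _] := up; have [->|z0] := eqVneq z 0.
  by rewrite scale0r rn0 mul0r useminorm0.
apply/eqP; rewrite eq_le pZ/= -{1}[x]scale1r -(mulVf z0) -scalerA.
have rz : 0 < rn z by apply: rn_gt0; apply/eqP.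
rewrite -ler_pdivlMl// (le_trans (pZ _ _))// ler_wpM2r//.
by rewrite -(ler_pM2r rz) -rnM mulVf// mulVf ?gt_eqF// (rnC 1) normr1.
Qed.

Lemma useminormB x y : p (x - y) <= p x + p y.
Proof.
have [pD _ _ _ _] := up; apply: (le_trans (pD _ _)).
by rewrite -scaleN1r useminormZ rnN (rnC 1) normr1 mul1r.
Qed.

(** Without a unit, [x - z] is only visible after multiplication by [b]; [f x z] plays the role of
    [p (x - z) * p b]. *)
Let f x z := p (cmul x b - z *: b).

Let f_lip x z w : f x z <= f x w + rn (z - w) * p b.
Proof.
rewrite -useminormZ; apply: le_trans (useminormB _ _).
by rewrite scalerBl opprB addrA subrK.
Qed.

Let f_sep x z w : rn (z - w) * p b <= f x z + f x w.
Proof.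
rewrite -useminormZ [leRHS]addrC; apply: le_trans (useminormB _ _).
by rewrite scalerBl opprB (addrC (_ - w *: b)) addrA subrK.
Qed.

(* Write [u] for [x - z].  In a suitable unitization,
   [u^N - w^N] is the product over the [N]-th roots of unity [s] of [u - s w], with
   [N] a power of 2; here [u^N] and [1] are represented by [u^N b^N] and [b^N]. *)
Let mazur_growth x m z w k : (forall z', m <= f x z') -> 0 <= m ->
  m ^+ (2 ^ k) * f x (z + w) <= m * (f x z ^+ (2 ^ k) + (rn w * p b) ^+ (2 ^ k)).
Proof.
move=> fm m0.
pose Y k := sqiter k (cmul x b - z *: b); pose B k := sqiter k b.
pose W k := iter k (fun c : R[i] => c * c) w.
have YBm k' c : m ^+ (2 ^ k') <= p (Y k' - c *: B k').
  elim: k' c => [|k' IH] c.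
    by rewrite expr1 /Y/B/= -addrA -opprD -scalerDl; exact: fm.
  rewrite /Y /B !sqiterS -/(Y k') -/(B k').
  have -> : cmul (Y k') (Y k') - c *: cmul (B k') (B k') =
      cmul (Y k' - sqrtc c *: B k') (Y k' - (- sqrtc c) *: B k').
    by rewrite cmul_diff_sq -expr2 sqr_sqrtc.
  rewrite pmul expnS mulnC exprM expr2.
  by apply: ler_pM => //; exact: exprn_ge0.
have YBf k' : m ^+ (2 ^ k') * f x (z + w) <= m * p (Y k' - W k' *: B k').
  elim: k' => [|k' IH].
    by rewrite expr1 /f /Y /B/= -addrA -opprD -scalerDl.
  rewrite /Y /B !sqiterS -/(Y k') -/(B k') /= -/(W k').
  have -> : cmul (Y k') (Y k') - (W k' * W k') *: cmul (B k') (B k') =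
      cmul (Y k' - W k' *: B k') (Y k' - (- W k') *: B k').
    by rewrite cmul_diff_sq.
  rewrite pmul expnS mulnC exprM expr2 mulrAC mulrA.
  by apply: ler_pM; rewrite ?IH ?YBm ?mulr_ge0 ?exprn_ge0 ?p0.
apply: (le_trans (YBf k)); rewrite ler_wpM2l//.
apply: (le_trans (useminormB _ _)); rewrite useminormZ.
have pB : p (B k) = p b ^+ (2 ^ k).
  elim: (k) => [|k' IH]; first by rewrite expr1.
  by rewrite /B sqiterS pmul -/(B k') IH expnS mulnC exprM expr2.
have pY : p (Y k) = f x z ^+ (2 ^ k).
  elim: (k) => [|k' IH]; first by rewrite expr1.
  by rewrite /Y sqiterS pmul -/(Y k') IH expnS mulnC exprM expr2.
have rW : rn (W k) = rn w ^+ (2 ^ k).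
  elim: (k) => [|k' IH]; first by rewrite expr1.
  by rewrite /W/= -/(W k') rnM IH expnS mulnC exprM expr2.
by rewrite pB pY rW exprMn.
Qed.

(** A convex function of [d] lies below its chord over [[0, 1]]. *)
Let pow1D (d : R) n : 0 <= d <= 1 -> (1 + d) ^+ n <= 1 + (2 ^+ n - 1) * d.
Proof.
move=> /andP[d0 d1]; elim: n => [|n IH]; first by rewrite !expr0 subrr mul0r addr0.
rewrite exprSr [2 ^+ n.+1]exprS; apply: (le_trans (ler_wpM2r _ IH)); first by rewrite addr_ge0.
have : 1 <= 2 ^+ n :> R by rewrite exprn_ege1// ler1n.
by set a := 2 ^+ n => a1; have : 0 <= (a - 1) * d * (1 - d);
  [rewrite !mulr_ge0// subr_ge0|lra].
Qed.

(** This stands in for Liouville's theorem. If the infimum [m] were positive, [mazur_growth] would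
    make [z + w] almost minimal whenever [z] is, for [w] of size [m / 2] after scaling by [p b].
    After [n] such steps the value is still at most [2 m], while [f_sep] bounds [n m / 2] by the sum
    of the values at the two ends, at most [4 m]; any [n > 8] is a contradiction. *)
Lemma inf_mazur x e : 0 < e -> exists z, p (cmul x b - z *: b) < e.
Proof.
move=> e0; apply: contrapT => /forallNP nz.
have fe z : e <= f x z by rewrite leNgt; apply/negP/nz.
have infs : has_inf (range (f x)).
  by split; [exists (f x 0), 0|exists e => _ [z _ <-]].
pose m := inf (range (f x)).
have fm z : m <= f x z by apply: ge_inf; [exact: infs.2|exists z].
have m0 : 0 < m.
  by apply: (lt_le_trans e0); apply: lb_le_inf; [exact: infs.1|move=> _ [z _ <-]].
pose w : R[i] := (m / 2 / p b)%:C.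
have rw : rn w * p b = m / 2.
  by rewrite rnC ger0_norm ?divr_ge0 ?(ltW m0) ?(ltW pb0)// divfK ?gt_eqF.
(* Dividing [mazur_growth] by [m^N] leaves [f x (z + w) <= m ((1 + d')^N + 2^-N)]. The choice of [N]
   makes the last term at most [d / 2], and then [d'] brings the power below [1 + d / 2]. *)
have step (d : R) : 0 < d -> exists2 d', 0 < d' <= 1 &
    forall z, f x z <= m * (1 + d') -> f x (z + w) <= m * (1 + d).
  move=> d0; pose k := (Num.truncn (2 / d)).+1; pose N := (2 ^ k)%N.
  have kN : (k <= N)%N by rewrite ltnW// ltn_expl.
  have N2 : 2^-1 ^+ N <= d / 2.
    have : 2 / d < 2 ^+ N.
      rewrite (lt_le_trans (truncnS_gt _))// -natrX ler_nat (leq_trans kN)//.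
      by rewrite ltnW// ltn_expl.
    rewrite exprVn -[d / 2]invrK invf_div => /ltW.
    by rewrite lef_pV2// posrE ?divr_gt0// exprn_gt0.
  have P1 : 0 < 2 ^+ N :> R by rewrite exprn_gt0.
  pose d' := Num.min 1 (d / 2 / 2 ^+ N).
  have d'0 : 0 < d' by rewrite lt_min ltr01 !divr_gt0.
  have d'1 : d' <= 1 by rewrite ge_min lexx.
  have d'N : 2 ^+ N * d' <= d / 2 by rewrite mulrC -ler_pdivlMr// ge_min lexx orbT.
  exists d'; first by rewrite d'0.
  move=> z fz.
  have := mazur_growth z w k fm (ltW m0); rewrite -/N rw.
  have mN : 0 < m ^+ N by rewrite exprn_gt0.
  have h1 : f x z ^+ N <= m ^+ N * (1 + d / 2).
    apply: (@le_trans _ _ ((m * (1 + d')) ^+ N)).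
      by rewrite lerXn2r ?nnegrE ?p0// mulr_ge0 ?addr_ge0 ?ltW.
    rewrite exprMn ler_pM2l// (le_trans (pow1D _ _)) ?(ltW d'0)//; lra.
  have h2 : (m / 2) ^+ N <= m ^+ N * (d / 2) by rewrite exprMn ler_pM2l.
  move=> h; rewrite -(ler_pM2l mN) (le_trans h)// mulrCA ler_pM2l//; lra.
have steps n (d : R) : 0 < d -> exists2 d', 0 < d' &
    forall z, f x z <= m * (1 + d') -> f x (z + n%:R * w) <= m * (1 + d).
  elim: n d => [|n IH] d d0.
    by exists d => // z; rewrite mul0r addr0.
  have [d1 /andP[d10 _] H1] := step d d0; have [d2 d20 H2] := IH _ d10.
  exists d2 => // z /H2/H1; by rewrite -natr1 mulrDl mul1r addrA.
pose n := (Num.truncn (4 * 2 : R)).+1.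
have [d d0 /= H] := steps n 1 ltr01.
have d1 : 0 < Num.min d 1 by rewrite lt_min d0 ltr01.
have [_ [z _ <-] fz] := inf_adherent (mulr_gt0 m0 d1) infs.
have fz2 : f x z <= m * (1 + Num.min d 1) by rewrite mulrDr mulr1 ltW.
have h1 : f x (z + n%:R * w) <= m * (1 + 1).
  by apply: H; rewrite (le_trans fz2)// ler_pM2l// lerD2l ge_min lexx.
have h2 : f x z <= m * (1 + 1).
  by rewrite (le_trans fz2)// ler_pM2l// lerD2l ge_min lexx orbT.
have := f_sep x (z + n%:R * w) z; rewrite addrAC subrr add0r rnM.
have -> : rn (n%:R : R[i]) = n%:R.
  by rewrite -(rmorph_nat (real_complex R)) rnC ger0_norm.
rewrite -mulrA rw => h3.
have n8 : 8 < n%:R :> R.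
  by apply: le_lt_trans (truncnS_gt _); rewrite -natrM.
have : n%:R * (m / 2) <= 4 * m by lra.
apply/negP; rewrite -ltNge mulrCA (mulrC _ m) ltr_pM2l//; lra.
Qed.

(** By [f_sep] approximate zeros form a Cauchy sequence, so completeness of the complex numbers
    turns the infimum zero into an attained value. *)
Lemma exists_mazur x : exists z, p (cmul x b - z *: b) = 0.
Proof.
have /choice[u uP] : forall n, exists z, f x z <= n.+1%:R^-1.
  move=> n; have [|z /ltW] := @inf_mazur x n.+1%:R^-1; first by rewrite invr_gt0.
  by exists z.
have inv_mono n m : (n <= m)%N -> (m.+1%:R^-1 <= n.+1%:R^-1 :> R).
  by move=> nm; rewrite lef_pV2 ?posrE// ler_nat.
have [||l ul lu] := @cauchy_rate R (complexC R) u (fun n => 2 / p b * n.+1%:R^-1).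
- move=> n m nm; rewrite mulrAC ler_pdivlMr//.
  apply: (le_trans (f_sep x (u m) (u n))).
  apply: (le_trans (lerD (uP m) (uP n))).
  by rewrite mulr_natl mulr2n lerD2r inv_mono.
- rewrite -[0](mulr0 (2 / p b)); apply: cvgMr; exact: cvg_harmonic.
exists l; apply/eqP; rewrite eq_le p0 andbT; apply/ler_addgt0Pr => e e0.
pose n := Num.truncn (3 / e); set h : R := n.+1%:R^-1.
have ne : h * 3 <= e.
  by rewrite mulrC ler_pdivrMr// mulrC -ler_pdivrMr// ltW// truncnS_gt.
have h1 := f_lip x l (u n); have h2 : f x (u n) <= h by exact: uP.
have h3 : rn (l - u n) * p b <= 2 * h.
  by rewrite -ler_pdivlMr// mulrAC; exact: lu.
by rewrite add0r; rewrite /f in h1 h2; lra.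
Qed.

End gelfand_mazur.

(** * Characters *)

Section characters.
Context {R : realType} {A : commCStarAlgType R}.
Implicit Types (chi : A -> complexC R) (a b x y : A).

(** Modulo the kernel of [p], each [x b] is a multiple of [b], and of only one since [p b > 0];
    [chi x] is the coefficient. Linearity and multiplicativity follow from this uniqueness, and
    [|chi x| = p x] by multiplicativity of [p]. *)
Lemma exists_character b : b <> 0 ->
  exists2 chi, is_character chi & rn (chi b) = rn b.
Proof.
move=> bn0; have b0 := rn_gt0 bn0.
have [p [up pb pM]] := multiplicative_useminorm bn0.
have pb0 : 0 < p b by rewrite pb.
have p0 x : 0 <= p x by have [_ _ _ _ /(_ x)/andP[]] := up.
have pD0 x y : p x = 0 -> p y = 0 -> p (x + y) = 0.
  move=> x0 y0; apply/eqP; rewrite eq_le p0 andbT.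
  by have [pD _ _ _ _] := up; rewrite (le_trans (pD _ _))// x0 y0 addr0.
have pZ0 (k : R[i]) x : p x = 0 -> p (k *: x) = 0.
  by move=> x0; rewrite useminormZ// x0 mulr0.
have /choice[chi chiP] x : exists z : complexC R, p (cmul x b - (z : R[i]) *: b) = 0.
  exact: exists_mazur.
have uniq z w : p ((z - w : R[i]) *: b) = 0 -> z = w.
  rewrite (useminormZ up)// => /eqP; rewrite mulf_eq0 [p b == 0]gt_eqF// orbF => /eqP/rn_eq0/eqP.
  by rewrite subr_eq0 => /eqP.
have rchi x : rn (chi x) = p x.
  apply: (mulIf (lt0r_neq0 pb0)); rewrite -pM.
  rewrite -[LHS](useminormZ up).
  have h := chiP x; have h' : p ((chi x : R[i]) *: b - cmul x b) = 0.
    by rewrite -opprB -scaleN1r pZ0.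
  have [pD _ _ _ _] := up.
  apply/eqP; rewrite eq_le; apply/andP; split.
    by rewrite -[leLHS]/(p _) -(subrK (cmul x b) (_ *: b)) (le_trans (pD _ _))// h' add0r.
  by rewrite -[in leLHS](subrK ((chi x : R[i]) *: b) (cmul x b)) (le_trans (pD _ _))// h add0r.
exists chi; last by rewrite rchi.
split.
- move=> c x y; apply: uniq.
  have -> : (chi (c *: x + y) - (c *: chi x + chi y) : R[i]) *: b =
    (c *: (cmul x b - (chi x : R[i]) *: b) + (cmul y b - (chi y : R[i]) *: b)) +
    (-1) *: (cmul (c *: x + y) b - (chi (c *: x + y) : R[i]) *: b).
    rewrite cmulDl cmulZl scalerBl scaleN1r !scalerBr scalerA scalerDl.
    by rewrite addrACA -opprD opprB [RHS]addrC addrA subrK.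
  by apply: (pD0); [apply: (pD0); [exact: pZ0|exact: chiP]|exact: pZ0].
- move=> x y; apply: uniq.
  have p2 : p (cmul (cmul x b) (cmul y b) - ((chi x : R[i]) * chi y) *: cmul b b) = 0.
    have -> : cmul (cmul x b) (cmul y b) - ((chi x : R[i]) * chi y) *: cmul b b =
       cmul (cmul x b - (chi x : R[i]) *: b) (cmul y b) +
       (chi x : R[i]) *: cmul b (cmul y b - (chi y : R[i]) *: b).
      by rewrite cmulBl cmulBr cmulZl cmulZr scalerBr scalerA addrA subrK.
    by apply: pD0; [|apply: pZ0]; rewrite pM chiP ?mul0r ?mulr0.
  have p3 : p (cmul (cmul (cmul x y) b - (chi (cmul x y) : R[i]) *: b) b) = 0.
    by rewrite pM chiP mul0r.
  have : p ((chi (cmul x y) - cmul (chi x) (chi y) : R[i]) *: cmul b b) = 0.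
    have -> : (chi (cmul x y) - cmul (chi x) (chi y) : R[i]) *: cmul b b =
      (cmul (cmul x b) (cmul y b) - ((chi x : R[i]) * chi y) *: cmul b b) -
      cmul (cmul (cmul x y) b - (chi (cmul x y) : R[i]) *: b) b.
      rewrite scalerBl cmulBl cmulZl cmulACA opprB -[cmul (cmul (cmul x y) b) b]cmulA.
      by rewrite [RHS]addrC addrA subrK.
    by apply: (pD0) => //; rewrite -scaleN1r; exact: pZ0.
  rewrite useminormZ// pM => /eqP; rewrite mulrA mulf_eq0 [p b == 0]gt_eqF// orbF.
  by rewrite -useminormZ// => /eqP.
- by exists b; apply/eqP => b00; have := rchi b; rewrite b00 rn0 pb => h; rewrite -h ltxx in b0.
Qed.

Section one_character.
Variable chi : A -> complexC R.
Hypothesis chiP : is_character chi.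

Lemma charD a b : chi (a + b) = chi a + chi b.
Proof. by have [/(_ 1 a b)] := chiP; rewrite !scale1r. Qed.

Lemma char0 : chi 0 = 0.
Proof. by apply: (addrI (chi 0)); rewrite -charD !addr0. Qed.

Lemma charZ (c : R[i]) a : chi (c *: a) = c * (chi a : R[i]).
Proof. by have [/(_ c a 0)] := chiP; rewrite char0 !addr0. Qed.

Lemma charN a : chi (- a) = - chi a.
Proof. by rewrite -scaleN1r charZ mulN1r. Qed.

Lemma charB a b : chi (a - b) = chi a - chi b.
Proof. by rewrite charD charN. Qed.

Lemma charM a b : chi (cmul a b) = (chi a : R[i]) * chi b.
Proof. by have [_ ->] := chiP. Qed.

Lemma char_sum (I : Type) (r : seq I) (Q : pred I) (F : I -> A) :
  chi (\sum_(i <- r | Q i) F i) = \sum_(i <- r | Q i) (chi (F i) : R[i]).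
Proof. by apply: (big_morph chi); [exact: charD|exact: char0]. Qed.

(** Continuity is automatic. If [|chi a| > |a|], then [a' = a / chi a] has norm below 1, so a
    geometric series solves [y = a' + a' y]; applying [chi] gives [chi y = 1 + chi y]. *)
Lemma char_contractive a : rn (chi a) <= rn a.
Proof.
rewrite leNgt; apply/negP => lt_a.
have k0 : 0 < rn (chi a) by apply: le_lt_trans lt_a; exact: rn_ge0.
have kn0 : (chi a : R[i]) != 0 by apply/eqP => k; rewrite k rn0 ltxx in k0.
pose a' := (chi a : R[i])^-1 *: a; pose r := rn a'.
have chia' : chi a' = 1 :> R[i] by rewrite charZ mulVf.
have r0 : 0 <= r by exact: rn_ge0.
have r1 : r < 1.
  rewrite /r rnZ -(ltr_pM2l k0) mulrA -rnM divff// (rnC 1) normr1 mul1r mulr1.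
  exact: lt_a.
pose s n := iter n (fun y => a' + cmul a' y) 0.
pose K := (1 - r)^-1.
have K0 : 0 < K by rewrite invr_gt0 subr_gt0.
have KE : K * (1 - r) = 1 by rewrite mulVf// gt_eqF// subr_gt0.
have sK n : rn (s n) <= K.
  elim: n => [|n IH]; first by rewrite rn0 ltW.
  rewrite /s iterS -/(s n) (le_trans (rnD _ _))//.
  have : rn (cmul a' (s n)) <= r * K by rewrite (le_trans (rn_cmul _ _))// ler_wpM2l.
  rewrite -/r; nra.
have sd n d : rn (s (n + d)%N - s n) <= r ^+ n * K.
  elim: n => [|n IH]; first by rewrite add0n subr0 mul1r.
  rewrite addSn /s !iterS -/(s n) -/(s (n + d)%N) opprD addrACA subrr add0r -cmulBr.
  by rewrite (le_trans (rn_cmul _ _))// exprS -mulrA ler_wpM2l.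
have e0 : (fun n => r ^+ n * K) @ \oo --> (0 : R).
  by rewrite -(mul0r K); apply: cvgMl; apply: cvg_expr; rewrite ger0_norm.
have [|y sy ys] := @cauchy_rate R A s (fun n => r ^+ n * K) _ e0.
  by move=> n m /subnKC <-.
have ya : y - (a' + cmul a' y) = 0.
  apply: rn_eq0; apply/eqP; rewrite eq_le rn_ge0 andbT.
  apply: (@le_cvg0 R _ (fun n => r ^+ n * K + r ^+ n * K)).
    by rewrite -[0](addr0 (0 : R)); exact: cvgD.
  move=> n; have -> : y - (a' + cmul a' y) = (y - s n.+1) - cmul a' (y - s n).
    by rewrite /s iterS -/(s n) cmulBr opprB !opprD !addrA subrK.
  rewrite (le_trans (rnD _ _))// rnN lerD//.
    rewrite (le_trans (ys _))// exprS -mulrA ler_piMl ?(ltW r1)//.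
    by rewrite mulr_ge0 ?exprn_ge0 ?(ltW K0).
  rewrite (le_trans (rn_cmul _ _))// (le_trans (ler_piMl _ (ltW r1))) ?rn_ge0// rnB.
have := congr1 chi ya; rewrite charB charD charM chia' char0 mul1r.
rewrite opprD addrCA subrr addr0 => /eqP; rewrite oppr_eq0.
by apply/negP; exact: oner_neq0.
Qed.

(** Arens's argument without a unit: multiplication by [h + i t] has norm at most the square root of
    [|h|^2 + t^2], and [chi] turns it into multiplication by [al + i (be + t)]. Iterating on some
    [u] with [chi u] nonzero, [root_test] removes the constant and leaves [key]. *)
Lemma char_selfadjoint h : cstar h = h -> complex.Im (chi h) = 0.
Proof.
move=> hh; have [u u0] : exists u, chi u != 0 by have [] := chiP.
set al := complex.Re (chi h : R[i]); set be := complex.Im (chi h).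
pose M (t : R) y := cmul h y + t%:C *: ('i *: y).
have rnM2 t y : rn (M t y) ^+ 2 <= (rn h ^+ 2 + t ^+ 2) * rn y ^+ 2.
  have -> : rn (M t y) ^+ 2 =
      rn (cmul (cmul h h) (cmul (cstar y) y) + (t ^+ 2)%:C *: cmul (cstar y) y).
    rewrite -rn_cstar_cmul /M cstarD cstarM hh !cstarZ; congr rn.
    rewrite cmulDr !cmulDl !(cmulZl, cmulZr) !scalerA.
    have -> : cmul (cmul (cstar y) h) y = cmul (cstar y) (cmul h y) by rewrite cmulA.
    rewrite -addrA; congr (_ + _).
      by rewrite (cmulC (cstar y) h) cmulACA.
    rewrite addrA -scalerDl.
    have -> : t%:C^* * 'i^* + t%:C * 'i = 0 :> R[i] by simpc; rewrite addNr.
    rewrite scale0r add0r; congr (_ *: _).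
    by rewrite rmorphXn/= expr2; simpc.
  rewrite (le_trans (rnD _ _))// mulrDl -!rn_cstar_cmul lerD//.
    by rewrite (le_trans (rn_cmul _ _))// ler_wpM2r ?rn_ge0// hh.
  by rewrite rnZ rnC ger0_norm ?sqr_ge0.
have rnMn t n : rn (iter n (M t) u) ^+ 2 <= (rn h ^+ 2 + t ^+ 2) ^+ n * rn u ^+ 2.
  elim: n => [|n IH]; first by rewrite mul1r.
  rewrite iterS (le_trans (rnM2 _ _))// [_ ^+ n.+1]exprS -mulrA ler_wpM2l//.
  by rewrite addr_ge0 ?sqr_ge0.
have chiMn t n : rn (chi (iter n (M t) u)) ^+ 2 =
    (al ^+ 2 + (be + t) ^+ 2) ^+ n * rn (chi u) ^+ 2.
  elim: n => [|n IH]; first by rewrite mul1r.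
  rewrite iterS /M charD charM !charZ mulrA -mulrDl [rn (_ * _)](rnM _ _) exprMn IH.
  rewrite [_ ^+ n.+1]exprS mulrA; congr (_ * _ * _); rewrite rn_sqr.
  by rewrite /al /be; case: (chi h) => x1 y1; simpc.
have ru0 : 0 < rn (chi u) ^+ 2 by rewrite exprn_gt0// rn_gt0//; apply/eqP.
have key t : al ^+ 2 + (be + t) ^+ 2 <= rn h ^+ 2 + t ^+ 2.
  apply: (@root_test _ _ _ (rn u ^+ 2 / rn (chi u) ^+ 2)).
    by rewrite addr_ge0 ?sqr_ge0.
  move=> n; exists n => //; rewrite mulrAC ler_pdivlMr// -chiMn.
  rewrite mulrC (le_trans _ (rnMn t n))// lerXn2r ?nnegrE ?rn_ge0//.
  exact: char_contractive.
apply/eqP; apply: contraT => be0.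
(* For this [t] one has [2 be t = |h|^2], and [key] becomes [al^2 + be^2 <= 0]. *)
have := key (rn h ^+ 2 / (2 * be)).
have -> : (be + rn h ^+ 2 / (2 * be)) ^+ 2 =
    be ^+ 2 + rn h ^+ 2 + (rn h ^+ 2 / (2 * be)) ^+ 2 by field.
have : 0 < be ^+ 2 by rewrite exprn_even_gt0.
have := sqr_ge0 al; set X := (_ / _) ^+ 2; lra.
Qed.

Lemma char_star a : chi (cstar a) = (chi a : R[i])^*.
Proof.
pose h1 := a + cstar a; pose h2 := 'i *: (a - cstar a).
have h1h : cstar h1 = h1 by rewrite /h1 cstarD cstarK addrC.
have cstarN x : cstar (- x) = - cstar x.
  by rewrite -scaleN1r cstarZ rmorphN rmorph1 scaleN1r.
have h2h : cstar h2 = h2.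
  rewrite /h2 cstarZ cstarD cstarN cstarK.
  have -> : 'i^* = - 'i :> R[i] by simpc.
  by rewrite scaleNr -scalerN opprB.
have := char_selfadjoint h1h; have := char_selfadjoint h2h.
rewrite /h1 /h2 charZ charB charD.
case: (chi a) => x1 y1; case: (chi (cstar a)) => x2 y2; simpc => /= e1 e2.
congr (_ +i* _); lra.
Qed.

End one_character.
End characters.

(** * Adjointable operators *)

Lemma rn_nat (R : realType) n : rn (n%:R : R[i]) = n%:R.
Proof. by rewrite -(rmorph_nat (real_complex R)) rnC ger0_norm. Qed.

Lemma rn_double (R : realType) (V : normedModType R[i]) (v : V) :
  rn (v + v) = 2 * rn v.
Proof.
by rewrite -{1 2}(scale1r v) -scalerDl rnZ; congr (_ * _); exact: (rn_nat R 2).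
Qed.

(** * Semi-inner products and the Cauchy-Schwarz inequality *)

Section semi_inner_product.
Context {R : realType} {V : lmodType R[i]}.
Variable B : V -> V -> R[i].

Definition semi_inner :=
  [/\ forall v w x, B v (w + x) = B v w + B v x,
      forall (c : R[i]) v w, B v (c *: w) = c * B v w,
      forall v w, (B v w)^* = B w v
    & forall v, 0 <= complex.Re (B v v)].

Definition qform v : R := complex.Re (B v v).

Hypothesis Bsip : semi_inner.
Implicit Types (v w x : V) (c : R[i]).

Lemma sipDr v w x : B v (w + x) = B v w + B v x.
Proof. by case: Bsip. Qed.

Lemma sipZr c v w : B v (c *: w) = c * B v w.
Proof. by case: Bsip. Qed.

Lemma sipC v w : (B v w)^* = B w v.
Proof. by case: Bsip. Qed.

Lemma sipDl v w x : B (v + w) x = B v x + B w x.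
Proof. by rewrite -sipC sipDr rmorphD/= !sipC. Qed.

Lemma sipZl c v w : B (c *: v) w = c^* * B v w.
Proof. by rewrite -sipC sipZr rmorphM/= sipC. Qed.

Lemma qform_ge0 v : 0 <= qform v.
Proof. by case: Bsip => _ _ _ /(_ v). Qed.

Lemma qformE v : B v v = (qform v)%:C.
Proof.
have := sipC v v; rewrite /qform; case: (B v v) => x y; simpc => -[y0].
by congr (_ +i* _); lra.
Qed.

Lemma qformZ c v : qform (c *: v) = rn c ^+ 2 * qform v.
Proof.
apply: complexI; rewrite -qformE sipZl sipZr mulrA rmorphM/= -qformE.
by rewrite rmorphXn/= rnE normCK [c^* * c]mulrC.
Qed.

Lemma qformN v : qform (- v) = qform v.
Proof. by rewrite -scaleN1r qformZ rnN (rnC 1) normr1 expr1n mul1r. Qed.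

Lemma qformD v w : qform (v + w) = qform v + qform w + 2 * complex.Re (B v w).
Proof.
rewrite /qform sipDr !sipDl -(sipC v w).
by case: (B v v) (B v w) (B w w) => [a1 b1] [a2 b2] [a3 b3] /=; lra.
Qed.

Lemma cauchy_schwarz v w : rn (B v w) ^+ 2 <= qform v * qform w.
Proof.
set N := rn _ ^+ 2.
have zz : (B v w)^* * B v w = N%:C by rewrite mulrC -normCK -rnE rmorphXn.
have key (t : R) : 0 <= qform v + t ^+ 2 * N * qform w - 2 * t * N.
  have -> : qform v + t ^+ 2 * N * qform w - 2 * t * N =
      qform (v + (- (t%:C * (B v w)^*)) *: w).
    rewrite qformD qformZ rnN rnM exprMn rnC real_normK ?num_real// (rn_conj (B v w)).
    by rewrite sipZr mulNr -(mulrA t%:C) zz -rmorphM -rmorphN/= -/N; lra.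
  exact: qform_ge0.
have N0 : 0 <= N by exact: sqr_ge0.
(* The form may be degenerate; the polynomial [key] in [t] is then affine, and a large [t] forces
   [N = 0]. *)
have [w0|w0] := eqVneq (qform w) 0.
  rewrite w0 mulr0; rewrite leNgt; apply/negP => Np.
  have := key ((qform v + 1) / N).
  rewrite w0 mulr0 addr0 -mulrA divfK ?gt_eqF//.
  by have := qform_ge0 v; lra.
have wp : 0 < qform w by rewrite lt0r w0 qform_ge0.
have := key (qform w)^-1.
have -> : (qform w)^-1 ^+ 2 * N * qform w = N / qform w by field.
rewrite -mulrA (mulrC _ N) => h.
by rewrite -ler_pdivrMr//; lra.
Qed.

Lemma qform_parallelogram v w :
  qform (v + w) + qform (v - w) = 2 * qform v + 2 * qform w.
Proof.
rewrite !qformD qformN -[- w]scaleN1r sipZr mulN1r raddfN/=; lra.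
Qed.

Lemma qform_le2D v w : qform (v + w) <= 2 * qform v + 2 * qform w.
Proof. by rewrite -qform_parallelogram lerDl qform_ge0. Qed.

Lemma qform_eq0 v w : qform v = 0 -> B w v = 0.
Proof.
move=> v0; apply: rn_eq0; apply/eqP; rewrite -sqrf_eq0 eq_le sqr_ge0 andbT.
by rewrite (le_trans (cauchy_schwarz _ _))// v0 mulr0.
Qed.

End semi_inner_product.

Lemma le_cvg0M (R : realType) (x K : R) (e : nat -> R) :
  e @ \oo --> (0 : R) -> (forall n, x <= K * e n) -> x <= 0.
Proof.
by move=> e0; apply: le_cvg0; rewrite -(mulr0 K); exact: cvgMr.
Qed.

(** * Fiber seminorms, adjoints and boundedness *)

Section hilbert_module_theory.
Context {R : realType} {A : commCStarAlgType R} {E : hilbertModType A}.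
Implicit Types (chi : A -> complexC R) (v w x : E) (S T P Q L : E -> E).

Definition fiber_ip chi v w : R[i] := chi (cip v w).

Lemma cipDl v w x : cip (v + w) x = cip v x + cip w x.
Proof. by rewrite -cip_star cipDr cstarD !cip_star. Qed.

Lemma cipZl (c : R[i]) v w : cip (c *: v) w = c^* *: cip v w.
Proof. by rewrite -cip_star cipZr cstarZ cip_star. Qed.

Lemma cip0r v : cip v 0 = 0.
Proof. by rewrite -(scale0r (0 : E)) cipZr !scale0r. Qed.

Lemma cipNr v w : cip v (- w) = - cip v w.
Proof. by rewrite -scaleN1r cipZr scaleN1r. Qed.

Lemma cipBr v w x : cip v (w - x) = cip v w - cip v x.
Proof. by rewrite cipDr cipNr. Qed.

Lemma cipBl v w x : cip (v - w) x = cip v x - cip w x.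
Proof. by rewrite cipDl -[- w]scaleN1r cipZl rmorphN rmorph1 scaleN1r. Qed.

Lemma cip_sumr v (I : Type) (r : seq I) (D : pred I) (F : I -> E) :
  cip v (\sum_(i <- r | D i) F i) = \sum_(i <- r | D i) cip v (F i).
Proof. by apply: (big_morph (cip v)); [exact: cipDr|exact: cip0r]. Qed.

Lemma rn_cip_sq v : rn (cip v v) = rn v ^+ 2.
Proof. by apply: complexI; rewrite rmorphXn/= !rnE -cip_norm. Qed.

Lemma cip_eq0 v : (forall w, cip w v = 0) -> v = 0.
Proof.
move=> /(_ v) v0; apply: rn_eq0; apply/eqP.
by rewrite -sqrf_eq0 -rn_cip_sq v0 rn0.
Qed.

Lemma cip_inj v v' : (forall w, cip w v = cip w v') -> v = v'.
Proof.
by move=> H; apply/eqP; rewrite -subr_eq0; apply/eqP/cip_eq0 => w; rewrite cipBr H subrr.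
Qed.

Lemma fiber_semi_inner chi : is_character chi -> semi_inner (fiber_ip chi).
Proof.
move=> chiP; split=> [v w x|c v w|v w|v]; rewrite /fiber_ip.
- by rewrite cipDr charD.
- by rewrite cipZr charZ.
- by rewrite -char_star// cip_star.
- have [a ->] := cip_ge0 v; rewrite charM// char_star// mulrC -sqr_normc -rnE.
  by rewrite -rmorphXn/= sqr_ge0.
Qed.

Definition fnorm2 chi := qform (fiber_ip chi).

Lemma fnorm2_ge0 chi v : is_character chi -> 0 <= fnorm2 chi v.
Proof. by move=> chiP; exact/qform_ge0/fiber_semi_inner. Qed.

Lemma fnorm2_le chi v : is_character chi -> fnorm2 chi v <= rn v ^+ 2.
Proof.
move=> chiP; rewrite -rn_cip_sq; apply: le_trans (char_contractive chiP _).
exact: Re_le_rn.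
Qed.

Lemma rn_fnorm2 v : v <> 0 ->
  exists2 chi, is_character chi & fnorm2 chi v = rn v ^+ 2.
Proof.
move=> v0; have [|chi chiP h] := @exists_character R A (cip v v).
  by move=> vv0; apply: v0; apply: rn_eq0; apply/eqP; rewrite -sqrf_eq0 -rn_cip_sq vv0 rn0.
exists chi => //; rewrite -rn_cip_sq -h.
rewrite -[chi _]/(fiber_ip chi v v) (qformE (fiber_semi_inner chiP)) rnC ger0_norm//.
exact: fnorm2_ge0.
Qed.

Lemma rn_le_fnorm2 v (c : R) : 0 <= c ->
  (forall chi, is_character chi -> fnorm2 chi v <= c) -> rn v ^+ 2 <= c.
Proof.
move=> c0 H; have [->|/eqP v0] := eqVneq v 0; first by rewrite rn0 expr0n.
by have [chi /H + <-] := rn_fnorm2 v0.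
Qed.

Lemma rn_le_char (a : A) (c : R) : 0 <= c ->
  (forall chi, is_character chi -> rn (chi a) <= c) -> rn a <= c.
Proof.
move=> c0 H; have [->|/eqP a0] := eqVneq a 0; first by rewrite rn0.
by have [chi /H + <-] := exists_character a0.
Qed.

Lemma char_inj (a b : A) :
  (forall chi, is_character chi -> chi a = chi b) -> a = b.
Proof.
move=> H; apply/eqP; rewrite -subr_eq0; apply/eqP/rn_eq0/eqP.
rewrite eq_le rn_ge0 andbT; apply: rn_le_char => // chi chiP.
by rewrite charB// H// subrr rn0.
Qed.

Lemma rn_cip v w : rn (cip v w) <= rn v * rn w.
Proof.
apply: rn_le_char; first by rewrite mulr_ge0 ?rn_ge0.
move=> chi chiP; rewrite -(@ler_pXn2r _ 2) ?nnegrE ?mulr_ge0 ?rn_ge0//.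
apply: (le_trans (cauchy_schwarz (fiber_semi_inner chiP) v w)).
by rewrite exprMn ler_pM ?fnorm2_ge0 ?fnorm2_le.
Qed.

Lemma is_adjoint_sym S T : is_adjoint T S -> is_adjoint S T.
Proof. by move=> TS v w; rewrite -cip_star -TS cip_star. Qed.

Lemma is_adjointE S T v w : is_adjoint T S -> cip v (T w) = cip (S v) w.
Proof. by move=> /is_adjoint_sym ->. Qed.

Lemma adjE S T : is_adjoint T S -> adj T = S.
Proof.
move=> TS; have TS' : is_adjoint T (adj T) by rewrite /adj; case: xgetP => // /(_ S).
apply: funext => w; apply: cip_inj => v; by rewrite -TS' TS.
Qed.

Lemma adjP T : adjointable T -> is_adjoint T (adj T).
Proof. by move=> [S TS]; rewrite (adjE TS). Qed.

Lemma adjointable_adj T : adjointable T -> adjointable (adj T).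
Proof. by move=> /adjP/is_adjoint_sym h; exists T. Qed.

Lemma adjD T : adjointable T -> forall v w, T (v + w) = T v + T w.
Proof.
move=> /adjP h v w; apply: cip_inj => x.
by rewrite cipDr !(is_adjointE _ _ h) cipDr.
Qed.

Lemma adjZ T : adjointable T -> forall (c : R[i]) v, T (c *: v) = c *: T v.
Proof.
move=> /adjP h c v; apply: cip_inj => x.
by rewrite cipZr !(is_adjointE _ _ h) cipZr.
Qed.

Lemma adj_act T : adjointable T -> forall v a, T (cact v a) = cact (T v) a.
Proof.
move=> /adjP h v a; apply: cip_inj => x.
by rewrite cip_act !(is_adjointE _ _ h) cip_act.
Qed.

Lemma adj0 T : adjointable T -> T 0 = 0.
Proof. by move=> h; rewrite -(scale0r (0 : E)) adjZ// !scale0r. Qed.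

Lemma adjN T : adjointable T -> forall v, T (- v) = - T v.
Proof. by move=> h v; rewrite -scaleN1r adjZ// scaleN1r. Qed.

Lemma adjB T : adjointable T -> forall v w, T (v - w) = T v - T w.
Proof. by move=> h v w; rewrite adjD// adjN. Qed.

Lemma adj_sum T : adjointable T -> forall (I : Type) (r : seq I) (D : pred I) (F : I -> E),
  T (\sum_(i <- r | D i) F i) = \sum_(i <- r | D i) T (F i).
Proof. by move=> h I r D F; apply: (big_morph T); [exact: adjD|exact: adj0]. Qed.

Lemma is_adjoint_comp S S' T T' : is_adjoint S S' -> is_adjoint T T' ->
  is_adjoint (S \o T) (T' \o S').
Proof. by move=> hS hT v w /=; rewrite hS hT. Qed.

Lemma is_adjointD S S' T T' : is_adjoint S S' -> is_adjoint T T' ->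
  is_adjoint (fun v => S v + T v) (fun v => S' v + T' v).
Proof. by move=> hS hT v w /=; rewrite cipDl cipDr hS hT. Qed.

Lemma is_adjointB S S' T T' : is_adjoint S S' -> is_adjoint T T' ->
  is_adjoint (fun v => S v - T v) (fun v => S' v - T' v).
Proof. by move=> hS hT v w /=; rewrite cipBl cipBr hS hT. Qed.

Lemma is_adjointZ (c : R[i]) S S' : is_adjoint S S' ->
  is_adjoint (fun v => c *: S v) (fun v => c^* *: S' v).
Proof. by move=> hS v w /=; rewrite cipZl cipZr hS. Qed.

Lemma is_adjoint_iter n S S' : is_adjoint S S' ->
  is_adjoint (iter n S) (iter n S').
Proof.
by move=> hS; elim: n => // n IH v w; rewrite iterSr iterS IH hS.
Qed.

(** A gliding hump: the functionals [<T (v n), .>] with [|v n| <= 1] are all bounded at [x] by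
    [|S x|], whereas an unbounded [T] allows the construction of an [x] at which they are not. *)
Lemma adjointable_bounded T : adjointable T ->
  exists2 C : R, 0 <= C & forall v, rn (T v) <= C * rn v.
Proof.
move=> [S TS]; apply: contrapT => nb.
have aT : adjointable T by exists S.
have /choice[v vP] n : exists v, rn v <= 1 /\ 2 * n%:R * 3 ^+ n < rn (T v).
  apply: contrapT => /forallNP nv; apply: nb; exists (2 * n%:R * 3 ^+ n).
    by rewrite !mulr_ge0// exprn_ge0.
  move=> v; have [->|/eqP v0] := eqVneq v 0; first by rewrite adj0// rn0 mulr0.
  have rv := rn_gt0 v0; have rv' : rn (rn v)^-1%:C = (rn v)^-1.
    by rewrite rnC ger0_norm// invr_ge0 ltW.
  rewrite leNgt; apply/negP => h; apply: (nv ((rn v)^-1%:C *: v)); split.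
    by rewrite rnZ rv' mulVf// gt_eqF.
  by rewrite adjZ// rnZ rv' ltr_pdivlMl// mulrC.
pose y n := (rn (T (v n)))^-1%:C *: T (v n).
have Tv0 n : 0 < rn (T (v n)).
  by apply: le_lt_trans (vP n).2; rewrite !mulr_ge0// exprn_ge0.
have rTv' n : rn (rn (T (v n)))^-1%:C = (rn (T (v n)))^-1.
  by rewrite rnC ger0_norm// invr_ge0 ltW.
have yn n : rn (y n) = 1 by rewrite rnZ rTv' mulVf// gt_eqF.
have Ty n : rn (cip (T (v n)) (y n)) = rn (T (v n)).
  by rewrite cipZr rnZ rTv' rn_cip_sq expr2 mulrA mulVf ?mul1r// gt_eqF.
pose rho n : R := (3^-1) ^+ n.
have rho0 n : 0 <= rho n by rewrite exprn_ge0.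
have rhoS n : rho n.+1 = rho n / 3 by rewrite /rho exprSr.
(* The values at [x + rho n y n] and [x - rho n y n] differ by [2 rho n |T (v n)|], so one of the
   two signs works. *)
have sgn (n : nat) (x : E) : exists x', rn (x' - x) <= rho n /\
    rho n * rn (T (v n)) <= rn (cip (T (v n)) x').
  have rr : rn (rho n)%:C = rho n by rewrite rnC ger0_norm.
  have ry : rn ((rho n)%:C *: y n) = rho n by rewrite rnZ yn rr mulr1.
  have [le|gt] := leP (rho n * rn (T (v n)))
      (rn (cip (T (v n)) (x + (rho n)%:C *: y n))).
    by exists (x + (rho n)%:C *: y n); split=> //; rewrite addrC addKr ry.
  exists (x - (rho n)%:C *: y n); split.
    by rewrite addrC addKr rnN ry.
  have : 2 * rn (cip (T (v n)) ((rho n)%:C *: y n)) <=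
      rn (cip (T (v n)) (x + (rho n)%:C *: y n)) +
      rn (cip (T (v n)) (x - (rho n)%:C *: y n)).
    have -> : 2 * rn (cip (T (v n)) ((rho n)%:C *: y n)) =
        rn (cip (T (v n)) (x + (rho n)%:C *: y n) - cip (T (v n)) (x - (rho n)%:C *: y n)).
      by rewrite -cipBr opprD opprK addrACA subrr add0r cipDr rn_double.
    by rewrite (le_trans (rnD _ _))// rnN.
  by rewrite cipZr rnZ Ty rr; lra.
have [g gP] : {g : nat -> E -> E & forall n x, rn (g n x - x) <= rho n /\
    rho n * rn (T (v n)) <= rn (cip (T (v n)) (g n x))}.
  have /choice[g gP] : forall p : nat * E, exists x', rn (x' - p.2) <= rho p.1 /\
    rho p.1 * rn (T (v p.1)) <= rn (cip (T (v p.1)) x') by move=> [n x]; exact: sgn.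
  by exists (fun n x => g (n, x)) => n x; exact: (gP (n, x)).
pose u := fix u n := if n is n'.+1 then g n' (u n') else 0.
have ud n d : rn (u (n + d)%N - u n) <= 3 / 2 * (rho n - rho (n + d)%N).
  elim: d => [|d IH]; first by rewrite addn0 !subrr rn0 mulr0.
  rewrite addnS -(subrKA (u (n + d)%N)) (le_trans (rnD _ _))//.
  have := (gP (n + d)%N (u (n + d)%N)).1; rewrite rhoS.
  by move: IH; have := rho0 (n + d)%N; rewrite -/(u (n + d).+1); lra.
have e0 : (fun n => 3 / 2 * rho n) @ \oo --> (0 : R).
  by rewrite -(mulr0 (3 / 2)); apply: cvgMr; apply: cvg_expr; rewrite ger0_norm; lra.
have [|x _ xu] := @cauchy_rate R E u _ _ e0.
  move=> n m /subnKC <-; rewrite (le_trans (ud _ _))// ler_pM2l//.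
  by rewrite lerBlDr lerDl.
(* The corrections after step [n] add up to at most [rho n / 2], so at least half of
   [rho n * |T (v n)|] survives at [x]; the choice of [v n] makes that half exceed [n]. *)
have key n : n%:R < rn (S x).
  have h1 : rho n * rn (T (v n)) <= rn (cip (T (v n)) (u n.+1)).
    exact: (gP n (u n)).2.
  have h2 : rn (cip (T (v n)) (x - u n.+1)) <= rn (T (v n)) * (rho n / 2).
    rewrite (le_trans (rn_cip _ _))// ler_wpM2l ?rn_ge0// (le_trans (xu _))// rhoS; lra.
  have h3 : rn (cip (T (v n)) x) <= rn (S x).
    rewrite TS (le_trans (rn_cip _ _))// ler_piMl ?rn_ge0//; exact: (vP n).1.
  have h4 : rn (cip (T (v n)) (u n.+1)) <= rn (cip (T (v n)) x) + rn (cip (T (v n)) (x - u n.+1)).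
    by rewrite -[X in rn X <= _](subKr (cip (T (v n)) x)) -cipBr (le_trans (rnD _ _))// rnN.
  have h5 : 2 * n%:R < rho n * rn (T (v n)).
    by rewrite [ltRHS]mulrC /rho exprVn ltr_pdivlMr ?exprn_gt0//; exact: (vP n).2.
  by lra.
have := key (Num.truncn (rn (S x))).+1; apply/negP; rewrite -leNgt ltW//.
exact: truncnS_gt.
Qed.

Lemma adj_bound S T (c : R) : 0 <= c -> is_adjoint T S ->
  (forall v, rn (T v) <= c * rn v) -> forall v, rn (S v) <= c * rn v.
Proof.
move=> c0 TS Tc v; have [->|/eqP/rn_gt0 s0] := eqVneq (S v) 0.
  by rewrite rn0 mulr_ge0 ?rn_ge0.
rewrite -(ler_pM2l s0) -expr2 -rn_cip_sq -TS (le_trans (rn_cip _ _))//.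
by rewrite mulrCA mulrA ler_wpM2r ?rn_ge0// mulrC.
Qed.

(** Iterated Cauchy-Schwarz bounds the power [2^k] of the left side, up to powers of [q], by
    [<v, P k v>], where [P k] is the power [2^k] of [S T]. The norm bound controls this by
    [(c^2)^(2^k) * |v|^2], and [root_test] discards the constant [|v|^2 / q]. *)
Lemma fnorm2_bound S T (c : R) chi v : is_adjoint T S -> 0 <= c ->
  (forall v, rn (T v) <= c * rn v) -> is_character chi ->
  fnorm2 chi (T v) <= c ^+ 2 * fnorm2 chi v.
Proof.
move=> TS c0 Tc chiP; have sip := fiber_semi_inner chiP.
have aP : is_adjoint (S \o T) (S \o T).
  by apply: is_adjoint_comp => //; exact: is_adjoint_sym.
have Sc := adj_bound c0 TS Tc.
pose P k := iter k (fun X : E -> E => X \o X) (S \o T).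
have Pa k : is_adjoint (P k) (P k).
  by elim: k => // k IH; rewrite /P iterS; exact: is_adjoint_comp.
have Pc k w : rn (P k w) <= (c ^+ 2) ^+ (2 ^ k) * rn w.
  elim: k w => [|k IH] w /=.
    by rewrite expr1 (le_trans (Sc _))// expr2 -mulrA ler_wpM2l.
  rewrite (le_trans (IH _))// expnS mulnC exprM [X in _ <= X * _]expr2 -mulrA.
  by rewrite ler_wpM2l ?exprn_ge0 ?sqr_ge0.
set x := fnorm2 chi (T v); set q := fnorm2 chi v.
have x0 : 0 <= x by exact: fnorm2_ge0.
have q0 : 0 <= q by exact: fnorm2_ge0.
have xE : x = rn (fiber_ip chi v (P 0%N v)).
  rewrite /x /fiber_ip /= -TS -[chi _]/(fiber_ip chi (T v) (T v)) (qformE sip).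
  by rewrite rnC ger0_norm.
have [qq|qq] := eqVneq q 0.
  rewrite qq mulr0 xE; have := cauchy_schwarz sip v (P 0%N v).
  rewrite -[qform _ v]/q qq mul0r => h.
  by rewrite -(@ler_pXn2r _ 2) ?nnegrE ?rn_ge0// expr0n.
have qp : 0 < q by rewrite lt0r qq.
have key k : x ^+ (2 ^ k) * q <= q ^+ (2 ^ k) * rn (fiber_ip chi v (P k v)).
  elim: k => [|k IH]; first by rewrite !expr1 -xE mulrC.
  rewrite -(ler_pM2r qp) -mulrA -expr2 !expnS (mulnC 2) !exprM -exprMn.
  apply: (@le_trans _ _ ((q ^+ (2 ^ k) * rn (fiber_ip chi v (P k v))) ^+ 2)).
    by rewrite lerXn2r ?nnegrE ?mulr_ge0 ?exprn_ge0 ?rn_ge0.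
  rewrite exprMn -[leRHS]mulrA ler_wpM2l ?exprn_ge0//.
  apply: (le_trans (cauchy_schwarz sip _ _)); rewrite -[qform _ v]/q mulrC ler_wpM2r//.
  rewrite {2}/fiber_ip /P iterS -/(P k) /= -Pa; exact: Re_le_rn.
rewrite -/x -/q; apply: (@root_test _ _ _ (rn v ^+ 2 / q)).
  by rewrite mulr_ge0 ?sqr_ge0.
move=> n; exists (2 ^ n)%N; first by rewrite ltnW// ltn_expl.
rewrite mulrAC ler_pdivlMr// (le_trans (key n))//.
have -> : rn v ^+ 2 * (c ^+ 2 * q) ^+ (2 ^ n) =
    q ^+ (2 ^ n) * ((c ^+ 2) ^+ (2 ^ n) * rn v ^+ 2) by rewrite exprMn mulrC mulrAC mulrC.
rewrite ler_wpM2l ?exprn_ge0// (le_trans (char_contractive chiP _))//.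
rewrite (le_trans (rn_cip _ _))// [rn v ^+ 2]expr2 mulrCA ler_wpM2l ?rn_ge0//; exact: Pc.
Qed.

Lemma operator_limit (F G : nat -> E -> E) (e : nat -> R) :
  (forall n, is_adjoint (F n) (G n)) -> e @ \oo --> (0 : R) ->
  (forall n m v, (n <= m)%N -> rn (F m v - F n v) <= e n * rn v) ->
  exists T S, [/\ is_adjoint T S, forall n v, rn (T v - F n v) <= e n * rn v
    & forall n v, rn (S v - G n v) <= e n * rn v].
Proof.
move=> FG e0 Fe.
(* Nonnegativity of [e n] is read off from a nonzero vector, so the zero module is treated apart. *)
have [E0|/existsNP[v0 /eqP v00]] := pselect (forall v : E, v = 0).
  by exists id, id; split => // n v; rewrite (E0 v) (E0 (_ - _)) !rn0 mulr0.
have en n : 0 <= e n.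
  have := Fe n n v0 (leqnn n); rewrite subrr rn0 pmulr_lge0//.
  by apply: rn_gt0; apply/eqP.
have Ge n m v : (n <= m)%N -> rn (G m v - G n v) <= e n * rn v.
  move=> nm; apply: (@adj_bound (fun v => G m v - G n v) (fun v => F m v - F n v)) => //.
    exact: is_adjointB.
  by move=> w; exact: Fe.
have lim (H : nat -> E -> E) : (forall n m v, (n <= m)%N -> rn (H m v - H n v) <= e n * rn v) ->
    exists T, forall n v, rn (T v - H n v) <= e n * rn v.
  move=> He; have /choice[T TP] v : exists l, forall n, rn (l - H n v) <= e n * rn v.
    have [||l _ lP] := @cauchy_rate R E (H^~ v) (fun n => e n * rn v).
    - by move=> n m nm; exact: He.
    - by rewrite -(mul0r (rn v)); exact: cvgMl.
    by exists l.
  by exists T => n v; exact: TP.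
have [T TF] := lim _ Fe; have [S SG] := lim _ Ge.
exists T, S; split => // v w; apply/eqP; rewrite -subr_eq0; apply/eqP/rn_eq0/eqP.
rewrite eq_le rn_ge0 andbT; apply: (le_cvg0M (K := 2 * (rn v * rn w)) e0) => n.
have -> : cip (T v) w - cip v (S w) = cip (T v - F n v) w - cip v (S w - G n w).
  by rewrite cipBl cipBr FG opprB addrA subrK.
rewrite (le_trans (rnD _ _))// rnN.
have h1 : rn (cip (T v - F n v) w) <= rn v * rn w * e n.
  by rewrite (le_trans (rn_cip _ _))// mulrAC ler_wpM2r ?rn_ge0// mulrC.
have h2 : rn (cip v (S w - G n w)) <= rn v * rn w * e n.
  by rewrite (le_trans (rn_cip _ _))// -mulrA ler_wpM2l ?rn_ge0// mulrC.
by lra.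
Qed.

Lemma selfadjoint_limit (F : nat -> E -> E) (e : nat -> R) :
  (forall n, is_adjoint (F n) (F n)) -> e @ \oo --> (0 : R) ->
  (forall n m v, (n <= m)%N -> rn (F m v - F n v) <= e n * rn v) ->
  exists2 T, is_adjoint T T & forall n v, rn (T v - F n v) <= e n * rn v.
Proof.
move=> FF e0 Fe; have [T [S [TS TF SF]]] := operator_limit FF e0 Fe.
suff ST : S = T by exists T => //; rewrite -{2}ST.
apply: funext => v; apply/eqP; rewrite -subr_eq0; apply/eqP/rn_eq0/eqP.
rewrite eq_le rn_ge0 andbT; apply: (le_cvg0M (K := 2 * rn v) e0) => n.
rewrite -(subrKA (F n v)) (le_trans (rnD _ _))// (rnB (F n v)).
by have := TF n v; have := SF n v; lra.
Qed.

End hilbert_module_theory.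

(** * Positive operators and square roots *)

Section positive_operators.
Context {R : realType} {A : commCStarAlgType R} {E : hilbertModType A}.
Implicit Types (chi : A -> complexC R) (v w x : E) (S T P Q L : E -> E).

Lemma cip0l v : cip (0 : E) v = 0.
Proof. by rewrite -(subrr v) cipBl subrr. Qed.

Definition fiber_re chi v w : R := complex.Re (fiber_ip chi v w).

Section fiber_re_theory.
Variable chi : A -> complexC R.
Hypothesis chiP : is_character chi.

Let sip := fiber_semi_inner (E := E) chiP.

Lemma freC v w : fiber_re chi v w = fiber_re chi w v.
Proof. by rewrite /fiber_re -(sipC sip w v); case: (fiber_ip chi w v). Qed.

Lemma freDr v w x : fiber_re chi v (w + x) = fiber_re chi v w + fiber_re chi v x.
Proof. by rewrite /fiber_re (sipDr sip) raddfD. Qed.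

Lemma freZr (c : R) v w : fiber_re chi v (c%:C *: w) = c * fiber_re chi v w.
Proof. by rewrite /fiber_re (sipZr sip); case: (fiber_ip chi v w) => a b /=; ring. Qed.

Lemma freNr v w : fiber_re chi v (- w) = - fiber_re chi v w.
Proof. by rewrite /fiber_re -scaleN1r (sipZr sip) mulN1r raddfN. Qed.

Lemma freBr v w x : fiber_re chi v (w - x) = fiber_re chi v w - fiber_re chi v x.
Proof. by rewrite freDr freNr. Qed.

Lemma freBl v w x : fiber_re chi (v - w) x = fiber_re chi v x - fiber_re chi w x.
Proof. by rewrite freC freBr !(freC x). Qed.

Lemma fre0r v : fiber_re chi v 0 = 0.
Proof. by rewrite -(subrr v) freBr subrr. Qed.

Lemma fre_fnorm2 v : fiber_re chi v v = fnorm2 chi v.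
Proof. by []. Qed.

Lemma fre_adj S T v w : is_adjoint T S -> fiber_re chi (T v) w = fiber_re chi v (S w).
Proof. by move=> TS; rewrite /fiber_re /fiber_ip TS. Qed.

Lemma fre_cs v w : fiber_re chi v w ^+ 2 <= fnorm2 chi v * fnorm2 chi w.
Proof.
apply: le_trans (cauchy_schwarz sip v w); rewrite rn_sqr lerDl; exact: sqr_ge0.
Qed.

Lemma fnorm2_le2D v w : fnorm2 chi (v + w) <= 2 * fnorm2 chi v + 2 * fnorm2 chi w.
Proof. exact: (qform_le2D sip). Qed.

Lemma fnorm2N v : fnorm2 chi (- v) = fnorm2 chi v.
Proof. exact: (qformN sip). Qed.

Lemma fnorm2_le2B v w : fnorm2 chi (v - w) <= 2 * fnorm2 chi v + 2 * fnorm2 chi w.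
Proof. by rewrite -[fnorm2 chi w]fnorm2N fnorm2_le2D. Qed.

Lemma fnorm2Z (c : R) v : fnorm2 chi (c%:C *: v) = c ^+ 2 * fnorm2 chi v.
Proof. by rewrite /fnorm2 (qformZ sip) rnC real_normK ?num_real. Qed.

End fiber_re_theory.

Lemma fnorm2_eq_cip v w :
  (forall chi, is_character chi -> fnorm2 chi v = fnorm2 chi w) -> cip v v = cip w w.
Proof.
move=> H; apply: char_inj => chi chiP.
have sip := fiber_semi_inner (E := E) chiP.
by rewrite -[LHS]/(fiber_ip chi v v) -[RHS]/(fiber_ip chi w w) !(qformE sip) [X in X%:C]H.
Qed.

(** Positivity tested on characters, which passes to sums and limits; it agrees with [op_positive]
    once square roots are available. *)
Definition psd P := is_adjoint P P /\
  forall chi, is_character chi -> forall v, 0 <= fiber_re chi v (P v).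

Lemma psd_adjointable P : psd P -> adjointable P.
Proof. by case=> PP _; exists P. Qed.

Lemma psd_semi_inner P chi : psd P -> is_character chi ->
  semi_inner (fun v w => fiber_ip chi v (P w)).
Proof.
move=> pP chiP; have sip := fiber_semi_inner (E := E) chiP.
have aP := psd_adjointable pP.
split=> [v w x|c v w|v w|v].
- by rewrite (adjD aP) (sipDr sip).
- by rewrite (adjZ aP) (sipZr sip).
- by rewrite (sipC sip) /fiber_ip pP.1.
- exact: pP.2.
Qed.

(** Cauchy-Schwarz for the semi-inner product [<v, P w>] in each fiber. *)
Lemma psd_eq0 P v : psd P ->
  (forall chi, is_character chi -> fiber_re chi v (P v) = 0) -> P v = 0.
Proof.
move=> pP v0; apply: cip_eq0 => w; apply: char_inj => chi chiP.
rewrite char0//.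
exact: (qform_eq0 (psd_semi_inner pP chiP) w (v0 _ chiP)).
Qed.

Lemma psd_sq S T : is_adjoint T S -> psd (S \o T).
Proof.
move=> TS; split; first by apply: is_adjoint_comp => //; exact: is_adjoint_sym.
by move=> chi chiP v /=; rewrite -(fre_adj _ _ _ TS); exact: fnorm2_ge0.
Qed.

Lemma psd_scale (c : R) P : 0 <= c -> psd P -> psd (fun v => c%:C *: P v).
Proof.
move=> c0 pP; split.
  have := is_adjointZ c%:C pP.1; rewrite (_ : (c%:C)^* = c%:C)//.
  exact: (conjc_real c).
by move=> chi chiP v; rewrite freZr// mulr_ge0// pP.2.
Qed.

(** Cauchy-Schwarz for [<v, P w>] gives [|P v|^4 <= <P v, P (P v)> <v, P v>], at most
    [c |P v|^2 * c |v|^2] in each fiber. *)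
Lemma psd_bound P (c : R) : psd P -> 0 <= c ->
  (forall chi, is_character chi -> forall v, fiber_re chi v (P v) <= c * fnorm2 chi v) ->
  forall v, rn (P v) <= c * rn v.
Proof.
move=> pP c0 Pc v.
rewrite -(@ler_pXn2r _ 2) ?nnegrE ?mulr_ge0 ?rn_ge0// exprMn.
apply: rn_le_fnorm2; first by rewrite mulr_ge0 ?sqr_ge0.
move=> chi chiP; apply: (@le_trans _ _ (c ^+ 2 * fnorm2 chi v)); last first.
  by rewrite ler_wpM2l ?sqr_ge0 ?fnorm2_le.
have q0 : 0 <= fnorm2 chi (P v) by exact: fnorm2_ge0.
have [->|qn] := eqVneq (fnorm2 chi (P v)) 0.
  by rewrite mulr_ge0 ?sqr_ge0 ?fnorm2_ge0.
have qp : 0 < fnorm2 chi (P v) by rewrite lt0r qn.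
have := cauchy_schwarz (psd_semi_inner pP chiP) (P v) v.
rewrite (qformE (fiber_semi_inner chiP)) rnC real_normK ?num_real//.
rewrite -[qform _ (P v)]/(fnorm2 chi (P v)) => h.
rewrite -(ler_pM2l qp) -expr2; apply: (le_trans h).
have -> : fnorm2 chi (P v) * (c ^+ 2 * fnorm2 chi v) =
  (c * fnorm2 chi (P v)) * (c * fnorm2 chi v) by ring.
by apply: ler_pM; rewrite ?Pc//; exact: pP.2.
Qed.

End positive_operators.

(** * The square root of [1 - K] for a self-adjoint contraction [K] *)

Section square_root.
Context {R : realType} {A : commCStarAlgType R} {E : hilbertModType A}.
Implicit Types (chi : A -> complexC R) (v w x : E) (S T P Q L : E -> E).

(* [nnpoly K T a]: [T] is a polynomial in [K] with nonnegative coefficients of sum [a]. *)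
Inductive nnpoly (K : E -> E) : (E -> E) -> R -> Prop :=
| Nnpoly0 : nnpoly K (fun=> 0) 0
| NnpolyX : nnpoly K K 1
| NnpolyD S T a b : nnpoly K S a -> nnpoly K T b ->
    nnpoly K (fun v => S v + T v) (a + b)
| NnpolyM S T a b : nnpoly K S a -> nnpoly K T b -> nnpoly K (S \o T) (a * b)
| NnpolyZ c S a : 0 <= c -> nnpoly K S a -> nnpoly K (fun v => c%:C *: S v) (c * a).

Lemma nnpoly_comm K L S a : nnpoly K S a -> adjointable L ->
  (forall v, L (K v) = K (L v)) -> forall v, L (S v) = S (L v).
Proof.
move=> KS aL LK; elim: {S a} KS => [|//|S T a b _ IS _ IT|S T a b _ IS _ IT|c S a _ _ IS] v /=.
- exact: adj0.
- by rewrite (adjD aL) IS IT.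
- by rewrite IS IT.
- by rewrite (adjZ aL) IS.
Qed.

Section contraction.
Variable K : E -> E.
Hypothesis KK : is_adjoint K K.
Hypothesis K1 : forall v, rn (K v) <= rn v.

Lemma nnpoly_adjointable S a : nnpoly K S a -> adjointable S.
Proof.
elim=> [||T S' a' b _ [T' TT'] _ [S'' SS']|T S' a' b _ [T' TT'] _ [S'' SS']|c T a' _ _ [T' TT']].
- by exists (fun=> 0) => v w; rewrite cip0l cip0r.
- by exists K.
- by eexists; exact: is_adjointD TT' SS'.
- by eexists; exact: is_adjoint_comp TT' SS'.
- by exists (fun v => (c%:C)^* *: T' v); apply: is_adjointZ.
Qed.

Lemma nnpoly_comm2 S T a b : nnpoly K S a -> nnpoly K T b ->
  forall v, S (T v) = T (S v).
Proof.
move=> KS KT; apply: (nnpoly_comm KT); first exact: nnpoly_adjointable KS.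
move=> v; apply/esym; apply: (nnpoly_comm KS) => //; by exists K.
Qed.

Lemma nnpoly_selfadjoint S a : nnpoly K S a -> is_adjoint S S.
Proof.
elim=> [|//|T S' a' b _ TT _ SS|T S' a' b nT TT nS SS|c T a' _ _ TT].
- by move=> v w; rewrite cip0l cip0r.
- exact: is_adjointD.
- have -> : T \o S' = S' \o T by apply: funext => v /=; rewrite (nnpoly_comm2 nT nS).
  rewrite [X in is_adjoint _ X](_ : _ = T \o S'); first exact: is_adjoint_comp.
  by apply: funext => v /=; rewrite (nnpoly_comm2 nT nS).
- have := is_adjointZ c%:C TT; rewrite (_ : (c%:C)^* = c%:C)//.
  exact: (conjc_real c).
Qed.

Lemma nnpoly_bound S a : nnpoly K S a -> 0 <= a /\ forall v, rn (S v) <= a * rn v.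
Proof.
elim=> [||T S' a' b _ [a0 Ta] _ [b0 Sb]|T S' a' b _ [a0 Ta] _ [b0 Sb]|c T a' c0 _ [a0 Ta]].
- by split=> // v; rewrite rn0 mul0r.
- by split=> // v; rewrite mul1r.
- split; first exact: addr_ge0.
  by move=> v; rewrite mulrDl (le_trans (rnD _ _))// lerD.
- split; first exact: mulr_ge0.
  by move=> v /=; rewrite (le_trans (Ta _))// -mulrA ler_wpM2l.
- split; first exact: mulr_ge0.
  by move=> v; rewrite rnZ rnC ger0_norm// -mulrA ler_wpM2l.
Qed.

(* [1 - X] with [X = (K + X^2) / 2] is a square root of [1 - K]. *)
Let Xn n : E -> E := iter n (fun X v => (2^-1)%:C *: (K v + X (X v))) (fun=> 0).
Let xn n : R := iter n (fun t : R => 2^-1 * (1 + t * t)) 0.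

Let XnS n v : Xn n.+1 v = (2^-1)%:C *: (K v + Xn n (Xn n v)).
Proof. by []. Qed.

Let diff_sq S T v : adjointable S -> adjointable T ->
  (forall w, S (T w) = T (S w)) ->
  S (S v) - T (T v) = S (S v + T v) - T (S v + T v).
Proof.
by move=> aS aT ST; rewrite (adjD aS) (adjD aT) ST opprD addrA addrK.
Qed.

Let nX n : nnpoly K (Xn n) (xn n).
Proof.
elim: n => [|n IH]; first exact: Nnpoly0.
rewrite /Xn /xn !iterS -/(Xn n) -/(xn n); apply: NnpolyZ; first by rewrite invr_ge0.
exact: (NnpolyD (NnpolyX K) (NnpolyM IH IH)).
Qed.

(** By [diff_sq] the increments again have nonnegative coefficients, so their norms are dominated by
    the scalar iteration [xn], which is the case [K = 1]. *)
Let nXS n : nnpoly K (fun v => Xn n.+1 v - Xn n v) (xn n.+1 - xn n).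
Proof.
elim: n => [|n IH].
  have -> : (fun v => Xn 1 v - Xn 0 v) = (Xn 1) by apply: funext => v; rewrite subr0.
  by rewrite subr0; exact: nX.
have -> : (fun v => Xn n.+2 v - Xn n.+1 v) = (fun v => (2^-1)%:C *:
    (((fun v => Xn n.+1 v - Xn n v) \o (fun v => Xn n.+1 v + Xn n v)) v)).
  apply: funext => v; rewrite !XnS -scalerBr; congr (_ *: _).
  rewrite opprD addrACA subrr add0r; apply: diff_sq => //.
  - exact: nnpoly_adjointable (nX _).
  - exact: nnpoly_adjointable (nX _).
  - exact: (nnpoly_comm2 (nX _) (nX _)).
have -> : xn n.+2 - xn n.+1 = 2^-1 * ((xn n.+1 - xn n) * (xn n.+1 + xn n)).
  by rewrite /xn iterS [in X in _ - X]iterS -/(xn n.+1) -/(xn n); ring.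
apply: NnpolyZ; first by rewrite invr_ge0.
exact: (NnpolyM IH (NnpolyD (nX n.+1) (nX n))).
Qed.

Let nXB n m : (n <= m)%N -> nnpoly K (fun v => Xn m v - Xn n v) (xn m - xn n).
Proof.
move/subnKC <-; elim: (m - n)%N => [|d IH].
  rewrite addn0 subrr (_ : (fun v => _) = fun=> 0); first exact: Nnpoly0.
  by apply: funext => v; rewrite subrr.
rewrite addnS.
have -> : (fun v => Xn (n + d).+1 v - Xn n v) = (fun v =>
    (Xn (n + d).+1 v - Xn (n + d)%N v) + (Xn (n + d)%N v - Xn n v)).
  by apply: funext => v; rewrite subrKA.
have -> : xn (n + d).+1 - xn n = (xn (n + d).+1 - xn (n + d)%N) + (xn (n + d)%N - xn n).
  by rewrite subrKA.
exact: NnpolyD (nXS _) IH.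
Qed.

(** In terms of [y = 1 - xn] the iteration is [y - y^2 / 2]. The decay is only of order [1 / n], as
    nothing keeps [K] away from 1. *)
Let xn1 n : 0 <= xn n <= 1 /\ 1 - xn n <= 2 / n.+2%:R.
Proof.
elim: n => [|n [/andP[x0 x1] IH]]; first by rewrite lexx ler01 subr0 divff.
rewrite /xn iterS -/(xn n); set x := xn n in x0 x1 IH *.
split; first by apply/andP; split; nra.
rewrite -natr1 in IH *; set t : R := n.+2%:R in IH *.
have t2 : 2 <= t by rewrite /t ler_nat.
set y := 1 - x in IH.
have -> : 1 - 2^-1 * (1 + x * x) = y - y * y / 2 by rewrite /y; field.
have y0 : 0 <= y by rewrite subr_ge0.
have y1 : y <= 1 by rewrite /y; lra.
have IH' : y * t <= 2 by rewrite -ler_pdivlMr//; lra.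
by rewrite ler_pdivlMr; nra.
Qed.

(** The limit satisfies [2 X = K + X^2], that is [(1 - X)^2 = 1 - K]. Positivity comes from
    [|X| <= 1], and commutation passes to the limit because adjointable operators are bounded. *)
Lemma sqrt_1B : exists Q,
  [/\ psd Q, forall v, Q (Q v) = v - K v
    & forall L, adjointable L -> (forall v, L (K v) = K (L v)) ->
        forall v, L (Q v) = Q (L v)].
Proof.
have e0 : (fun n => 2 / n.+1%:R) @ \oo --> (0 : R).
  by rewrite -(mulr0 2); apply: cvgMr; exact: cvg_harmonic.
have xe n : 1 - xn n <= 2 / n.+1%:R.
  apply: (le_trans (xn1 n).2); rewrite ler_pM2l// lef_pV2 ?posrE ?ltr0n//.
  by rewrite ler_nat.
have eS n : 2 / n.+2%:R <= 2 / n.+1%:R :> R.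
  by rewrite ler_pM2l// lef_pV2 ?posrE ?ltr0n// ler_nat.
have [||X XX XXn] := @selfadjoint_limit R A E Xn _ _ e0.
- by move=> n; exact: nnpoly_selfadjoint (nX n).
- move=> n m v nm; have [_ h] := nnpoly_bound (nXB nm).
  apply: (le_trans (h v)); rewrite ler_wpM2r ?rn_ge0// (le_trans _ (xe n))//.
  by have [/andP[_ ?] _] := xn1 m; lra.
pose e n : R := 2 / n.+1%:R.
have {}XXn n v : rn (X v - Xn n v) <= e n * rn v by exact: XXn.
have {}e0 : e @ \oo --> (0 : R) by exact: e0.
have {}eS n : e n.+1 <= e n by exact: eS.
have e_ge0 n : 0 <= e n by rewrite divr_ge0.
clearbody e.
have Xc n v : rn (Xn n v) <= rn v.
  have [_ h] := nnpoly_bound (nX n); apply: (le_trans (h v)).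
  by rewrite ler_piMl ?rn_ge0//; have [/andP[]] := xn1 n.
have aX : adjointable X by exists X.
have X1 v : rn (X v) <= rn v.
  rewrite -subr_le0; apply: (le_cvg0M (K := rn v) e0) => n.
  have := rnD (X v - Xn n v) (Xn n v); rewrite subrK.
  by have := XXn n v; have := Xc n v; lra.
have aXn n : adjointable (Xn n) by exact: nnpoly_adjointable (nX n).
have XE v : X v = (2^-1)%:C *: (K v + X (X v)).
  apply/eqP; rewrite -subr_eq0; apply/eqP/rn_eq0/eqP.
  rewrite eq_le rn_ge0 andbT; apply: (le_cvg0M (K := 2 * rn v + rn (X v)) e0) => n.
  have -> : X v - (2^-1)%:C *: (K v + X (X v)) =
      (X v - Xn n.+1 v) +
      ((2^-1)%:C *: (- Xn n (X v - Xn n v)) + (2^-1)%:C *: (- (X (X v) - Xn n (X v)))).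
    rewrite (adjB (aXn n)) -scalerDr !opprB addrA subrK XnS -[RHS]addrA.
    by congr (_ + _); rewrite -!scalerN -scalerDr !opprD addrA subrK.
  have h1 := XXn n.+1 v; have h2 := XXn n (X v).
  have h3 : rn (Xn n (X v - Xn n v)) <= e n * rn v by exact: le_trans (Xc _ _) (XXn _ _).
  have h4 : e n.+1 * rn v <= e n * rn v by rewrite ler_wpM2r ?rn_ge0.
  rewrite (le_trans (rnD _ _))//.
  have h5 := rnD ((2^-1)%:C *: (- Xn n (X v - Xn n v)))
                 ((2^-1)%:C *: (- (X (X v) - Xn n (X v)))).
  rewrite !rnZ !rnN rnC ger0_norm ?invr_ge0// in h5.
  have e1 := e_ge0 n.
  by have := rn_ge0 v; have := rn_ge0 (X v); nra.
exists (fun v => v - X v); split.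
- split; first exact: is_adjointB.
  move=> chi chiP v; rewrite freBr// fre_fnorm2 subr_ge0.
  have h := fre_cs chiP v (X v).
  have q0 : 0 <= fnorm2 chi v by exact: fnorm2_ge0.
  have h1 : fnorm2 chi (X v) <= 1 ^+ 2 * fnorm2 chi v.
    by apply: (fnorm2_bound v XX) => // w; rewrite mul1r.
  by rewrite leNgt; apply/negP => h2; nra.
- move=> v; rewrite (adjB aX).
  have /(canRL (addKr _)) : K v + X (X v) = X v + X v.
    rewrite {2 3}(XE v) -scalerDl -rmorphD/= [X in X%:C](_ : _ = 1) ?scale1r//.
    by rewrite -[2^-1]mul1r -splitr.
  have -> : - K v + (X v + X v) = X v + (X v - K v) by rewrite addrC addrA.
  by move=> ->; rewrite opprB (addrC (X v) (X v - K v)) addrK addrA subrK.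
- move=> L aL LK v; rewrite (adjB aL); congr (_ - _).
  have [C C0 LC] := adjointable_bounded aL.
  apply/eqP; rewrite -subr_eq0; apply/eqP/rn_eq0/eqP.
  rewrite eq_le rn_ge0 andbT; apply: (le_cvg0M (K := C * rn v + rn (L v)) e0) => n.
  rewrite -(subrKA (L (Xn n v))) (le_trans (rnD _ _))// -(adjB aL).
  rewrite (nnpoly_comm (nX n) aL LK) (rnB (Xn n (L v))).
  have := LC (X v - Xn n v); have := XXn n v; have := XXn n (L v); nra.
Qed.

End contraction.
End square_root.

(** * Uniqueness of roots, absolute values and weak polar decompositions *)

Section operator_roots.
Context {R : realType} {A : commCStarAlgType R} {E : hilbertModType A}.
Implicit Types (chi : A -> complexC R) (v w x : E) (S T P Q L : E -> E).

(* The commutation clause stands for [Q] being a limit of polynomials in [P]. *)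
Definition good_sqrt P Q :=
  [/\ psd Q, forall v, Q (Q v) = P v
    & forall L, adjointable L -> (forall v, L (P v) = P (L v)) ->
        forall v, L (Q v) = Q (L v)].

Lemma psd_1B P : psd P ->
  (forall chi, is_character chi -> forall v, fiber_re chi v (P v) <= fnorm2 chi v) ->
  psd (fun v => v - P v).
Proof.
move=> pP P1; split; first by apply: is_adjointB => //; exact: pP.1.
by move=> chi chiP v; rewrite freBr// subr_ge0 P1.
Qed.

Lemma good_sqrt_contraction P : psd P ->
  (forall chi, is_character chi -> forall v, fiber_re chi v (P v) <= fnorm2 chi v) ->
  exists Q, good_sqrt P Q.
Proof.
move=> pP P1; pose K v := v - P v; have pK : psd K by exact: psd_1B.
have K1 v : rn (K v) <= rn v.
  rewrite -[leRHS]mul1r; apply: (psd_bound pK) => // chi chiP w.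
  by rewrite mul1r freBr// lerBlDr lerDl pP.2.
have [Q [pQ QQ QL]] := sqrt_1B pK.1 K1.
exists Q; split=> //.
  by move=> v; rewrite QQ /K subKr.
by move=> L aL LP v; apply: QL => // w; rewrite /K (adjB aL) LP.
Qed.

Lemma exists_good_sqrt P : psd P -> exists Q, good_sqrt P Q.
Proof.
move=> pP; have [C C0 PC] := adjointable_bounded (psd_adjointable pP).
have aP := psd_adjointable pP.
(* The summand 1 keeps [c] invertible when [P = 0]; rescaling by [c] reduces to a contraction. *)
pose c := C + 1; have c0 : 0 < c by rewrite ltr_wpDl.
have pP' : psd (fun v => c^-1%:C *: P v).
  by apply: psd_scale => //; rewrite invr_ge0 ltW.
have [|Q [pQ QQ QL]] := good_sqrt_contraction pP'.
  move=> chi chiP v; rewrite freZr// mulrC ler_pdivrMr//.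
  have q0 : 0 <= fnorm2 chi v by exact: fnorm2_ge0.
  have h1 := fnorm2_bound v pP.1 C0 PC chiP.
  have h2 := fre_cs chiP v (P v).
  have h3 : fiber_re chi v (P v) ^+ 2 <= (fnorm2 chi v * c) ^+ 2.
    apply: (le_trans h2); apply: (le_trans (ler_wpM2l q0 h1)).
    rewrite mulrCA -expr2 exprMn mulrC ler_wpM2l ?sqr_ge0//.
    by rewrite ler_pXn2r ?nnegrE ?(ltW c0)// lerDl.
  have h4 : 0 <= fnorm2 chi v * c by rewrite mulr_ge0 ?(ltW c0).
  have h5 := pP.2 _ chiP v.
  by rewrite -(@ler_pXn2r _ 2).
pose s := Num.sqrt c; have s0 : 0 <= s by exact: sqrtr_ge0.
have ss : s * s = c by rewrite -expr2 sqr_sqrtr// ltW.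
have aQ := psd_adjointable pQ.
exists (fun v => s%:C *: Q v); split.
- exact: psd_scale.
- move=> v; rewrite (adjZ aQ) QQ !scalerA -!rmorphM/= ?mulrA ss divff ?gt_eqF//.
  by rewrite scale1r.
- move=> L aL LP v; rewrite (adjZ aL) QL// => w.
  by rewrite (adjZ aL) LP.
Qed.

Lemma psd_add_eq0 P Q v : psd P -> psd Q ->
  (forall chi, is_character chi -> fiber_re chi v (P v) + fiber_re chi v (Q v) = 0) ->
  P v = 0 /\ Q v = 0.
Proof.
by move=> pP pQ H; split; apply: psd_eq0 => // chi chiP;
  have := H _ chiP; have := pP.2 _ chiP v; have := pQ.2 _ chiP v; lra.
Qed.

(** As [S] commutes with [P = S^2], it commutes with [Q], so [(S + Q) (S - Q) = 0]. Both summands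
    being positive, [S] and [Q] each vanish on the range of [S - Q], whence [(S - Q)^2 = 0]. *)
Lemma good_sqrt_unique P Q S : good_sqrt P Q -> psd S -> (forall v, S (S v) = P v) ->
  S = Q.
Proof.
move=> [pQ QQ QL] pS SS; have aS := psd_adjointable pS; have aQ := psd_adjointable pQ.
have SQ v : S (Q v) = Q (S v) by apply: QL => // w; rewrite -!SS.
apply: funext => v; apply/eqP; rewrite -subr_eq0; apply/eqP.
have D0 w : S (S w - Q w) = 0 /\ Q (S w - Q w) = 0.
  apply: psd_add_eq0 => // chi chiP; rewrite -freDr//.
  have -> : S (S w - Q w) + Q (S w - Q w) = 0.
    by rewrite (adjB aS) (adjB aQ) SQ addrA subrK SS QQ subrr.
  exact: fre0r.
have [Sw Qw] := D0 v.
apply: rn_eq0; apply/eqP; rewrite -sqrf_eq0 -rn_cip_sq.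
by rewrite cipBl pS.1 pQ.1 Sw Qw !cip0r subrr rn0.
Qed.

Lemma psd_op_positive P : psd P -> op_positive P.
Proof.
move=> /exists_good_sqrt[Q [pQ QQ _]]; exists Q; first exact: psd_adjointable.
by rewrite (adjE pQ.1); apply: funext => v /=; rewrite QQ.
Qed.

Lemma op_positive_psd P : op_positive P -> psd P.
Proof. by move=> [Q aQ ->]; apply/psd_sq/adjP. Qed.

Lemma sqrt_opE P Q : psd Q -> (forall v, Q (Q v) = P v) -> sqrt_op P = Q.
Proof.
move=> pQ QQ; have pP : psd P.
  have -> : P = Q \o Q by apply: funext => v /=; rewrite QQ.
  by apply: psd_sq; exact: pQ.1.
have [Q0 gQ0] := exists_good_sqrt pP.
rewrite (good_sqrt_unique gQ0 pQ QQ).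
rewrite /sqrt_op; case: xgetP => [S -> [_ pS SS]|].
  by apply: (good_sqrt_unique gQ0) => [|v]; [exact: op_positive_psd|exact: (congr1 (@^~ v) SS)].
move=> /(_ Q)[]; split; first exact: psd_adjointable.
  exact: psd_op_positive.
by apply: funext => v /=; rewrite QQ.
Qed.

Lemma sqrt_opP P : psd P -> good_sqrt P (sqrt_op P).
Proof.
move=> /exists_good_sqrt[Q gQ]; rewrite (@sqrt_opE _ Q)//.
  by case: gQ.
by case: gQ.
Qed.

Lemma abs_opP T : adjointable T -> good_sqrt (adj T \o T) (abs_op T).
Proof. by move=> aT; apply/sqrt_opP/psd_sq/adjP. Qed.

Section decay.
Variable r : E -> E.
Hypothesis rr : is_adjoint r r.

(* [k |-> |r^k v|^2] is convex. *)
Lemma fnorm2_iter_decay chi v n : is_character chi ->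
  fnorm2 chi (iter n r v) - fnorm2 chi (iter n.+1 r v) <= fnorm2 chi v / n.+1%:R.
Proof.
move=> chiP; pose d k := fnorm2 chi (iter k r v) - fnorm2 chi (iter k.+1 r v).
have dS k : d k.+1 <= d k.
  rewrite /d !iterS; set w := iter k r v.
  have : 0 <= fnorm2 chi (w - r (r w)) by exact: fnorm2_ge0.
  rewrite -fre_fnorm2 freBl// !freBr// !fre_fnorm2 (freC chiP (r (r w))).
  by rewrite -(fre_adj _ _ _ rr) fre_fnorm2; lra.
rewrite ler_pdivlMr ?ltr0n// mulrC -[X in _ * X]/(d n).
suff : n.+1%:R * d n <= fnorm2 chi v - fnorm2 chi (iter n.+1 r v).
  by have := fnorm2_ge0 (iter n.+1 r v) chiP; lra.
elim: n => [|n IH]; first by rewrite mul1r.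
rewrite -natr1 mulrDl mul1r.
have : n.+1%:R * d n.+1 <= n.+1%:R * d n by rewrite ler_wpM2l ?ler0n.
rewrite /d in IH *; lra.
Qed.

End decay.

Lemma cvg_sqrt_rate (c : R) : (fun n => Num.sqrt (c / n.+1%:R)) @ \oo --> (0 : R).
Proof.
have c0 : (fun n => c / n.+1%:R) @ \oo --> (0 : R).
  by rewrite -(mulr0 c); apply: cvgMr; exact: cvg_harmonic.
by have := cvg_comp _ _ c0 (@sqrt_continuous R 0); rewrite sqrtr0.
Qed.

Lemma rn_le_rate v w (c : R) : 0 <= c ->
  (forall chi, is_character chi -> fnorm2 chi v <= c * fnorm2 chi w) ->
  rn v <= Num.sqrt c * rn w.
Proof.
move=> c0 H; rewrite -(@ler_pXn2r _ 2) ?nnegrE ?mulr_ge0 ?rn_ge0 ?sqrtr_ge0//.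
rewrite exprMn sqr_sqrtr//; apply: rn_le_fnorm2; first by rewrite mulr_ge0 ?sqr_ge0.
by move=> chi chiP; rewrite (le_trans (H _ chiP))// ler_wpM2l// fnorm2_le.
Qed.

Lemma cip_eq_lim (u y : nat -> E) v w (c : R) (e : nat -> R) :
  e @ \oo --> (0 : R) -> (forall n, 0 <= e n <= c) ->
  (forall n, rn (v - u n) <= e n) -> (forall n, rn (w - y n) <= e n) ->
  (forall n, cip (u n) (u n) = cip (y n) (y n)) -> cip v v = cip w w.
Proof.
move=> e0 ec vu wy uy.
have key (x : E) (z : nat -> E) n : (forall n, rn (x - z n) <= e n) ->
    rn (cip x x - cip (z n) (z n)) <= (2 * rn x + c) * e n.
  move=> xz; have h := xz n; have /andP[en0 enc] := ec n.
  have -> : cip x x - cip (z n) (z n) =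
      cip (x - z n) x + (cip x (x - z n) - cip (x - z n) (x - z n)).
    by rewrite -cipBl subKr cipBl cipBr addrA subrK.
  rewrite (le_trans (rnD _ _))//.
  have h1 := rnD (cip x (x - z n)) (- cip (x - z n) (x - z n)).
  rewrite rnN in h1.
  have h2 := rn_cip (x - z n) x; have h3 := rn_cip x (x - z n).
  have h4 := rn_cip (x - z n) (x - z n).
  have x0 := rn_ge0 x; have xz0 := rn_ge0 (x - z n).
  nra.
apply/eqP; rewrite -subr_eq0; apply/eqP/rn_eq0/eqP.
rewrite eq_le rn_ge0 andbT; apply: (le_cvg0M (K := (2 * rn v + c) + (2 * rn w + c)) e0) => n.
have -> : cip v v - cip w w = (cip v v - cip (u n) (u n)) - (cip w w - cip (y n) (y n)).
  by rewrite uy opprB addrA subrK.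
rewrite (le_trans (rnD _ _))// rnN mulrDl lerD//; exact: key.
Qed.

(** The difference is self-adjoint with zero quadratic form, hence positive, and [psd_eq0]
    applies. *)
Lemma cip_eq_adj S S' Q : is_adjoint S S' -> psd Q ->
  (forall v, cip (S v) (S v) = cip (Q v) (Q v)) -> forall v, S' (S v) = Q (Q v).
Proof.
move=> SS pQ H.
have aD : is_adjoint (fun v => S' (S v) - Q (Q v)) (fun v => S' (S v) - Q (Q v)).
  apply: is_adjointB; first exact: (psd_sq SS).1.
  exact: (psd_sq pQ.1).1.
have D0 v chi : is_character chi -> fiber_re chi v (S' (S v) - Q (Q v)) = 0.
  move=> chiP; rewrite freBr// -(fre_adj _ _ _ SS) -(fre_adj _ _ _ pQ.1).
  by rewrite /fiber_re /fiber_ip H subrr.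
move=> v; apply/eqP; rewrite -subr_eq0; apply/eqP.
apply: (@psd_eq0 _ _ _ (fun v => S' (S v) - Q (Q v))) => [|chi chiP]; last exact: D0.
by split=> // chi chiP w; rewrite D0.
Qed.

(* [S = lim c^-1 T Q (1 + P + ... + P^(n-1))] with [P = 1 - Q^2/c], an approximation of
   [T Q^-1]. *)
Lemma exists_polar T Q : adjointable T -> psd Q ->
  (forall chi, is_character chi -> forall v, fnorm2 chi (T v) = fnorm2 chi (Q (Q v))) ->
  exists S S', [/\ is_adjoint S S', forall v, S (Q v) = T v
    & forall v, S' (S v) = Q (Q v)].
Proof.
move=> aT pQ TQ; have aQ := psd_adjointable pQ.
have [C C0 QC] := adjointable_bounded aQ.
have QCf chi v : is_character chi -> fnorm2 chi (Q v) <= C ^+ 2 * fnorm2 chi v.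
  exact: (fnorm2_bound v pQ.1 C0 QC).
pose c := C ^+ 2 + 1; have c0 : 0 < c by rewrite ltr_wpDl// sqr_ge0.
have cn0 : c != 0 by rewrite gt_eqF.
have Qc chi v : is_character chi -> fnorm2 chi (Q v) <= c * fnorm2 chi v.
  move=> chiP; apply: (le_trans (QCf _ _ chiP)).
  by rewrite ler_wpM2r ?fnorm2_ge0// lerDl.
pose P v := v - c^-1%:C *: Q (Q v).
have freQQ chi v : is_character chi -> fiber_re chi v (Q (Q v)) = fnorm2 chi (Q v).
  by move=> chiP; rewrite -(fre_adj _ _ _ pQ.1).
have pP : psd P.
  apply: psd_1B => [|chi chiP v].
    by apply: psd_scale; [rewrite invr_ge0 ltW|exact: (psd_sq pQ.1)].
  by rewrite freZr// freQQ// ler_pdivrMl// Qc.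
have aP := psd_adjointable pP.
have freP chi v : is_character chi ->
    fiber_re chi v (P v) = fnorm2 chi v - c^-1 * fnorm2 chi (Q v).
  by move=> chiP; rewrite freBr// freZr// freQQ.
have [r [pr rrP rL]] := exists_good_sqrt pP.
have PQ v : P (Q v) = Q (P v) by rewrite /P (adjB aQ) (adjZ aQ).
have QPn n v : Q (iter n P v) = iter n P (Q v).
  by elim: n => //= n IH; rewrite -PQ IH.
have Pr n v : iter n P v = iter n.*2 r v.
  by elim: n => //= n ->; rewrite -rrP.
(* With [P = r^2] and [w = r^(2n) v], the drop [|w|^2 - |r w|^2] equals [|Q w|^2 / c]; convexity of
   the norms of iterates makes it at most [|v|^2 / (2n+1)]. *)
have decay chi v n : is_character chi ->
    fnorm2 chi (Q (iter n P v)) <= c * (fnorm2 chi v / n.+1%:R).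
  move=> chiP; have := fnorm2_iter_decay pr.1 v n.*2 chiP.
  rewrite -[X in X - _ <= _]fre_fnorm2 iterS; set w := iter n.*2 r v => h.
  have : fnorm2 chi w - fnorm2 chi (r w) <= fnorm2 chi v / n.+1%:R.
    apply: (le_trans h); rewrite ler_wpM2l ?fnorm2_ge0// lef_pV2 ?posrE ?ltr0n//.
    by rewrite ler_nat ltnS -addnn leq_addr.
  rewrite -[fnorm2 chi (r w)]fre_fnorm2 (fre_adj _ _ _ pr.1) rrP freP//.
  by rewrite opprB addrCA subrr addr0 ler_pdivrMl// Pr.
pose Om n v := \sum_(j < n) iter j P v.
have QQP w : Q (Q w) = c%:C *: (w - P w).
  by rewrite /P subKr scalerA -rmorphM/= divff// scale1r.
have QQOm n v : Q (Q (Om n v)) = c%:C *: (v - iter n P v).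
  rewrite /Om; elim: n => [|n IH].
    by rewrite big_ord0 (adj0 aQ) (adj0 aQ) subrr scaler0.
  by rewrite big_ord_recr/= (adjD aQ) (adjD aQ) IH QQP -scalerDr subrKA.
have QOm n v : Q (Om n v) = Om n (Q v).
  by rewrite /Om (adj_sum aQ); apply: eq_bigr => j _; exact: QPn.
pose SF n v := c^-1%:C *: T (Q (Om n v)).
(* The factor 2 is the square root of the 4 that arises from [|x - y|^2 <= 2 |x|^2 + 2 |y|^2]
   applied to two terms of the same bound. *)
pose e n := 2 * Num.sqrt (c / n.+1%:R).
have e0 : e @ \oo --> (0 : R).
  by rewrite -(mulr0 2); apply: cvgMr; exact: cvg_sqrt_rate.
have en n : 0 <= c / n.+1%:R by rewrite divr_ge0// ltW.
have cQQOm n v : c^-1%:C *: Q (Q (Om n v)) = v - iter n P v.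
  by rewrite QQOm scalerA -rmorphM/= mulVf// scale1r.
have aOm n : is_adjoint (Om n) (Om n).
  move=> v w; rewrite /Om; elim: n => [|n IH]; first by rewrite !big_ord0 cip0l cip0r.
  by rewrite !big_ord_recr/= cipDl cipDr IH (is_adjoint_iter n pP.1).
(* The hypothesis replaces [T] by [Q^2]: in each fiber [|SF n v| = |Q (v - P^n v)|]. This yields the
   Cauchy estimate and, in the limit, [|S v| = |Q v|]. *)
have TQx chi x : is_character chi ->
    fnorm2 chi (c^-1%:C *: T (Q x)) = fnorm2 chi (Q (c^-1%:C *: Q (Q x))).
  by move=> chiP; rewrite (adjZ aQ) !fnorm2Z// TQ.
have rQP n v : rn (Q (iter n P v)) <= Num.sqrt (c / n.+1%:R) * rn v.
  apply: rn_le_rate => // chi chiP; rewrite mulrAC -mulrA; exact: decay.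
have [||S [S' [SS SFn _]]] := @operator_limit R A E SF
    (fun n v => (c^-1%:C)^* *: Om n (Q (adj T v))) e _ e0.
- by move=> n; apply: is_adjointZ => v w; rewrite (adjP aT) pQ.1 aOm.
- move=> n m v nm.
  have -> : e n = Num.sqrt (4 * (c / n.+1%:R)).
    by rewrite sqrtrM// [4](_ : _ = 2 ^+ 2) ?sqrtr_sqr ?ger0_norm// -natrX.
  apply: rn_le_rate => [|chi chiP]; first by rewrite mulr_ge0.
  rewrite /SF -scalerBr -(adjB aT) -(adjB aQ) TQx// (adjB aQ) (adjB aQ) scalerBr.
  rewrite !cQQOm opprB [_ - iter m P v + _]addrC addrA subrK (adjB aQ) (le_trans (fnorm2_le2B _ _ _))//.
  have h1 := decay chi v n chiP; have h2 := decay chi v m chiP.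
  have h3 : c * (fnorm2 chi v / m.+1%:R) <= c * (fnorm2 chi v / n.+1%:R).
    rewrite ler_pM2l// ler_wpM2l ?fnorm2_ge0// lef_pV2 ?posrE ?ltr0n//.
    by rewrite ler_nat.
  move: h1 h2 h3; move: (n.+1%:R^-1) (m.+1%:R^-1) => tn tm; lra.
exists S, S'; split=> //.
(* [SF n (Q v)] differs from [T v] by [T (P^n v)], whose fiber norm is that of [Q (Q (P^n v))] and
   tends to zero by [decay]. *)
- move=> v; apply/eqP; rewrite -subr_eq0; apply/eqP/rn_eq0/eqP.
  rewrite eq_le rn_ge0 andbT.
  apply: (le_cvg0M (K := rn (Q v) + Num.sqrt c * rn v) e0) => n.
  have h1 := SFn n (Q v).
  have h2 : SF n (Q v) - T v = - T (iter n P v).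
    by rewrite /SF -QOm -(adjZ aT) cQQOm (adjB aT) addrAC subrr add0r.
  have h3 : rn (T (iter n P v)) <= Num.sqrt (c * (c / n.+1%:R)) * rn v.
    apply: rn_le_rate => [|chi chiP]; first by rewrite mulr_ge0// ltW.
    rewrite TQ// (le_trans (Qc _ _ chiP))// -mulrA ler_pM2l//.
    by rewrite mulrAC -mulrA; exact: decay.
  rewrite sqrtrM ?(ltW c0)// in h3.
  rewrite -(subrKA (SF n (Q v))) (le_trans (rnD _ _))// h2 rnN.
  have s0 : 0 <= Num.sqrt (c / n.+1%:R) by exact: sqrtr_ge0.
  have h4 : 0 <= Num.sqrt c * Num.sqrt (c / n.+1%:R) * rn v.
    by rewrite !mulr_ge0 ?sqrtr_ge0 ?rn_ge0.
  by rewrite /e in h1 *; lra.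
- apply: cip_eq_adj => // v.
  have ee0 : (fun n => e n * rn v) @ \oo --> (0 : R).
    by rewrite -(mul0r (rn v)); exact: cvgMl.
  apply: (cip_eq_lim (u := SF^~ v) (y := fun n => Q (v - iter n P v))
    (c := e 0%N * rn v) ee0) => n.
  + rewrite mulr_ge0 ?rn_ge0 ?mulr_ge0 ?sqrtr_ge0//= ler_wpM2r ?rn_ge0//.
    rewrite ler_pM2l// ler_wsqrtr// ler_pM2l// lef_pV2 ?posrE ?ltr0n//.
    by rewrite ler_nat.
  + exact: SFn.
  + rewrite (adjB aQ) subKr; apply: (le_trans (rQP _ _)).
    rewrite ler_wpM2r ?rn_ge0// /e ler_peMl ?sqrtr_ge0// ler1n//.
  + by apply: fnorm2_eq_cip => chi chiP; rewrite TQx// cQQOm.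
Qed.

Lemma exists_weak_polar T : adjointable T -> exists S, weak_polar T S.
Proof.
move=> aT; have [pU UU _] := abs_opP aT; set U := abs_op T in pU UU *.
have [pQ QQ _] := sqrt_opP pU; set Q := sqrt_op U in pQ QQ *.
have [chi chiP v|S [S' [SS SQ S'S]]] := @exists_polar T Q aT pQ.
  rewrite -fre_fnorm2 (fre_adj _ _ _ (adjP aT)) QQ -[fnorm2 _ _]fre_fnorm2.
  by rewrite (fre_adj _ _ _ pU.1) UU.
exists S; split; first by exists S'.
  by apply: funext => v /=; rewrite -/U -/Q SQ.
by rewrite /abs_op (adjE SS); apply: sqrt_opE => // v; rewrite /= S'S.
Qed.

End operator_roots.

(** * Frames *)

Lemma esum_nat_cvg (R : realType) (a : nat -> R) (l : R) : (forall n, 0 <= a n) ->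
  (fun n => \sum_(i < n) a i) @ \oo --> l ->
  \esum_(i in [set: nat]) (a i)%:E = l%:E.
Proof.
move=> a0 al; rewrite -nneseries_esumT; last by move=> n; rewrite lee_fin.
apply: cvg_lim => //; apply: cvg_EFin; first by apply: nearW => n; rewrite sumEFin.
rewrite [X in X @ _](_ : _ = fun n => \sum_(i < n) a i)//.
by apply: funext => n /=; rewrite sumEFin big_mkord.
Qed.

Lemma cvg_RP (R : realType) (u : nat -> R) (l : R) :
  (forall e : R, 0 < e -> exists N, forall n, (N <= n)%N -> `|l - u n| <= e) ->
  u @ \oo --> l.
Proof.
by move=> H; apply/cvgrPdist_le => e /H[N HN]; exists N.
Qed.

Lemma closure_rn (R : realType) (V : normedModType R[i]) (S : set V) (v : V) (e : R) :
  closure S v -> 0 < e -> exists2 x, S x & rn (v - x) < e.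
Proof.
move=> cSv e0; have [|x [Sx]] := cSv (ball v e%:C); first by apply: nbhsx_ballx; rewrite ltcR.
by rewrite -ball_normE/= -rnE ltcR; exists x.
Qed.

Section frames.
Context {R : realType} {A : commCStarAlgType R} {E : hilbertModType A}.
Implicit Types (chi : A -> complexC R) (v w x : E) (S T P Q L : E -> E).

Lemma rn_cstar (a : A) : rn (cstar a) = rn a.
Proof.
have le (b : A) : rn b <= rn (cstar b).
  have [->|/eqP/rn_gt0 b0] := eqVneq b 0; first by rewrite rn0 rn_ge0.
  by rewrite -(ler_pM2r b0) -expr2 -rn_cstar_cmul rn_cmul.
by apply/eqP; rewrite eq_le le andbT; rewrite -{2}[a]cstarK le.
Qed.

Lemma cip_actl v w (a : A) : cip (cact v a) w = cmul (cstar a) (cip v w).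
Proof. by rewrite -cip_star cip_act cstarM cip_star. Qed.

Lemma rn_cact v (a : A) : rn (cact v a) <= rn v * rn a.
Proof.
rewrite -(@ler_pXn2r _ 2) ?nnegrE ?mulr_ge0 ?rn_ge0// -rn_cip_sq cip_act cip_actl.
rewrite (le_trans (rn_cmul _ _))// (le_trans (ler_wpM2r (rn_ge0 _) (rn_cmul _ _)))//.
by rewrite rn_cstar rn_cip_sq exprMn [leLHS]mulrAC -expr2 mulrC.
Qed.

(* Parseval's identity in the fibers is all that is used of a frame. *)
Definition fiber_frame (e : nat -> E) := forall chi, is_character chi -> forall v,
  \esum_(i in [set: nat]) (rn (fiber_ip chi (e i) v) ^+ 2)%:E = (fnorm2 chi v)%:E.

Lemma fiber_ip_sq chi v w : is_character chi ->
  chi (cmul (cip v w) (cip w v)) = (rn (fiber_ip chi w v) ^+ 2)%:C.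
Proof.
move=> chiP; have sip := fiber_semi_inner (E := E) chiP.
rewrite charM// -[X in X * _](sipC sip w v) mulrC -normCK.
by rewrite -rnE -rmorphXn.
Qed.

Lemma frame_fiber_frame e : frame e -> fiber_frame e.
Proof.
move=> eF chi chiP v; have sip := fiber_semi_inner (E := E) chiP.
apply: esum_nat_cvg => [n|]; first exact: sqr_ge0.
apply: cvg_RP => d d0; have [N HN] := (cvg_rnP _ _).1 (eF v v) _ d0.
exists N => n /HN h; apply: le_trans h; apply: le_trans (char_contractive chiP _).
rewrite charB// /series /= big_mkord char_sum// (eq_bigr _ (fun i _ => fiber_ip_sq _ _ chiP)).
rewrite -rmorph_sum/= -[chi _]/(fiber_ip chi v v) (qformE sip) -rmorphB rnC.
exact: lexx.
Qed.

Lemma is_adjoint_rank1 v : is_adjoint (fun w => cact v (cip v w)) (fun w => cact v (cip v w)).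
Proof. by move=> w x; rewrite cip_act cip_actl cip_star. Qed.

Lemma fre_rank1 chi v w : is_character chi ->
  fiber_re chi w (cact v (cip v w)) = rn (fiber_ip chi v w) ^+ 2.
Proof. by move=> chiP; rewrite /fiber_re /fiber_ip cip_act (fiber_ip_sq _ _ chiP). Qed.

Lemma fre_sumr chi v n (F : 'I_n -> E) : is_character chi ->
  fiber_re chi v (\sum_(i < n) F i) = \sum_(i < n) fiber_re chi v (F i).
Proof.
by move=> chiP; apply: (big_morph (fiber_re chi v)) => [x y|]; [exact: freDr|exact: fre0r].
Qed.

Lemma fre_le_rn chi v w : is_character chi -> `|fiber_re chi v w| <= rn v * rn w.
Proof.
move=> chiP; have h : rn (fiber_ip chi v w) <= rn v * rn w.
  by apply: le_trans (char_contractive chiP _) (rn_cip _ _).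
by apply: le_trans h; rewrite -lecR rnE; exact: normc_ge_Re.
Qed.

(** The telescoping bound serves twice: its tails give the rate of convergence of the rank-one sums,
    and its total 1 gives [h <= 1], so that [1 - h] has a root. *)
Lemma exists_rank1_sum (y : nat -> E) :
  (forall n, rn (y n) ^+ 2 <= n.+1%:R^-1 - n.+2%:R^-1) ->
  exists h, [/\ psd h,
    forall chi, is_character chi -> forall v, fiber_re chi v (h v) <= fnorm2 chi v &
    forall chi, is_character chi -> forall v,
      (fun n => \sum_(i < n) rn (fiber_ip chi (y i) v) ^+ 2) @ \oo --> fiber_re chi v (h v)].
Proof.
move=> yn; pose F n v := \sum_(i < n) cact (y i) (cip (y i) v).
have FF n : is_adjoint (F n) (F n).
  move=> v w; rewrite /F; elim: n => [|n IH]; first by rewrite !big_ord0 cip0l cip0r.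
  by rewrite !big_ord_recr/= cipDl cipDr IH is_adjoint_rank1.
have FB n d v : rn (F (n + d)%N v - F n v) <= (n.+1%:R^-1 - (n + d).+1%:R^-1) * rn v.
  elim: d => [|d IH]; first by rewrite addn0 !subrr rn0 mul0r.
  rewrite addnS /F big_ord_recr/= -/(F (n + d)%N v) addrAC (le_trans (rnD _ _))//.
  have h1 : rn (cact (y (n + d)%N) (cip (y (n + d)%N) v)) <=
      rn (y (n + d)%N) ^+ 2 * rn v.
    rewrite (le_trans (rn_cact _ _))// expr2 -mulrA ler_wpM2l ?rn_ge0//; exact: rn_cip.
  have h2 := ler_wpM2r (rn_ge0 v) (yn (n + d)%N).
  rewrite -/(F n v); move: IH h1 h2.
  by move: (n.+1%:R^-1) ((n + d).+1%:R^-1) ((n + d).+2%:R^-1) => a b c; lra.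
have e0 : (fun n => n.+1%:R^-1) @ \oo --> (0 : R) by exact: cvg_harmonic.
have [|h hh hF] := selfadjoint_limit FF e0.
  move=> n m v /subnKC <-; rewrite (le_trans (FB _ _ _))// ler_wpM2r ?rn_ge0//.
  by rewrite lerBlDr lerDl invr_ge0.
have freF chi n v : is_character chi ->
    fiber_re chi v (F n v) = \sum_(i < n) rn (fiber_ip chi (y i) v) ^+ 2.
  by move=> chiP; rewrite fre_sumr//; apply: eq_bigr => i _; exact: fre_rank1.
have cv chi v : is_character chi ->
    (fun n => \sum_(i < n) rn (fiber_ip chi (y i) v) ^+ 2) @ \oo --> fiber_re chi v (h v).
  move=> chiP; apply: cvg_RP => d d0.
  have v1 : 0 < rn v * rn v + 1 by rewrite ltr_wpDl// mulr_ge0 ?rn_ge0.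
  exists (Num.truncn ((rn v * rn v + 1) / d)) => n nN.
  rewrite -freF// -freBr// (le_trans (fre_le_rn _ _ chiP))//.
  apply: (@le_trans _ _ ((rn v * rn v + 1) * n.+1%:R^-1)).
    have := hF n v => /(ler_wpM2l (rn_ge0 v)) h'; apply: (le_trans h').
    have : 0 <= n.+1%:R^-1 :> R by rewrite invr_ge0.
    by move: (n.+1%:R^-1) => t t0; lra.
  rewrite ler_pdivrMr ?ltr0n// [leRHS]mulrC -ler_pdivrMr// ltW//.
  by rewrite (lt_le_trans (truncnS_gt _))// ler_nat.
exists h; split; last by move=> chi chiP v; exact: cv.
- split=> // chi chiP v.
  apply: (cvgr_to_ge (cv _ _ chiP)); apply: nearW => n; apply: sumr_ge0 => i _.
  exact: sqr_ge0.
- move=> chi chiP v.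
  apply: (cvgr_to_le (cv _ _ chiP)); apply: nearW => n.
  have q0 : 0 <= fnorm2 chi v by exact: fnorm2_ge0.
  apply: (@le_trans _ _ ((1 - n.+1%:R^-1) * fnorm2 chi v)); last first.
    by rewrite ler_piMl// lerBlDr lerDl invr_ge0.
  elim: n => [|n IH]; first by rewrite big_ord0 invr1 subrr mul0r.
  rewrite big_ord_recr/=; have h1 := cauchy_schwarz (fiber_semi_inner chiP) (y n) v.
  have h2 : fnorm2 chi (y n) <= n.+1%:R^-1 - n.+2%:R^-1.
    exact: le_trans (fnorm2_le _ chiP) (yn n).
  have h3 := ler_wpM2r q0 h2.
  rewrite -[qform _ v]/(fnorm2 chi v) -[qform _ (y n)]/(fnorm2 chi (y n)) in h1.
  by move: (n.+1%:R^-1) (n.+2%:R^-1) IH h1 h2 h3 => t t'; lra.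
Qed.

(* With [h = sum_n y_n <y_n, .>] for small multiples [y_n] of generators and
   [r = (1 - h)^(1/2)], [1 = sum_k r^k h r^k], so that the [r^k y_n] are a frame. *)
Lemma exists_fiber_frame : countably_generated E -> exists e, fiber_frame e.
Proof.
move=> [X /countable_injP[code codeI] Xgen].
(* The generators listed by their codes, with value 0 at integers that are not codes. *)
pose x n := xget 0 [set v | X v /\ code v = n].
have xX v : X v -> x (code v) = v.
  move=> Xv; rewrite /x; case: xgetP => [w _ [Xw cw]|/(_ v)[]//].
  by apply: codeI; rewrite ?inE.
(* This scaling gives [|y n| <= 1 / (n+2)], whose square is below [1 / ((n+1) (n+2))]. *)
pose c n : R := (n.+2%:R * (1 + rn (x n)))^-1.
have cd0 n : 0 < n.+2%:R * (1 + rn (x n)) by rewrite mulr_gt0// ltr_wpDr ?rn_ge0.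
have c0 n : 0 < c n by rewrite invr_gt0.
pose y n := (c n)%:C *: x n.
have yn n : rn (y n) ^+ 2 <= n.+1%:R^-1 - n.+2%:R^-1.
  have y1 : rn (y n) <= n.+2%:R^-1.
    rewrite /y rnZ rnC ger0_norm ?(ltW (c0 n))// mulrC /c ler_pdivrMr// mulrA mulVf// mul1r.
    by rewrite lerDr.
  apply: (@le_trans _ _ (n.+2%:R^-1 ^+ 2)).
    by rewrite ler_pXn2r ?nnegrE ?rn_ge0// invr_ge0.
  rewrite -(addn1 n.+1) natrD; set t : R := n.+1%:R.
  have t0 : 0 < t by rewrite /t ltr0n.
  have -> : t^-1 - (t + 1)^-1 = (t * (t + 1))^-1.
    by field; rewrite !gt_eqF// ltr_wpDl// ltW.
  rewrite exprVn lef_pV2 ?posrE ?exprn_gt0 ?mulr_gt0 ?ltr_wpDl ?(ltW t0)//.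
  by rewrite expr2 ler_wpM2r ?lerDl// addr_ge0// ltW.
have [h [ph h1 hcv]] := exists_rank1_sum yn.
have [r [pr rrE _]] := exists_good_sqrt (psd_1B ph h1).
have ar := psd_adjointable pr.
have qr chi v : is_character chi -> fnorm2 chi (r v) = fnorm2 chi v - fiber_re chi v (h v).
  by move=> chiP; rewrite -fre_fnorm2 (fre_adj _ _ _ pr.1) rrE freBr.
have qr1 chi v : is_character chi -> fnorm2 chi (r v) <= fnorm2 chi v.
  by move=> chiP; rewrite qr// lerBlDr lerDl ph.2.
have qrn chi n v : is_character chi -> fnorm2 chi (iter n r v) <= fnorm2 chi v.
  by move=> chiP; elim: n => //= n IH; exact: le_trans (qr1 _ _ chiP) IH.
have single chi n v : is_character chi ->
    rn (fiber_ip chi (y n) v) ^+ 2 <= fiber_re chi v (h v).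
  move=> chiP; apply: (cvgr_to_ge (hcv _ chiP v)); exists n.+1 => // m /= nm.
  rewrite (bigD1 (Ordinal nm))//= lerDl; apply: sumr_ge0 => i _; exact: sqr_ge0.
(* That is, [r^n v] tends to 0 in the fiber. Such vectors form a submodule, closed because [r] is a
   contraction in fibers, so it suffices to treat the [y n]. *)
pose vanishes chi v := forall d : R, 0 < d ->
  exists N, forall n, (N <= n)%N -> fnorm2 chi (iter n r v) <= d.
have airn n : adjointable (iter n r) by exists (iter n r); exact: is_adjoint_iter pr.1.
have van_y chi n : is_character chi -> vanishes chi (y n).
  move=> chiP d d0; exists (Num.truncn d^-1) => k kN; set w := iter k r (y n).
  (* Since [<y n, r^k w> = |w|^2], the term [|w|^4] is at most [<r^k w, h (r^k w)> = |r^k w|^2 -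
     |r^(k+1) w|^2], which decays like [|w|^2 / (k+1)]. *)
  have key : fnorm2 chi w ^+ 2 <= fnorm2 chi w / k.+1%:R.
    have hw : rn (fiber_ip chi (y n) (iter k r w)) = fnorm2 chi w.
      rewrite /fiber_ip -(is_adjoint_iter k pr.1) -/w -[chi _]/(fiber_ip chi w w).
      by rewrite (qformE (fiber_semi_inner chiP)) rnC ger0_norm//; exact: fnorm2_ge0.
    rewrite -hw; apply: (le_trans (single _ _ _ chiP)).
    have := fnorm2_iter_decay pr.1 w k chiP; rewrite iterS qr// hw.
    by rewrite opprB addrCA subrr addr0.
  have [->|w0] := eqVneq (fnorm2 chi w) 0; first exact: ltW.
  have wp : 0 < fnorm2 chi w by rewrite lt0r w0 fnorm2_ge0.
  have h2 : fnorm2 chi w <= k.+1%:R^-1 by rewrite -(ler_pM2l wp) -expr2.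
  apply: (le_trans h2); rewrite -[d]invrK lef_pV2 ?posrE ?invr_gt0 ?ltr0n//.
  by rewrite ltW// (lt_le_trans (truncnS_gt _))// ler_nat.
have van_D chi v w : is_character chi -> vanishes chi v -> vanishes chi w ->
    vanishes chi (v + w).
  move=> chiP hv hw d d0; have d4 : 0 < d / 4 by rewrite divr_gt0.
  have [N HN] := hv _ d4; have [M HM] := hw _ d4.
  exists (maxn N M) => n; rewrite geq_max => /andP[/HN h2 /HM h3].
  rewrite (adjD (airn n)) (le_trans (fnorm2_le2D chiP _ _))//; lra.
have van_Z chi (k : R) v : is_character chi -> vanishes chi v -> vanishes chi (k%:C *: v).
  move=> chiP hv d d0; have k1 : 0 < k ^+ 2 + 1 by rewrite ltr_wpDl// sqr_ge0.
  have [|N HN] := hv (d / (k ^+ 2 + 1)); first by rewrite divr_gt0.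
  exists N => n /HN; rewrite ler_pdivlMr// (adjZ (airn n)) fnorm2Z// mulrC.
  by have := fnorm2_ge0 (iter n r v) chiP; lra.
have van_act chi a v : is_character chi -> vanishes chi v -> vanishes chi (cact v a).
  move=> chiP hv d d0; have k1 : 0 < rn (chi a) ^+ 2 + 1 by rewrite ltr_wpDl// sqr_ge0.
  have [|N HN] := hv (d / (rn (chi a) ^+ 2 + 1)); first by rewrite divr_gt0.
  exists N => n /HN; rewrite ler_pdivlMr// (adj_act (airn n)).
  set u := iter n r v.
  have -> : fnorm2 chi (cact u a) = rn (chi a) ^+ 2 * fnorm2 chi u.
    apply: complexI; rewrite /fnorm2 -(qformE (fiber_semi_inner chiP)) /fiber_ip.
    rewrite cip_act cip_actl !charM// char_star// rmorphM/= rmorphXn/= rnE normCK.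
    by rewrite -(qformE (fiber_semi_inner chiP)) mulrAC (mulrC (chi a : R[i])).
  by have := fnorm2_ge0 u chiP; lra.
have van chi v : is_character chi -> vanishes chi v.
  move=> chiP d d0; have d4 : 0 < d / 4 by rewrite divr_gt0.
  pose d' := Num.min 1 (d / 4); have d'0 : 0 < d' by rewrite lt_min ltr01.
  have [|w' [n [u [a [Xu ->]]]] uv] := @closure_rn R E (module_span X) v d' _ d'0.
    by rewrite [closure _]Xgen.
  have hw : vanishes chi (\sum_(i < n) cact (u i) (a i)).
    elim/big_ind : _ => [d1 d10|v1 v2|i _].
    - exists 0%N => k _; rewrite (adj0 (airn k)) -fre_fnorm2 fre0r//; exact: ltW.
    - exact: van_D.
    - apply: van_act => //; rewrite -(xX _ (Xu i)).
      have -> : x (code (u i)) = (c (code (u i)))^-1%:C *: y (code (u i)).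
        by rewrite /y scalerA -rmorphM/= mulVf ?gt_eqF// scale1r.
      by apply: van_Z => //; exact: van_y.
  have [N HN] := hw _ d4; exists N => k /HN.
  set w := \sum_(i < n) _ in uv hw HN *; move=> wk.
  rewrite -(subrK w v) (adjD (airn k)) (le_trans (fnorm2_le2D chiP _ _))//.
  have : fnorm2 chi (iter k r (v - w)) <= d / 4.
    rewrite (le_trans (qrn _ _ _ chiP))// (le_trans (fnorm2_le _ chiP))//.
    have e1 : rn (v - w) <= 1 by rewrite (le_trans (ltW uv))// ge_min lexx.
    have e2 : rn (v - w) <= d / 4 by rewrite (le_trans (ltW uv))// ge_min lexx orbT.
    by have := rn_ge0 (v - w); nra.
  by lra.
(* A bijection enumerates the family [r^k y_n]. All terms are nonnegative, so the sum over [n] may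
   be taken first; it gives [<r^k v, h (r^k v)>], and the sum over [k] telescopes. *)
have /card_esym/card_set_bijP[f fbij] := card_nat2.
exists (fun i => iter (f i).1 r (y (f i).2)) => chi chiP v.
pose a (kn : nat * nat) := (rn (fiber_ip chi (iter kn.1 r (y kn.2)) v) ^+ 2)%:E.
rewrite -[LHS]/(\esum_(i in [set: nat]) a (f i)) -(reindex_esum _ _ _ _ fbij).
have -> : [set: nat * nat] = [set: nat] `*`` (fun=> [set: nat]).
  by apply/seteqP; split.
rewrite -(@esum_esum _ _ _ [set: nat] (fun=> [set: nat]) (fun k n => a (k, n))); last first.
  by move=> k n _ _; rewrite lee_fin sqr_ge0.
rewrite (eq_esum (b := fun k =>
    (fnorm2 chi (iter k r v) - fnorm2 chi (iter k.+1 r v))%:E)); last first.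
  move=> k _; rewrite iterS qr// opprB addrCA subrr addr0.
  apply: esum_nat_cvg => [n|]; first exact: sqr_ge0.
  have -> : (fun n => \sum_(i < n) rn (fiber_ip chi (iter (k, (i : nat)).1 r (y (k, (i : nat)).2)) v) ^+ 2) =
     (fun n => \sum_(i < n) rn (fiber_ip chi (y i) (iter k r v)) ^+ 2).
    apply: funext => n; apply: eq_bigr => i _.
    by rewrite /fiber_ip /= (is_adjoint_iter k pr.1).
  exact: hcv.
apply: esum_nat_cvg => [k|].
  by rewrite subr_ge0 iterS qr1.
have -> : (fun n => \sum_(i < n) (fnorm2 chi (iter i r v) - fnorm2 chi (iter i.+1 r v))) =
    (fun n => fnorm2 chi v - fnorm2 chi (iter n r v)).
  apply: funext; elim => [|n IH]; first by rewrite big_ord0 subrr.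
  by rewrite big_ord_recr IH/= subrKA.
apply: cvg_RP => d /(van chi v chiP)[N HN]; exists N => n /HN.
by rewrite subKr ger0_norm//; exact: fnorm2_ge0.
Qed.

End frames.

(** * Traces on Hilbert spaces *)

Section parseval.
Context {R : realType} {H : hilbertModType (complexC R)}.
Implicit Types (x y z : H) (L : H -> H).

(** A Hilbert space is its own fiber over the identity character, so the fiberwise lemmas apply to
    it. *)
Lemma id_character : is_character (@id (complexC R)).
Proof. by split=> //; exists (1 : R[i]); exact: oner_neq0. Qed.

Lemma cactE x (z : complexC R) : cact x z = (z : R[i]) *: x.
Proof. by apply: cip_inj => y; rewrite cip_act cipZr; exact: mulrC. Qed.

Lemma fnorm2_id x : fnorm2 id x = rn x ^+ 2.
Proof.
rewrite -rn_cip_sq -[cip x x]/(fiber_ip id x x) (qformE (fiber_semi_inner id_character)).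
by rewrite (rnC (fnorm2 id x)) ger0_norm// fnorm2_ge0//; exact: id_character.
Qed.

Lemma cipE x : cip x x = (rn x ^+ 2)%:C :> R[i].
Proof.
by rewrite -fnorm2_id; exact: (qformE (fiber_semi_inner id_character)).
Qed.

Lemma rn_cipC x y : rn (cip x y) = rn (cip y x).
Proof. by rewrite -cip_star; exact: rn_conj. Qed.

Lemma rn_parallelogram x y :
  rn (x + y) ^+ 2 + rn (x - y) ^+ 2 = 2 * rn x ^+ 2 + 2 * rn y ^+ 2.
Proof.
rewrite -!fnorm2_id; exact: (qform_parallelogram (fiber_semi_inner id_character)).
Qed.

Lemma Re_cip_le x y : 2 * complex.Re (cip x y : R[i]) <= rn x ^+ 2 + rn y ^+ 2.
Proof.
have := Re_le_rn (cip x y : R[i]); have : rn (cip x y) <= _ := rn_cip x y.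
by have := sqr_ge0 (rn x - rn y); nra.
Qed.

Section family.
Variables (I : choiceType) (D : set I) (g : I -> H).

(** Orthonormal bases and images of frames in a fiber both qualify; no orthogonality is asked
    for. *)
Definition parseval := forall x,
  \esum_(i in D) (rn (cip (g i) x) ^+ 2)%:E = (rn x ^+ 2)%:E.

Definition bessel := forall x,
  (\esum_(i in D) (rn (cip (g i) x) ^+ 2)%:E <= (rn x ^+ 2)%:E)%E.

(* [y = sum_i g_i <g_i, x>] satisfies [Re <y, x> = S] where [S] is the left-hand side. *)
Lemma bessel_seq (s : seq I) x :
  let y := \sum_(i <- s) (cip (g i) x : R[i]) *: g i in
  rn y ^+ 2 <= \sum_(i <- s) rn (cip (g i) x) ^+ 2 ->
  \sum_(i <- s) rn (cip (g i) x) ^+ 2 <= rn x ^+ 2.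
Proof.
move=> y yS; set S := \sum_(i <- s) _ in yS *.
have : complex.Re (cip x y : R[i]) = S.
  rewrite /y cip_sumr; rewrite [X in complex.Re X](_ : _ = S%:C)//.
  rewrite /S rmorph_sum/=; apply: eq_bigr => i _.
  by rewrite cipZr -(cip_star (g i) x) rmorphXn/= rnE normCK.
by have := Re_cip_le x y; lra.
Qed.

(** The sum inherits the parallelogram identity termwise; this substitutes for a sesquilinear form
    in the next two lemmas. *)
Lemma bessel_sum : bessel -> exists N : H -> R,
  [/\ forall x, \esum_(i in D) (rn (cip (g i) x) ^+ 2)%:E = (N x)%:E,
      forall x, 0 <= N x <= rn x ^+ 2
    & forall x y, N (x + y) + N (x - y) = 2 * N x + 2 * N y].
Proof.
move=> bes; pose N x := fine (\esum_(i in D) (rn (cip (g i) x) ^+ 2)%:E).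
have s0 x : (0 <= \esum_(i in D) (rn (cip (g i) x) ^+ 2)%:E)%E.
  by apply: esum_ge0 => i _; rewrite lee_fin sqr_ge0.
have NE x : \esum_(i in D) (rn (cip (g i) x) ^+ 2)%:E = (N x)%:E.
  by rewrite fineK// ge0_fin_numE//; apply: le_lt_trans (bes x) _; rewrite ltry.
exists N; split=> // [x|x y].
  by rewrite fine_ge0//= -lee_fin -NE.
apply: EFin_inj; rewrite !EFinD !EFinM -!NE.
have ge0 z i : D i -> (0 <= (rn (cip (g i) z) ^+ 2)%:E)%E by rewrite lee_fin sqr_ge0.
have dbl (t : \bar R) : (0 <= t -> 2%:E * t = t + t)%E.
  by move=> t0; rewrite -[2%:E]/(1 + 1)%:E EFinD ge0_muleDl// mul1e.
rewrite !dbl// -!esumD; try by move=> i Di; rewrite ?adde_ge0 ?ge0.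
apply: eq_esum => i _; rewrite -!EFinD; congr (_%:E).
rewrite cipDr cipBr !rn_sqr.
by case: (cip (g i) x) (cip (g i) y) => [a b] [c d] /=; ring.
Qed.

(** The parallelogram identities for [N] and for the norm at [x'] and [x - x'], with
    [N x' = |x'|^2], yield [N x >= |x|^2 - 2 |x - x'|^2]. *)
Lemma parseval_dense : bessel ->
  (forall x (e : R), 0 < e -> exists2 x', rn (x - x') < e &
     \esum_(i in D) (rn (cip (g i) x') ^+ 2)%:E = (rn x' ^+ 2)%:E) ->
  parseval.
Proof.
move=> /bessel_sum[N [NE Nle Npar]] dense.
move=> x; rewrite NE; congr (_%:E); apply/eqP; rewrite eq_le.
have /andP[_ ->] := Nle x; rewrite /=.
apply/ler_addgt0Pr => e e0; pose d := Num.min 1 (e / 2).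
have d0 : 0 < d by rewrite lt_min ltr01 divr_gt0.
have [x' xx' Nx'] := dense x _ d0; rewrite NE in Nx'; case: Nx' => Nx'.
have := Npar x' (x - x'); have := rn_parallelogram x' (x - x').
rewrite subrKC; have /andP[_] := Nle (x' - (x - x')); rewrite Nx'.
have /andP[N0 _] := Nle (x - x').
have : rn (x - x') ^+ 2 <= e / 2.
  have e1 : rn (x - x') <= 1 by rewrite (le_trans (ltW xx'))// ge_min lexx.
  have e2 : rn (x - x') <= e / 2 by rewrite (le_trans (ltW xx'))// ge_min lexx orbT.
  by have := rn_ge0 (x - x'); nra.
by lra.
Qed.

(** The sums of the values at [x + y] and [x - y] agree for [N] and the squared norm, and [N] is
    below it at each point, so both inequalities are equalities. *)
Lemma parseval_add x y : bessel ->
  \esum_(i in D) (rn (cip (g i) x) ^+ 2)%:E = (rn x ^+ 2)%:E ->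
  \esum_(i in D) (rn (cip (g i) y) ^+ 2)%:E = (rn y ^+ 2)%:E ->
  \esum_(i in D) (rn (cip (g i) (x + y)) ^+ 2)%:E = (rn (x + y) ^+ 2)%:E.
Proof.
move=> /bessel_sum[N [NE Nle Npar]]; rewrite !NE => -[Nx] [Ny]; congr (_%:E).
have := Npar x y; have := rn_parallelogram x y.
have /andP[_] := Nle (x + y); have /andP[_] := Nle (x - y); lra.
Qed.

End family.

Lemma esum_exchange (I J : choiceType) (D : set I) (D' : set J) (a : I -> J -> \bar R) :
  (forall i j, 0 <= a i j)%E ->
  \esum_(i in D) \esum_(j in D') a i j = \esum_(j in D') \esum_(i in D) a i j.
Proof.
move=> a0; rewrite !esum_esum//.
rewrite (reindex_esum (D' `*`` (fun=> D)) _ (fun p : J * I => (p.2, p.1)))//.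
split=> [[j i] [/= Dj Di]//|[j i] [j' i'] _ _ [-> ->]//|[i j] [/= Di Dj]].
by exists (j, i).
Qed.

Lemma trace_parseval (I J : choiceType) (D : set I) (D' : set J) (g : I -> H) (g' : J -> H)
    (L L' : H -> H) : is_adjoint L L' -> parseval D g -> parseval D' g' ->
  \esum_(i in D) (rn (L (g i)) ^+ 2)%:E = \esum_(j in D') (rn (L' (g' j)) ^+ 2)%:E.
Proof.
move=> LL pg pg'.
under eq_esum do rewrite -pg'.
under [RHS]eq_esum do rewrite -pg.
rewrite esum_exchange; last by move=> i j; rewrite lee_fin sqr_ge0.
by apply: eq_esum => j _; apply: eq_esum => i _; rewrite rn_cipC LL.
Qed.

Lemma esum_nat_le (a : nat -> R) (l : R) : (forall n, 0 <= a n) ->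
  (forall n, \sum_(i < n) a i <= l) -> (\esum_(i in [set: nat]) (a i)%:E <= l%:E)%E.
Proof.
move=> a0 al; rewrite -nneseries_esumT; last by move=> n; rewrite lee_fin.
apply: lime_le; first by apply: is_cvg_nneseries => n _ _; rewrite lee_fin.
by apply: nearW => n; rewrite sumEFin lee_fin big_mkord.
Qed.

Lemma le_esum_nat (a : nat -> R) n : (forall n, 0 <= a n) ->
  ((\sum_(i < n) a i)%:E <= \esum_(i in [set: nat]) (a i)%:E)%E.
Proof.
move=> a0; rewrite -nneseries_esumT; last by move=> k; rewrite lee_fin.
rewrite -(big_mkord xpredT) -sumEFin; apply: nneseries_lim_ge => k _ _.
by rewrite lee_fin.
Qed.

(** Bessel's inequality comes from projecting onto finite subsets. Equality is clear on multiples of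
    basis vectors, passes to sums by [parseval_add] and to limits by density. *)
Lemma onb_parseval (B : set H) : orthonormal_basis B -> parseval B id.
Proof.
move=> [Bon Bgen].
have bes : bessel B id.
  move=> x; apply: ge_ereal_sup => _ [X [finX XB] <-].
  rewrite fsbig_finite//= sumEFin lee_fin; apply: bessel_seq.
  set s := finmap.enum_fset (fset_set X); set y := \sum_(i <- s) _.
  have sB b : b \in s -> B b.
    by rewrite -[b \in s]/(b \in fset_set X) in_fset_set// inE => /XB.
  have by_ b : b \in s -> cip b y = cip b x.
    move=> bs; rewrite cip_sumr (bigD1_seq b)//= ?finmap.fset_uniq//.
    rewrite cipZr (Bon b b) ?eqxx; [|exact: sB|exact: sB].
    rewrite big_seq_cond big1 ?addr0; first exact: (mulr1 (cip b x : R[i])).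
    move=> c /andP[cs cb]; rewrite cipZr (Bon b c); [|exact: sB|exact: sB].
    by rewrite eq_sym (negPf cb); exact: (mulr0 (cip c x : R[i])).
  rewrite -lecR -cipE {2}/y cip_sumr rmorph_sum/=.
  rewrite le_eqVlt; apply/orP; left; apply/eqP.
  rewrite big_seq [RHS]big_seq; apply: eq_bigr => b bs.
  by rewrite cipZr -(cip_star b y) by_// rmorphXn/= rnE normCK.
apply: parseval_dense => // x e e0.
have [|x' Sx' xx'] := @closure_rn R H (module_span B) x e _ e0.
  by rewrite [closure _]Bgen.
exists x' => //; have [n [b [a [Bb ->]]]] := Sx'.
elim/big_ind : _ => [|x1 x2|i _].
- by rewrite esum1 ?rn0 ?expr0n// => i _; rewrite cip0r rn0 expr0n.
- exact: parseval_add.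
have single c : B c -> rn (cip c (cact (b i) (a i))) ^+ 2 =
    if c == b i then rn (a i : R[i]) ^+ 2 else 0.
  move=> Bc; rewrite cip_act (Bon c (b i))//.
  case: eqP => _; first by congr (rn _ ^+ 2); exact: mul1r.
  by rewrite (_ : cmul _ _ = 0) ?rn0 ?expr0n//; exact: mul0r.
rewrite (esumID [set b i]); last by move=> c _; rewrite lee_fin sqr_ge0.
rewrite setIidr; last by move=> _ ->.
rewrite esum_set1 ?lee_fin ?sqr_ge0// esum1 ?adde0; last first.
  by move=> c [Bc cb]; rewrite single//; case: eqP => // cb'; case: cb.
rewrite single// eqxx; congr (_%:E).
rewrite cactE rnZ.
have -> : rn (b i) = 1; last by rewrite mulr1.
apply/eqP; rewrite -(@eqrXn2 _ 2)// ?rn_ge0// -rn_cip_sq (Bon (b i) (b i))// eqxx expr1n.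
by rewrite (rnC 1) normr1.
Qed.

End parseval.

(** * Localization *)

Section fibers.
Context {R : realType} {A : commCStarAlgType R} {E : hilbertModType A}.
Variables (chi : A -> complexC R) (H : interior_tensor E chi).
Hypothesis chiP : is_character chi.
Implicit Types (v w : E) (x y : H) (S T P Q : E -> E).

Definition fib v : H := tens H v (1 : R[i]).

Lemma fibD v w : fib (v + w) = fib v + fib w.
Proof. exact: tensDl. Qed.

Lemma fibZ (c : R[i]) v : fib (c *: v) = c *: fib v.
Proof. exact: tensZl. Qed.

Lemma fib0 : fib 0 = 0.
Proof. by rewrite -(scale0r (0 : E)) fibZ scale0r. Qed.

Lemma fibB v w : fib (v - w) = fib v - fib w.
Proof. by rewrite fibD -[- w]scaleN1r fibZ scaleN1r. Qed.

Lemma cip_fib v w : cip (fib v) (fib w) = chi (cip v w).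
Proof.
rewrite cip_tens; rewrite -[LHS]/((1 : R[i])^* * ((chi (cip v w) : R[i]) * 1)).
by rewrite rmorph1 mul1r mulr1.
Qed.

Lemma rn_fib v : rn (fib v) ^+ 2 = fnorm2 chi v.
Proof. by rewrite -fnorm2_id /fnorm2 /qform /fiber_ip /= cip_fib. Qed.

Lemma tensE v (z : complexC R) : tens H v z = fib ((z : R[i]) *: v).
Proof.
rewrite fibZ -cactE tens_act; congr (tens H v _); exact/esym/mul1r.
Qed.

Lemma fib_dense x (e : R) : 0 < e -> exists v, rn (x - fib v) < e.
Proof.
move=> e0; have [|y [n [u [a [Xu ->]]]] xy] := @closure_rn R H
  (module_span [set tens H p.1 p.2 | p in [set: E * complexC R]]) x e _ e0.
  by rewrite [closure _](tens_generates H).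
have [v yv] : exists v, \sum_(i < n) cact (u i) (a i) = fib v.
  elim/big_ind : _ => [|_ _ [v ->] [w ->]|i _].
  - by exists 0; rewrite fib0.
  - by exists (v + w); rewrite fibD.
  - have [[v z] _ <-] := Xu i; exists ((cmul z (a i) : R[i]) *: v).
    by rewrite tens_act tensE.
by exists v; rewrite -yv.
Qed.

Lemma fib_eq0 (f : H -> R) (M : R) x :
  (forall v, f x <= M * rn (x - fib v)) -> f x <= 0.
Proof.
move=> Mf; apply/ler_addgt0Pr => e e0; rewrite add0r.
have M1 : 0 < `|M| + 1 by rewrite ltr_wpDl.
have [|v] := @fib_dense x (e / (`|M| + 1)); first by rewrite divr_gt0.
rewrite ltr_pdivlMr// => xv; apply: (le_trans (Mf v)).
have := rn_ge0 (x - fib v); have := ler_norm M; nra.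
Qed.

Lemma fib_extension (f : E -> H) (K : R) : 0 <= K ->
  (forall v w, rn (f v - f w) <= K * rn (fib v - fib w)) ->
  exists F : H -> H, forall x v, rn (F x - f v) <= K * rn (x - fib v).
Proof.
move=> K0 fK.
have cv x : exists l, forall v, rn (l - f v) <= K * rn (x - fib v).
  have /choice[u uP] n : exists v, rn (x - fib v) < n.+1%:R^-1.
    by apply: fib_dense; rewrite invr_gt0.
  have inv_mono n m : (n <= m)%N -> (m.+1%:R^-1 <= n.+1%:R^-1 :> R).
    by move=> nm; rewrite lef_pV2 ?posrE// ler_nat.
  have [||l _ lu] := @cauchy_rate R H (f \o u) (fun n => 2 * K * n.+1%:R^-1).
  - move=> n m nm; rewrite (le_trans (fK _ _))// -mulrA mulrCA ler_wpM2l//.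
    rewrite -(subrKA x) (le_trans (rnD _ _))// (rnB (fib (u m))).
    have := ltW (uP n); have := ltW (uP m); have := inv_mono _ _ nm.
    by move: (n.+1%:R^-1) (m.+1%:R^-1) => s t; lra.
  - by rewrite -[0](mulr0 (2 * K)); apply: cvgMr; exact: cvg_harmonic.
  exists l => v; rewrite -subr_le0.
  apply: (le_cvg0M (K := 3 * K) (@cvg_harmonic R)) => n.
  have h1 := rnD (l - f (u n)) (f (u n) - f v); rewrite subrKA in h1.
  have h2 := fK (u n) v.
  have h3 := rnD (fib (u n) - x) (x - fib v); rewrite subrKA (rnB _ x) in h3.
  have h4 := lu n; have h5 := ltW (uP n); rewrite /= in h4.
  rewrite /harmonic /=; move: (n.+1%:R^-1) h4 h5 => s h4 h5.
  have h6 : K * rn (fib (u n) - fib v) <= K * (s + rn (x - fib v)).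
    by rewrite ler_wpM2l//; lra.
  lra.
by have /choice[F FP] := cv; exists F.
Qed.

Lemma fib_lip S T : is_adjoint T S -> exists2 C : R, 0 <= C &
  forall v w, rn (fib (T v) - fib (T w)) <= C * rn (fib v - fib w).
Proof.
move=> TS; have aT : adjointable T by exists S.
have [C C0 TC] := adjointable_bounded aT; exists C => // v w.
rewrite -!fibB -(adjB aT) -(@ler_pXn2r _ 2) ?nnegrE ?mulr_ge0 ?rn_ge0//.
by rewrite exprMn !rn_fib; exact: (fnorm2_bound _ TS).
Qed.

(** By [fnorm2_bound], [T] and its adjoint are Lipschitz for the fiber seminorm, so they act on the
    image of [fib] and extend by density; the adjoint relation extends in one variable at a time. *)
Lemma exists_localize S T : is_adjoint T S -> exists F G : H -> H,
  [/\ is_adjoint F G, forall v, F (fib v) = fib (T v) & forall v, G (fib v) = fib (S v)].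
Proof.
move=> TS; have ST := is_adjoint_sym TS.
have [C C0 TC] := fib_lip TS; have [D D0 SD] := fib_lip ST.
have [F FP] := fib_extension C0 TC; have [G GP] := fib_extension D0 SD.
have Ff v : F (fib v) = fib (T v).
  apply/eqP; rewrite -subr_eq0; apply/eqP/rn_eq0/eqP; rewrite eq_le rn_ge0 andbT.
  by have := FP (fib v) v; rewrite subrr rn0 mulr0.
have Gf v : G (fib v) = fib (S v).
  apply/eqP; rewrite -subr_eq0; apply/eqP/rn_eq0/eqP; rewrite eq_le rn_ge0 andbT.
  by have := GP (fib v) v; rewrite subrr rn0 mulr0.
exists F, G; split=> //.
have h x w : cip (F x) (fib w) = cip x (fib (S w)).
  apply/eqP; rewrite -subr_eq0; apply/eqP/rn_eq0/eqP; rewrite eq_le rn_ge0 andbT.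
  apply: (@fib_eq0 (fun x => rn (cip (F x) (fib w) - cip x (fib (S w))))
    (C * rn (fib w) + rn (fib (S w)))) => v.
  have -> : cip (F x) (fib w) - cip x (fib (S w)) =
      cip (F x - fib (T v)) (fib w) - cip (x - fib v) (fib (S w)).
    by rewrite !cipBl !cip_fib TS opprB addrA subrK.
  rewrite (le_trans (rnD _ _))// rnN.
  have h1 := rn_cip (F x - fib (T v)) (fib w).
  have h2 := rn_cip (x - fib v) (fib (S w)).
  have h3 := ler_wpM2r (rn_ge0 (fib w)) (FP x v).
  by rewrite mulrDl; lra.
move=> x y.
apply/eqP; rewrite -subr_eq0; apply/eqP/rn_eq0/eqP; rewrite eq_le rn_ge0 andbT.
apply: (@fib_eq0 (fun y => rn (cip (F x) y - cip x (G y)))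
    (rn (F x) + rn x * D)) => w.
have -> : cip (F x) y - cip x (G y) =
    cip (F x) (y - fib w) - cip x (G y - fib (S w)).
  by rewrite !cipBr h opprB addrA subrK.
rewrite (le_trans (rnD _ _))// rnN.
have h1 := rn_cip (F x) (y - fib w).
have h2 := rn_cip x (G y - fib (S w)).
have h3 := ler_wpM2l (rn_ge0 x) (GP y w).
by rewrite mulrDl; lra.
Qed.

Lemma adj_dense_inj (F G : H -> H) : adjointable F -> adjointable G ->
  (forall v, F (fib v) = G (fib v)) -> F = G.
Proof.
move=> aF aG FG; apply: funext => x; apply: cip_inj => y.
apply/eqP; rewrite -subr_eq0; apply/eqP/rn_eq0/eqP; rewrite eq_le rn_ge0 andbT.
apply: (@fib_eq0 (fun x => rn (cip y (F x) - cip y (G x))) (rn (adj F y - adj G y))) => v.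
have -> : cip y (F x) - cip y (G x) = cip (adj F y - adj G y) (x - fib v).
  rewrite cipBl !cipBr -!(is_adjointE _ _ (adjP aF)) -!(is_adjointE _ _ (adjP aG)).
  by rewrite FG opprB addrA subrK.
exact: rn_cip.
Qed.

Lemma localizeP T : adjointable T ->
  adjointable (localize (H := H) T) /\ forall v, localize (H := H) T (fib v) = fib (T v).
Proof.
move=> aT; have [F [G [FG Ff Gf]]] := exists_localize (adjP aT).
rewrite /localize; case: xgetP => [L _ [aL LT]|/(_ F)[]].
  by split=> // v; rewrite /fib LT.
split; first by exists G.
by move=> v z; rewrite !tensE Ff (adjZ aT).
Qed.

Lemma localizeE T (F : H -> H) : adjointable T -> adjointable F ->
  (forall v, F (fib v) = fib (T v)) -> localize (H := H) T = F.
Proof.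
move=> aT aF FT; have [aL LT] := localizeP aT.
by apply: adj_dense_inj => // v; rewrite LT FT.
Qed.

Lemma localize_adjoint S T : is_adjoint T S ->
  is_adjoint (localize (H := H) T) (localize (H := H) S).
Proof.
move=> TS; have [F [G [FG Ff Gf]]] := exists_localize TS.
rewrite (@localizeE _ F)//; [|by exists S|by exists G].
rewrite (@localizeE _ G)//; [by exists T; exact: is_adjoint_sym|].
by exists F; exact: is_adjoint_sym.
Qed.

Lemma localize_comp S T : adjointable S -> adjointable T ->
  localize (H := H) (S \o T) = localize (H := H) S \o localize (H := H) T.
Proof.
move=> aS aT; have [aLS LS] := localizeP aS; have [aLT LT] := localizeP aT.
apply: localizeE => [||v /=]; last by rewrite LT LS.
- by eexists; exact: is_adjoint_comp (adjP aS) (adjP aT).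
- by eexists; exact: is_adjoint_comp (adjP aLS) (adjP aLT).
Qed.

Lemma localize_psd P : psd P -> psd (localize (H := H) P).
Proof.
move=> /exists_good_sqrt[Q [pQ QQ _]]; have aQ := psd_adjointable pQ.
have -> : P = Q \o Q by apply: funext => v /=; rewrite QQ.
by rewrite localize_comp//; apply/psd_sq/localize_adjoint/pQ.1.
Qed.

(** Parseval's identity is known on the dense image of [fib] only, and Bessel's inequality must be
    had everywhere before [parseval_dense] applies. The finite sum [y] lies in that image, so
    [|y|^2] is at most half of [|y|^2] plus half of the partial sum at [x], and [bessel_seq]
    concludes. *)
Lemma fib_parseval (e : nat -> E) : fiber_frame e ->
  parseval [set: nat] (fib \o e).
Proof.
move=> eF.
have dense x (d : R) : 0 < d -> exists2 x', rn (x - x') < d &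
    \esum_(i in [set: nat]) (rn (cip ((fib \o e) i) x') ^+ 2)%:E = (rn x' ^+ 2)%:E.
  move=> /(fib_dense x)[v xv]; exists (fib v) => //.
  rewrite rn_fib -eF//; apply: eq_esum => i _; by rewrite /= cip_fib.
apply: parseval_dense => // x; apply: esum_nat_le => [n|n]; first exact: sqr_ge0.
have E0 : \sum_(i < n) rn (cip ((fib \o e) i) x) ^+ 2 =
    \sum_(i <- iota 0 n) rn (cip ((fib \o e) i) x) ^+ 2.
  by rewrite -(big_mkord xpredT (fun i => rn (cip ((fib \o e) i) x) ^+ 2)) /index_iota subn0.
rewrite E0; apply: bessel_seq; rewrite -E0; set S := \sum_(i < n) _ in E0 *.
set y := \sum_(i <- _) _.
have [w yw] : exists w, y = fib w.
  rewrite /y; elim/big_ind : _ => [|_ _ [v ->] [w ->]|i _].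
  - by exists 0; rewrite fib0.
  - by exists (v + w); rewrite fibD.
  - by exists ((cip (fib (e i)) x : R[i]) *: e i); rewrite fibZ.
have h1 : \sum_(i < n) rn (cip ((fib \o e) i) y) ^+ 2 <= rn y ^+ 2.
  rewrite -lee_fin; apply: le_trans
    (@le_esum_nat _ (fun i => rn (cip ((fib \o e) i) y) ^+ 2) n (fun=> sqr_ge0 _)) _.
  rewrite yw rn_fib -eF// le_esum// => i _; by rewrite /= cip_fib.
have h2 : rn y ^+ 2 = \sum_(i < n)
    complex.Re ((cip y ((fib \o e) i) : R[i]) * cip ((fib \o e) i) x).
  rewrite -[LHS]/(complex.Re (rn y ^+ 2)%:C) -cipE {2}/y cip_sumr raddf_sum/=.
  rewrite -(big_mkord xpredT (fun i => complex.Re ((cip y (fib (e i)) : R[i]) * cip (fib (e i)) x))).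
  rewrite /index_iota subn0; apply: eq_bigr => i _.
  by rewrite cipZr; congr complex.Re; exact: mulrC.
have h3 : rn y ^+ 2 <= \sum_(i < n)
    2^-1 * (rn (cip ((fib \o e) i) y) ^+ 2 + rn (cip ((fib \o e) i) x) ^+ 2).
  rewrite {1}h2; apply: ler_sum => i _; apply: (le_trans (Re_le_rn _)).
  rewrite rnM rn_cipC; set a := rn _; set b := rn _.
  by have := sqr_ge0 (a - b); nra.
rewrite -mulr_sumr big_split/= -/S in h3.
move: h1 h3; set S' := \sum_(i < n) rn (cip _ y) ^+ 2; lra.
Qed.

End fibers.

(** * A Dini theorem for characters *)

Section ultralimit.
Context {R : realType}.
Variable U : set_system nat.
Hypothesis UU : UltraFilter U.

Let UP : ProperFilter U. Proof. by case: UU. Qed.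

Lemma exists_real_ulim (u : nat -> R) (M : R) : (forall n, `|u n| <= M) ->
  exists l, forall e : R, 0 < e -> U [set n | `|l - u n| < e].
Proof.
move=> uM.
have [|l [_ ul]] := @segment_compact R (- M) M (u @ U) _ _.
  have : U [set n | u n \in `[- M, M]] by apply: filterE => n /=; rewrite in_itv/= -ler_norml.
  by [].
exists l => e e0; pose S := [set n | `|l - u n| < e].
have [//|Uc] := in_ultra_setVsetC S UU.
have US : U (u @^-1` (u @` ~` S)) by apply: filterS Uc => n ne; exists n.
have [_ [[n nS <-] ln]] := ul (u @` ~` S) (ball l e) US (nbhsx_ballx l e e0).
by case: nS; rewrite -ball_normE in ln.
Qed.

Lemma exists_ulim (u : nat -> R[i]) (M : R) : (forall n, rn (u n) <= M) ->
  exists l, forall e : R, 0 < e -> U [set n | rn (l - u n) < e].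
Proof.
move=> uM.
have [|a aP] := @exists_real_ulim (fun n => complex.Re (u n)) M.
  by move=> n; apply: le_trans (uM n); rewrite -lecR rnE normc_ge_Re.
have [|b bP] := @exists_real_ulim (fun n => complex.Im (u n)) M.
  by move=> n; apply: le_trans (uM n); rewrite -lecR rnE normc_ge_Im.
exists (a +i* b) => e e0; have e2 : 0 < e / 2 by rewrite divr_gt0.
apply: filterS2 (aP _ e2) (bP _ e2) => n /= h1 h2.
rewrite -ltcR rnE (le_lt_trans (normc_le_ReIm _))// ltcR.
by case: (u n) h1 h2 => x y /= h1 h2; rewrite (splitr e) ltrD.
Qed.

End ultralimit.

Section dini.
Context {R : realType} {A : commCStarAlgType R}.
Implicit Types (chi : A -> complexC R) (b : nat -> A).

(** Contractivity bounds the values, so ultralimits exist pointwise. The limit may be zero, the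
    character space being only locally compact; hence nonvanishing is left to the caller. *)
Lemma character_ulim (U : set_system nat) (chis : nat -> A -> complexC R) :
  UltraFilter U -> (forall n, is_character (chis n)) ->
  exists chi : A -> complexC R,
    [/\ forall x (e : R), 0 < e -> U [set n | rn (chi x - chis n x) < e],
        forall (c : R[i]) x y, chi (c *: x + y) = c *: chi x + chi y
      & forall x y, chi (cmul x y) = cmul (chi x) (chi y)].
Proof.
move=> UU chisP.
have UP : ProperFilter U by case: UU.
have /choice[chi chil] x : exists l : complexC R,
    forall e : R, 0 < e -> U [set n | rn (l - chis n x) < e].
  have [l lP] := @exists_ulim R U UU (fun n => chis n x) (rn x)
    (fun n => char_contractive (chisP n) x).
  by exists l.
exists chi.
have zero (z : complexC R) (K : R) : 0 <= K ->
    (forall e : R, 0 < e -> exists n : nat, rn z <= K * e) -> z = 0.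
  move=> K0 H; apply: rn_eq0; apply/eqP; rewrite eq_le rn_ge0 andbT.
  apply/ler_addgt0Pr => e e0; rewrite add0r.
  have K1 : 0 < K + 1 by rewrite ltr_wpDl.
  have [|_ h] := H (e / (K + 1)); first by rewrite divr_gt0.
  apply: (le_trans h); rewrite mulrCA ler_piMr ?(ltW e0)//.
  by rewrite ler_pdivrMr// mul1r lerDl.
split=> // [c x y|x y]; apply/eqP; rewrite -subr_eq0; apply/eqP.
- apply: (@zero _ (2 + rn c)) => [|e e0]; first by rewrite addr_ge0 ?rn_ge0.
  have [n [[/= h1 h2] h3]] := filter_ex (filterI (filterI (chil (c *: x + y) e e0)
    (chil x e e0)) (chil y e e0)).
  exists n.
  have -> : chi (c *: x + y) - (c *: chi x + chi y) =
      (chi (c *: x + y) - chis n (c *: x + y)) -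
      (c *: (chi x - chis n x) + (chi y - chis n y)).
    have [-> _ _] := chisP n; rewrite scalerBr addrACA -opprD.
    by rewrite opprB addrA subrK.
  rewrite (le_trans (rnD _ _))// rnN.
  have h4 := rnD (c *: (chi x - chis n x)) (chi y - chis n y).
  rewrite rnZ in h4; have h5 := rn_ge0 c; nra.
- apply: (@zero _ (1 + rn x + rn (chi y))) => [|e e0]; first by rewrite !addr_ge0 ?rn_ge0.
  have [n [[/= h1 h2] h3]] := filter_ex (filterI (filterI (chil (cmul x y) e e0)
    (chil x e e0)) (chil y e e0)).
  exists n.
  have -> : chi (cmul x y) - cmul (chi x) (chi y) =
      (chi (cmul x y) - chis n (cmul x y)) -
      (cmul (chis n x) (chi y - chis n y) + cmul (chi x - chis n x) (chi y)).
    rewrite cmulBr cmulBl; have [_ -> _] := chisP n.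
    have -> (p q r : complexC R) : (p - q) + (r - p) = r - q by rewrite addrC addrA subrK.
    by rewrite opprB addrA subrK.
  rewrite (le_trans (rnD _ _))// rnN.
  have h4 := rnD (cmul (chis n x) (chi y - chis n y)) (cmul (chi x - chis n x) (chi y)).
  have h5 := rn_cmul (chis n x) (chi y - chis n y).
  have h6 := rn_cmul (chi x - chis n x) (chi y).
  have h7 := char_contractive (chisP n) x.
  have h8 := rn_ge0 (chis n x); have h9 := rn_ge0 (chi y).
  have h10 := rn_ge0 (chi y - chis n y).
  have h11 : rn (chis n x) * rn (chi y - chis n y) <= rn x * e by apply: ler_pM => //; exact: ltW.
  have h12 : rn (chi x - chis n x) * rn (chi y) <= e * rn (chi y) by apply: ler_wpM2r => //; exact: ltW.
  lra.
Qed.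

(* Otherwise the characters realizing [|b_n| >= e] have an ultralimit on which no [b_n]
   is small. *)
Lemma dini b :
  (forall chi, is_character chi -> exists c : nat -> R,
     [/\ forall n, chi (b n) = (c n)%:C, forall n, 0 <= c n,
         forall n m, (n <= m)%N -> c m <= c n & c @ \oo --> (0 : R)]) ->
  b @ \oo --> (0 : A).
Proof.
move=> H; apply/cvg_rnP => e e0; apply: contrapT => /forallNP nb.
have mono n m : (n <= m)%N -> rn (b m) <= rn (b n).
  move=> nm; have [->|/eqP b0] := eqVneq (b m) 0; first by rewrite rn0 rn_ge0.
  have [chi chiP <-] := exists_character b0; have [c [bc c0 cm _]] := H _ chiP.
  apply: le_trans (char_contractive chiP (b n)).
  rewrite !bc (rnC (c m)) (rnC (c n)) !ger0_norm//; exact: cm.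
have big n : e < rn (b n).
  have /existsNP[m /not_implyP[nm /negP]] := nb n.
  rewrite sub0r rnN -ltNge => /lt_le_trans; apply; exact: mono.
have /choice[chis chisP] n : exists chi, is_character chi /\ rn (chi (b n)) = rn (b n).
  have [|chi chiP h] := @exists_character R A (b n); last by exists chi.
  by move=> b0; have := big n; rewrite b0 rn0 ltNge ltW.
have [U [UU oU]] := ultraFilterLemma eventually_filter.
have UP : ProperFilter U by case: UU.
have [chi [chil chi1 chi2]] := character_ulim UU (fun n => (chisP n).1).
(* For [n >= m] monotonicity gives [chis n (b m) >= chis n (b n) > e]. The resulting bound both
   keeps [chi] from being zero and contradicts convergence at [chi]. *)
have low m : e / 2 <= complex.Re (chi (b m) : R[i]).
  have e2 : 0 < e / 2 by rewrite divr_gt0.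
  have Um : U [set n | (m <= n)%N] by apply: oU; exists m.
  have [n [/= h mn]] := filter_ex (filterI (chil (b m) _ e2) Um).
  have [c [bc c0 cm _]] := H _ (chisP n).1.
  have h1 : e < c n.
    have := (chisP n).2; rewrite bc (rnC (c n)) ger0_norm// => ->; exact: big.
  have h2 := cm _ _ mn.
  have h3 : complex.Re (chis n (b m) - chi (b m) : R[i]) < e / 2.
    by apply: le_lt_trans (Re_le_rn _) _; rewrite rnB.
  by rewrite raddfB/= bc/= in h3; lra.
have chiP : is_character chi.
  split=> //; exists (b 0%N); apply/eqP => b0.
  have := low 0%N; rewrite b0 /= leNgt divr_gt0//.
have [c [bc c0 cm cc]] := H _ chiP.
have : e / 2 <= 0.
  by apply: (le_cvg0 cc) => n; have := low n; rewrite bc.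
by rewrite leNgt divr_gt0.
Qed.

End dini.

(** * The trace *)

Section traces.
Context {R : realType} {A : commCStarAlgType R} {E : hilbertModType A}.
Implicit Types (chi : A -> complexC R) (v w : E) (S T P Q : E -> E) (a : A).

Lemma iter2_abs_op (H : hilbertModType (complexC R)) (L : H -> H) : adjointable L ->
  iter 2 (abs_op L) = adj L \o L.
Proof. by move=> aL; apply: funext => x; have [_ /= -> _] := abs_opP aL. Qed.

Lemma has_trace_sq (H : hilbertModType (complexC R)) (L : H -> H) (t : \bar R) :
  adjointable L -> has_trace (adj L \o L) t <->
  exists2 B, orthonormal_basis B & t = \esum_(b in B) (rn (L b) ^+ 2)%:E.
Proof.
move=> aL; have E0 (B : set H) : \esum_(b in B) (complex.Re (cip b ((adj L \o L) b) : R[i]))%:E =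
    \esum_(b in B) (rn (L b) ^+ 2)%:E.
  apply: eq_esum => b _; congr (_%:E).
  by rewrite /= -(adjP aL) cipE.
by split=> -[B Bo ->]; exists B; rewrite ?E0.
Qed.

(** Localization respects products, adjoints and positivity, so by uniqueness of roots it commutes
    with [abs_op]. The trace of [T] with exponent 1 thereby becomes that of its root [|T|^(1/2)]
    with exponent 2. *)
Lemma iter1_abs_localize chi (H : interior_tensor E chi) T : is_character chi ->
  adjointable T ->
  iter 1 (abs_op (localize (H := H) T)) =
  iter 2 (abs_op (localize (H := H) (sqrt_op (abs_op T)))).
Proof.
move=> chiP aT; have [pV VV _] := abs_opP aT; have [pQ QQ _] := sqrt_opP pV.
have aV := psd_adjointable pV; have aQ := psd_adjointable pQ.
set Q := sqrt_op _ in pQ QQ aQ *.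
have [aLT _] := localizeP H chiP aT; have [aLQ _] := localizeP H chiP aQ.
rewrite iter2_abs_op// (adjE (localize_adjoint (H := H) chiP pQ.1)) -(localize_comp H chiP)//.
have -> : Q \o Q = abs_op T by apply: funext => v /=; rewrite QQ.
rewrite (_ : iter 1 _ = abs_op (localize (H := H) T)); last exact: funext.
apply: sqrt_opE => [|x]; first exact: localize_psd.
rewrite (adjE (localize_adjoint (H := H) chiP (adjP aT))).
rewrite -[LHS]/((localize (H := H) (abs_op T) \o localize (H := H) (abs_op T)) x).
rewrite -!(localize_comp H chiP)//; last exact: adjointable_adj.
by congr (localize _ _); apply: funext => v /=; rewrite VV.
Qed.

Variable e : nat -> E.
Hypothesis eF : fiber_frame e.

(** Exchanging the basis with the frame passes from [T] to its adjoint, and exchanging the frame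
    with itself passes back. The two equations together transport traces to adjoints. *)
Lemma trace_fiber chi (H : interior_tensor E chi) (B : set H) S T :
  is_character chi -> orthonormal_basis B -> is_adjoint T S ->
  \esum_(b in B) (rn (localize (H := H) T b) ^+ 2)%:E =
    \esum_(i in [set: nat]) (fnorm2 chi (T (e i)))%:E /\
  \esum_(b in B) (rn (localize (H := H) T b) ^+ 2)%:E =
    \esum_(i in [set: nat]) (fnorm2 chi (S (e i)))%:E.
Proof.
move=> chiP Bo TS; have ST := is_adjoint_sym TS.
have fE (P Q : E -> E) : is_adjoint P Q -> \esum_(i in [set: nat])
    (rn (localize (H := H) P ((fib H \o e) i)) ^+ 2)%:E =
    \esum_(i in [set: nat]) (fnorm2 chi (P (e i)))%:E.
  move=> PQ; apply: eq_esum => i _ /=; have [|_ ->] := @localizeP _ _ _ _ H chiP P.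
    by exists Q.
  by rewrite rn_fib.
have pf := fib_parseval (H := H) chiP eF.
have LTS := localize_adjoint (H := H) chiP TS.
have h := trace_parseval LTS (onb_parseval Bo) pf.
split; rewrite [LHS]h; last exact: fE ST.
by rewrite (trace_parseval (is_adjoint_sym LTS) pf pf); exact: fE TS.
Qed.

(** The counterpart of [is_tr_abs_pow 2] computed in [E] itself, with no choice of a model of the
    fiber. *)
Definition frame_trace2 T a := forall chi, is_character chi -> exists2 t : R,
  \esum_(i in [set: nat]) (fnorm2 chi (T (e i)))%:E = t%:E & chi a = t%:C.

Lemma tr_abs_pow2_frame T a : adjointable T -> is_tr_abs_pow 2 T a -> frame_trace2 T a.
Proof.
move=> aT trT chi chiP; have [t [H Ht] chia] := trT _ chiP; exists t => //.
have [aL _] := localizeP H chiP aT; move: Ht; rewrite iter2_abs_op//.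
move=> /(has_trace_sq _ aL)[B Bo ->].
by have [-> _] := trace_fiber chiP Bo (adjP aT).
Qed.

Section models.
Hypothesis models : forall chi, is_character chi ->
  exists H : interior_tensor E chi, exists B : set H, orthonormal_basis B.

Lemma frame_tr_abs_pow2 T a : adjointable T -> frame_trace2 T a -> is_tr_abs_pow 2 T a.
Proof.
move=> aT trT chi chiP; have [t Ht chia] := trT _ chiP; exists t => //.
have [H [B Bo]] := models chiP; exists H.
have [aL _] := localizeP H chiP aT; rewrite iter2_abs_op//.
apply/(has_trace_sq _ aL); exists B => //.
by have [-> _] := trace_fiber chiP Bo (adjP aT).
Qed.

Lemma frame_trace2_adj S T a : is_adjoint T S -> frame_trace2 T a -> frame_trace2 S a.
Proof.
move=> TS trT chi chiP; have [t Ht chia] := trT _ chiP; exists t => //.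
have [H [B Bo]] := models chiP.
by have [h1 h2] := trace_fiber chiP Bo TS; rewrite -h2 h1.
Qed.

Lemma frame_trace2_inj T a a' : frame_trace2 T a -> frame_trace2 T a' -> a = a'.
Proof.
move=> trT trT'; apply: char_inj => chi chiP.
have [t h ->] := trT _ chiP; have [t' + ->] := trT' _ chiP.
by rewrite h => -[->].
Qed.

Lemma tr_abs_pow2E T a : adjointable T -> frame_trace2 T a -> tr_abs_pow 2 T = a.
Proof.
move=> aT trT; rewrite /tr_abs_pow; case: xgetP => [a' _ trT'|].
  exact: frame_trace2_inj (tr_abs_pow2_frame aT trT') trT.
by move=> /(_ a)[]; exact: frame_tr_abs_pow2.
Qed.

End models.

Definition gram T n : A := series (fun i => cip (T (e i)) (T (e i))) n.

Lemma char_gram chi T n : is_character chi ->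
  chi (gram T n) = (\sum_(i < n) fnorm2 chi (T (e i)))%:C.
Proof.
move=> chiP; rewrite /gram /series/= big_mkord char_sum// rmorph_sum/=.
by apply: eq_bigr => i _; exact: (qformE (fiber_semi_inner chiP)).
Qed.

Lemma frame_trace2_partial chi T a n : is_character chi -> frame_trace2 T a ->
  \sum_(i < n) fnorm2 chi (T (e i)) <= complex.Re (chi a : R[i]).
Proof.
move=> chiP /(_ _ chiP)[t Ht ->]; rewrite -lee_fin -Ht /=.
by apply: le_esum_nat => i; exact: fnorm2_ge0.
Qed.

Lemma sum_fnorm2_mono chi T n m : is_character chi -> (n <= m)%N ->
  \sum_(i < n) fnorm2 chi (T (e i)) <= \sum_(i < m) fnorm2 chi (T (e i)).
Proof.
move=> chiP; move/subnKC <-; rewrite big_split_ord/= lerDl.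
by apply: sumr_ge0 => i _; exact: fnorm2_ge0.
Qed.

Lemma gram_cvg T a : frame_trace2 T a -> gram T @ \oo --> a.
Proof.
move=> trT; have : (fun n => a - gram T n) @ \oo --> (0 : A).
  apply: dini => chi chiP; have [t Ht chia] := trT _ chiP.
  exists (fun n => t - \sum_(i < n) fnorm2 chi (T (e i))); split.
  - by move=> n; rewrite charB// chia char_gram// -rmorphB.
  - by move=> n; rewrite subr_ge0 -[t]/(complex.Re t%:C) -chia frame_trace2_partial.
  - by move=> n m nm; rewrite lerD2l lerN2 sum_fnorm2_mono.
  - have a0 n : (0 <= (fnorm2 chi (T (e n)))%:E)%E by rewrite lee_fin fnorm2_ge0.
    have : (fun n => \sum_(0 <= i < n) (fnorm2 chi (T (e i)))%:E)%E @ \oo --> t%:E.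
      by rewrite -Ht -nneseries_esumT//; exact: is_cvg_nneseries.
    move=> /fine_cvg h.
    have {}h : (fun n => fine (\sum_(0 <= i < n) (fnorm2 chi (T (e i)))%:E)%E) @ \oo --> t.
      exact: h.
    have E0 : (fun n => fine (\sum_(0 <= i < n) (fnorm2 chi (T (e i)))%:E)%E) =
        (fun n => \sum_(i < n) fnorm2 chi (T (e i))).
      by apply: funext => n; rewrite sumEFin/= big_mkord.
    rewrite E0 in h.
    have h2 : (fun n => t - \sum_(i < n) fnorm2 chi (T (e i))) @ \oo --> t - t.
      by apply: cvgB; [exact: cvg_cst|exact: h].
    by rewrite subrr in h2.
move=> /cvg_rnP h; apply/cvg_rnP => d /h[N HN]; exists N => n /HN.
by rewrite sub0r rnN.
Qed.

Lemma gram_frame_trace2 T a : gram T @ \oo --> a -> frame_trace2 T a.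
Proof.
move=> Ta chi chiP.
have [im0 re] : complex.Im (chi a : R[i]) = 0 /\
    (fun n => \sum_(i < n) fnorm2 chi (T (e i))) @ \oo --> complex.Re (chi a : R[i]).
  have cv (d : R) : 0 < d -> exists N, forall n, (N <= n)%N ->
      rn (chi a - (\sum_(i < n) fnorm2 chi (T (e i)))%:C : R[i]) <= d.
    move=> /((cvg_rnP _ _).1 Ta)[N HN]; exists N => n /HN; apply: le_trans.
    by rewrite -char_gram// -(charB chiP); exact: char_contractive.
  split.
    apply/eqP; rewrite -normr_le0; apply/ler_addgt0Pr => d /cv[N /(_ N (leqnn N))].
    rewrite add0r; apply: le_trans; rewrite -lecR rnE.
    by apply: le_trans (normc_ge_Im _); rewrite raddfB/= subr0.
  apply: cvg_RP => d /cv[N HN]; exists N => n /HN; apply: le_trans.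
  rewrite -lecR rnE; apply: le_trans (normc_ge_Re _).
  by rewrite raddfB/=.
exists (complex.Re (chi a : R[i])).
  by apply: esum_nat_cvg => // n; exact: fnorm2_ge0.
by case: (chi a : R[i]) im0 => x y /= ->.
Qed.

(** In each fiber an increment of [gram P] is at most [k] times the remainders of [Q] and [S], which
    tend to zero in norm. Completeness of [A] then supplies the element [c]. *)
Lemma exists_gram_cvg P Q S a a' (k : R) : 
  (forall v chi, is_character chi -> fnorm2 chi (P v) <= k * fnorm2 chi (Q v) + k * fnorm2 chi (S v)) ->
  0 <= k ->
  frame_trace2 Q a -> frame_trace2 S a' -> exists2 c, gram P @ \oo --> c & frame_trace2 P c.
Proof.
move=> PQS k0 trQ trS.
have rate T b : frame_trace2 T b -> (fun n => rn (b - gram T n)) @ \oo --> (0 : R).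
  move=> /gram_cvg/cvg_rnP h; apply: cvg_RP => d /h[N HN]; exists N => n /HN.
  by rewrite sub0r normrN ger0_norm ?rn_ge0.
have [||c Pc _] := @cauchy_rate R A (gram P)
    (fun n => k * rn (a - gram Q n) + k * rn (a' - gram S n)).
- move=> n m nm; apply: rn_le_char => [|chi chiP].
    by rewrite addr_ge0// mulr_ge0 ?rn_ge0.
  rewrite charB// !char_gram// -rmorphB/= (rnC (_ - _)) ger0_norm; last first.
    by rewrite subr_ge0 sum_fnorm2_mono.
  have diff T b : frame_trace2 T b ->
      \sum_(i < m) fnorm2 chi (T (e i)) - \sum_(i < n) fnorm2 chi (T (e i)) <=
      rn (b - gram T n).
    move=> trT; apply: le_trans (char_contractive chiP _).
    apply: le_trans (Re_le_rn _); rewrite charB// raddfB/= char_gram//= lerB//.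
    exact: frame_trace2_partial.
  apply: le_trans (lerD (ler_wpM2l k0 (diff _ _ trQ)) (ler_wpM2l k0 (diff _ _ trS))).
  rewrite -(subnKC nm) !big_split_ord/= ![_ + _ - _]addrAC !subrr !add0r !mulr_sumr -big_split/=.
  by apply: ler_sum => i _; exact: PQS.
- rewrite -[0](addr0 (0 : R)); apply: cvgD; rewrite -(mulr0 k); apply: cvgMr; exact: rate.
by exists c => //; exact: gram_frame_trace2.
Qed.

End traces.

(** * Polarization *)

Section polarization.
Context {R : realType} {A : commCStarAlgType R} {E : hilbertModType A}.
Implicit Types (chi : A -> complexC R) (S T P Q : E -> E) (a : A).

Lemma rn_expi (k : nat) : rn ('i%C ^+ k : R[i]) = 1.
Proof.
elim: k => [|k IH]; first by rewrite expr0 (rnC 1) normr1.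
rewrite exprS rnM IH mulr1; apply: complexI; rewrite rnE normc_def/=.
by rewrite expr0n/= add0r expr1n sqrtr1.
Qed.

Lemma expi_sqr_norm (k : nat) : ('i%C ^+ k) * ('i%C ^+ k)^* = 1 :> R[i].
Proof. by rewrite -normCK -rnE rn_expi expr1n. Qed.

(** After expansion the diagonal terms carry [i^k], the term [<x, y>] carries [i^(2k)] and [<y, x>]
    carries 1; the first two coefficients sum to zero over [k]. *)
Lemma polarization (x y : E) :
  (4%:R^-1 : R[i]) *: \sum_(k < 4) ('i%C ^+ k : R[i]) *:
    cip (x + ('i%C ^+ k : R[i]) *: y) (x + ('i%C ^+ k : R[i]) *: y) = cip y x.
Proof.
have i2 : 'i%C * 'i%C = -1 :> R[i] by rewrite -expr2 sqr_i.
rewrite (eq_bigr (fun k : 'I_4 => ('i%C ^+ k : R[i]) *: (cip x x + cip y y) +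
    ((('i%C ^+ k * 'i%C ^+ k : R[i]) *: cip x y) + (1 : R[i]) *: cip y x))) => [|k _].
  rewrite !big_split/= -!scaler_suml.
  have -> : \sum_(k < 4) 'i%C ^+ k = 0 :> R[i].
    rewrite !big_ord_recr big_ord0/= add0r expr0 expr1 expr2 !exprS expr0 mulr1 i2.
    by rewrite mulrN1; ring.
  have -> : \sum_(k < 4) 'i%C ^+ k * 'i%C ^+ k = 0 :> R[i].
    rewrite !big_ord_recr big_ord0/= add0r !exprS expr0 !mulr1 i2.
    by rewrite !mulrN1 !mulrN !mulNr i2; ring.
  by rewrite !scale0r !add0r sumr_const card_ord scalerA mulVf ?scale1r// pnatr_eq0.
set z := 'i%C ^+ k.
rewrite cipDr !cipDl !cipZr !cipZl !scalerDr !scalerA -!mulrA (expi_sqr_norm k) mulr1.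
by rewrite (addrC (_ *: cip x y)) addrACA (addrC (_ *: cip y x)).
Qed.

End polarization.

(** * The trace as a sum over a frame *)

Section trace_formula.
Context {R : realType} {A : commCStarAlgType R} {E : hilbertModType A}.
Implicit Types (chi : A -> complexC R) (S T P Q : E -> E) (a : A).

Lemma weak_polarE T S : weak_polar T S -> adjointable T ->
  let Q := sqrt_op (abs_op T) in
  [/\ psd Q, forall v, S (Q v) = T v, is_adjoint S (adj S)
    & forall chi v, fnorm2 chi (S v) = fnorm2 chi (Q v)].
Proof.
move=> [aS TS aSQ] aT Q; have [pV _ _] := abs_opP aT; have [pQ _ _] := sqrt_opP pV.
have [_ SS _] := abs_opP aS; rewrite aSQ in SS.
split=> // [v||chi v]; first by rewrite [in RHS]TS.
  exact: adjP.
rewrite /fnorm2 /qform /fiber_ip (adjP aS) -[adj S (S v)]/((adj S \o S) v) -SS.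
by rewrite -pQ.1.
Qed.

(** A trace value is witnessed by a model of the fiber and an orthonormal basis of it, so membership
    of [T] supplies the models in which the traces of other operators are computed. *)
Lemma schatten1_models T : schatten 1 T -> forall chi, is_character chi ->
  exists H : interior_tensor E chi, exists B : set H, orthonormal_basis B.
Proof.
by move=> [_ [a trT]] chi /trT[t [H [B Bo _]] _]; exists H, B.
Qed.

Lemma cvg_scale (c : R[i]) (u : nat -> A) (l : A) :
  u @ \oo --> l -> (fun n => c *: u n) @ \oo --> c *: l.
Proof. by move=> ul; apply: cvgZ => //; exact: cvg_cst. Qed.

Lemma weak_polar_trace T S (e : nat -> E) : schatten 1 T -> weak_polar T S ->
  fiber_frame e ->
  series (fun i => cip (e i) (T (e i))) @ \oo -->
    schatten2_ip (adj S) (sqrt_op (abs_op T)).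
Proof.
move=> T1 TS eF; have models := schatten1_models T1; have [aT [a trT]] := T1.
have [pQ SQ SS SQn] := weak_polarE TS aT; set Q := sqrt_op _ in pQ SQ SQn *.
have aQ := psd_adjointable pQ; set S' := adj S in SS *.
have S'S := is_adjoint_sym SS.
have trQ : frame_trace2 e Q a.
  apply: tr_abs_pow2_frame => // chi chiP; have [t [H Ht] chia] := trT _ chiP.
  by exists t => //; exists H; rewrite -iter1_abs_localize.
have trS : frame_trace2 e S a.
  by move=> chi /trQ[t Ht chia]; exists t => //; rewrite -Ht; apply: eq_esum => i _; rewrite SQn.
have trS' : frame_trace2 e S' a by exact: (frame_trace2_adj eF models SS).
pose W (k : nat) v := Q v + ('i%C ^+ k : R[i]) *: S' v.
have aW k : adjointable (W k).
  by eexists; apply: is_adjointD pQ.1 _; exact: is_adjointZ S'S.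
have /choice[c cP] k : exists c, gram e (W k) @ \oo --> c /\ frame_trace2 e (W k) c.
  have [v chi chiP||c] := @exists_gram_cvg R A E e (W k) Q S' a a 2 _ _ trQ trS'.
  - apply: (le_trans (fnorm2_le2D chiP _ _)).
    by rewrite [fnorm2 chi (_ *: S' v)](qformZ (fiber_semi_inner chiP)) rn_expi expr1n mul1r.
  - by [].
  - by exists c.
have -> : schatten2_ip S' Q = (4%:R^-1 : R[i]) *: \sum_(k < 4) ('i%C ^+ k : R[i]) *: c k.
  rewrite /schatten2_ip; congr (_ *: _); apply: eq_bigr => k _; congr (_ *: _).
  exact: (tr_abs_pow2E eF models (aW k) (cP k).2).
have -> : series (fun i => cip (e i) (T (e i))) =
    (fun n => (4%:R^-1 : R[i]) *: \sum_(k < 4) ('i%C ^+ k : R[i]) *: gram e (W k) n).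
  apply: funext => n; rewrite /gram /series/=.
  under [in RHS]eq_bigr do rewrite scaler_sumr.
  rewrite exchange_big/= scaler_sumr; apply: eq_bigr => i _.
  by rewrite polarization S'S SQ.
apply: cvg_scale; rewrite !big_ord_recr big_ord0/=.
have -> : (fun n => \sum_(k < 4) ('i%C ^+ k : R[i]) *: gram e (W k) n) =
  (fun n => 0 + ('i%C ^+ 0 : R[i]) *: gram e (W 0%N) n + ('i%C ^+ 1 : R[i]) *: gram e (W 1%N) n
     + ('i%C ^+ 2 : R[i]) *: gram e (W 2%N) n + ('i%C ^+ 3 : R[i]) *: gram e (W 3%N) n).
  by apply: funext => n; rewrite !big_ord_recr big_ord0.
apply: cvgD; last exact: cvg_scale (cP 3%N).1.
apply: cvgD; last exact: cvg_scale (cP 2%N).1.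
apply: cvgD; last exact: cvg_scale (cP 1%N).1.
apply: cvgD; last exact: cvg_scale (cP 0%N).1.
exact: cvg_cst.
Qed.

End trace_formula.

Theorem proposition3p37 (R : realType) (A : commCStarAlgType R)
    (E : hilbertModType A) (hE : countably_generated E) :
  (forall T : E -> E, schatten 1 T ->
     (exists S, weak_polar T S) /\
     (forall S, weak_polar T S ->
        schatten2_ip (adj S) (sqrt_op (abs_op T)) = tr T)) /\
  (forall e : nat -> E, frame e ->
     forall T : E -> E, schatten 1 T ->
       series (fun i => cip (e i) (T (e i))) @ \oo --> tr T).
Proof.
have wd (T S : E -> E) : schatten 1 T -> weak_polar T S ->
    schatten2_ip (adj S) (sqrt_op (abs_op T)) = tr T.
  move=> T1 TS; have [e eF] := exists_fiber_frame hE.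
  have h := weak_polar_trace T1 TS eF.
  (* Whichever decomposition [xget] selects, its value is a limit of the same series. *)
  rewrite /tr; case: xgetP => [_ _ [S' TS' <-]|/(_ _ (imageP _ TS))//].
  exact: (cvg_unique (@norm_hausdorff _ A) h (weak_polar_trace T1 TS' eF)).
split=> [T T1|e eF T T1].
  split; first exact: exists_weak_polar T1.1.
  by move=> S; exact: wd.
have [S TS] := exists_weak_polar T1.1.
by rewrite -(wd T S T1 TS); apply: weak_polar_trace => //; exact: frame_fiber_frame.
Qed.
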